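(* Let $\widetilde{W}/W\in\{\widetilde{C}_n/C_n,\widetilde{B}_n/B_n,\widetilde{B}_n/D_n,\widetilde{D}_n/D_n\}$, let $w\in\widetilde{W}/W$, let $\lambda=\mathcal{C}(w)$, and let $i\in\{0,1,\dots,n\}$. If $s_i$ is an ascent for $w$ then $s_i$ acts on $\lambda$ by adding all addable $i$-components to $\lambda$. If $s_i$ is a descent for $w$ then $s_i$ acts on $\lambda$ by removing all removable $i$-components from $\lambda$. If $s_i$ is neither an ascent nor a descent for $w$ then $s_i$ does not change $\lambda$.
   Context: Groups. Let $N=2n+1$. A mirrored $\mathbb{Z}$-permutation is a bijection $w:\mathbb{Z}\to\mathbb{Z}$ with $w(i+N)=w(i)+N$ and $w(-i)=-w(i)$ for all $i\in\mathbb{Z}$; it is determined by $(w(1),\dots,w(n))$. Under composition these form the affine Coxeter group $\widetilde{C}_n$. Define elements by their images $(w(1),\dots,w(n))$: $s_i=(1,\dots,i-1,i+1,i,i+2,\dots,n)$ for $1\le i\le n-1$; $s_0^C=(-1,2,3,\dots,n)$; $s_0^D=(-2,-1,3,\dots,n)$; $s_n^C=(1,\dots,n-1,n+1)$; $s_n^D=(1,\dots,n-2,n+1,n+2)$. The four types are: - $\widetilde{C}/C$: $\widetilde{W}$ is all mirrored $\mathbb{Z}$-permutations, generators $s_0=s_0^C,s_1,\dots,s_{n-1},s_n=s_n^C$ ($n\ge2$). - $\widetilde{B}/B$: those with $|\{i\le0:w(i)\ge1\}|$ even, generators $s_0=s_0^D,s_1,\dots,s_{n-1},s_n=s_n^C$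 ($n\ge3$). - $\widetilde{B}/D$: those with $|\{i\le n:w(i)\ge n+1\}|$ even, generators $s_0=s_0^C,s_1,\dots,s_{n-1},s_n=s_n^D$ ($n\ge3$). - $\widetilde{D}/D$: those satisfying both parity conditions, generators $s_0=s_0^D,s_1,\dots,s_{n-1},s_n=s_n^D$ ($n\ge4$). $W$ is generated by $s_1,\dots,s_n$, and $\widetilde{W}/W$ denotes the set of minimal length representatives of the cosets $wW$. $\widetilde{W}$ acts on $\widetilde{W}/W$ by left multiplication of cosets. For $w\in\widetilde{W}/W$, $s_i$ is a descent if $s_iw$ has smaller Coxeter length than $w$; an ascent if $s_iw$ has larger length and $s_iw\in\widetilde{W}/W$; it is neither if $s_iwW=wW$. Abaci and cores. An abacus has runners (columns) $1,\dots,2n$; runner $i$ has entries labeled $mN+i$ for each level $m\in\mathbb{Z}$; some entries are beads, the others gaps; reading order is the order of labels; ''lowest'' means largest label; the abacus is flush if no bead is preceded by a gap on its runner. $\mathcal{A}(w)$ is the flush abacus whose lowest bead in each runner is an element of $\{w(1),\dots,w(2n)\}$. $\mathcal{C}(w)$ is the partition whose southeast boundary is the lattice path obtained by reading the entries of $\mathcal{A}(w)$ in reading order, recording a north-step for each bead and an east-step for each gap (diagrams are drawn with the first row at the top). $w\mapsto\mathcal{C}(w)$ is a bijection from $\widetilde{W}/W$ onto the symmetric $(2n)$-cores (types $\widetilde{C}/C,\widetilde{B}/D$) or the symmetric $(2n)$-cores with an even number of boxes on the main diagonal (types $\widetilde{B}/B,\widetilde{D}/D$), where a $(2n)$-core is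 a partition with no hook length divisible by $2n$; the action of $\widetilde{W}$ on these partitions is the one transported through this bijection. Residues. Entries of $\mathbb{N}^2$ are $(i,j)$ = (row, column), starting at $(1,1)$. Write $p\,\|\,q$ for the element of $\{0,\dots,q-1\}$ congruent to $p$ mod $q$. The fixed residue of $(i,j)$ is $(j-i)\|(2n)$ if this is $\le n$, and $2n-((j-i)\|(2n))$ otherwise. An escalator is a connected component of the set of $(i,j)$ with $(j-i)\|(2n)\in\{n-1,n,n+1\}$; a descalator is a connected component of the set of $(i,j)$ with $(j-i)\|(2n)$ equal to $0$, $1$ or $2n-1$. Each is called upper if it lies above the main diagonal $i=j$, lower if it lies below; the descalator containing the main diagonal is the main descalator (neither upper nor lower). Given the partition $\lambda$, residues in an upper escalator are assigned row by row: a row meets the escalator in three consecutive cells $c_1,c_2,c_3$ (left to right), and (0) if the row of $\lambda$ ends immediately to the left of $c_1$: $c_1$ has both residues $n-1$ and $n$, $c_2$ has residue $n$, $c_3$ is undefined; (1) if the row of $\lambda$ ends at $c_1$: residues $n-1,n,n$; (2) if it ends at $c_2$: residues $n,n,n-1$; (3) if it ends at $c_3$: $c_1$ undefined, $c_2$ has residue $n$, $c_3$ has both residues $n-1$ and $n$; in all other cases the residues are undefined. Residues in an upper descalator are assigned by the same rule with $n-1$ replaced by $1$ and $n$ replaced by $0$. Residues in lower escalators and descalators are assigned column by column by the transposed rule. In the main descalator, $(i,j)$ has residue $0$ if $j=i$; if $|j-i|=1$ it has residue $1$ when $i+j\equiv1$ mod $4$ and $0$ when $i+j\equiv3$ mod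 $4$. The residue assignment used is: fixed residues everywhere in type $\widetilde{C}/C$; in type $\widetilde{B}/B$, the descalator (including main descalator) rules on descalators and fixed residues elsewhere; in type $\widetilde{B}/D$, the escalator rules on escalators and fixed residues elsewhere; in type $\widetilde{D}/D$, both escalator and descalator rules, and fixed residues elsewhere. Two boxes of $\mathbb{N}^2$ are $i$-connected if they share an edge and both have residue $i$; the $i$-connected components are the $i$-components. (A cell with two residues takes part in components for each of them.) An $i$-component is addable if adding its boxes to the diagram of $\lambda$ results in a partition, and removable if removing its boxes from the diagram of $\lambda$ results in a partition. *)

(* Defs.v *)
From Stdlib Require Import Relation_Operators.
From mathcomp Require Import all_boot all_order all_algebra.
From mathcomp Require Import boolp classical_sets functions cardinality.

Set Implicit Arguments.
Unset Strict Implicit.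
Unset Printing Implicit Defensive.

Import Order.TTheory GRing.Theory Num.Theory.

Local Open Scope classical_set_scope.
Local Open Scope card_scope.
Local Open Scope ring_scope.

(* [TypeXY] stands for X~/Y: the first letter is the affine type of the big
   group, the second one the type of its parabolic subgroup. *)
Inductive quotient_type := TypeCC | TypeBB | TypeBD | TypeDD.

Definition min_rank (t : quotient_type) : nat :=
  match t with TypeCC => 2 | TypeBB => 3 | TypeBD => 3 | TypeDD => 4 end.

(* Whether s_0 is s_0^D (rather than s_0^C), and whether s_n is s_n^D (rather
   than s_n^C). *)
Definition s0_is_D (t : quotient_type) : bool :=
  match t with TypeBB | TypeDD => true | TypeCC | TypeBD => false end.
Definition sn_is_D (t : quotient_type) : bool :=
  match t with TypeBD | TypeDD => true | TypeCC | TypeBB => false end.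

Definition period (n : nat) : nat := (2 * n).+1.

Definition mirrored_perm (n : nat) (w : int -> int) : Prop :=
  [/\ bijective w,
      forall i : int, w (i + (period n)%:Z) = w i + (period n)%:Z &
      forall i : int, w (- i) = - w i].

Definition even_card (A : set int) : Prop :=
  exists2 k : nat, ~~ odd k & A #= `I_k.

Definition affine_group (t : quotient_type) (n : nat) : set (int -> int) :=
  [set w | [/\ mirrored_perm n w,
     s0_is_D t -> even_card [set i : int | i <= 0 /\ 1 <= w i] &
     sn_is_D t -> even_card [set i : int | i <= n%:Z /\ n.+1%:Z <= w i]]].

(* The map Z -> Z commuting with translation by [period n] and with negation
   whose values at 1, ..., n are f 1, ..., f n. *)
Definition mirror_ext (n : nat) (f : nat -> int) (x : int) : int :=
  let N : nat := period n in
  let q : int := (x %/ N%:Z)%Z in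
  let r : nat := `|(x %% N%:Z)%Z|%N in
  if r == 0%N then x
  else if (r <= n)%N then q * N%:Z + f r
  else q * N%:Z + (N%:Z - f (N - r)%N).

Definition window_s0C (k : nat) : int := if k == 1%N then -1 else k%:Z.
Definition window_s0D (k : nat) : int :=
  if k == 1%N then -2 else if k == 2%N then -1 else k%:Z.
Definition window_s (i k : nat) : int :=
  if k == i then i.+1%:Z else if k == i.+1 then i%:Z else k%:Z.
Definition window_snC (n k : nat) : int := if k == n then n.+1%:Z else k%:Z.
Definition window_snD (n k : nat) : int :=
  if k == n.-1 then n.+1%:Z else if k == n then n.+2%:Z else k%:Z.

Definition gen (t : quotient_type) (n : nat) (i : 'I_n.+1) : int -> int :=
  mirror_ext n
    (if i == 0%N :> nat then if s0_is_D t then window_s0D else window_s0C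
     else if i == n :> nat then
       if sn_is_D t then window_snD n else window_snC n
     else window_s i).

Definition word_prod (t : quotient_type) (n : nat) (s : seq 'I_n.+1) :
    int -> int :=
  foldr (fun i w => gen t i \o w) id s.

(* The value is 0 when w is not a product of generators. *)
Definition len (t : quotient_type) (n : nat) (w : int -> int) : nat :=
  xget 0%N [set k : nat |
    (exists2 s : seq 'I_n.+1, size s = k & word_prod t s = w) /\
    (forall s : seq 'I_n.+1, word_prod t s = w -> (k <= size s)%N)].

(* Words suffice to describe the generated subgroup since the generators are
   involutions. *)
Definition parabolic (t : quotient_type) (n : nat) : set (int -> int) :=
  [set u | exists2 s : seq 'I_n.+1,
     (forall i, i \in s -> (0 < i)%N) & u = word_prod t s].

Definition left_coset (t : quotient_type) (n : nat) (w : int -> int) :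
    set (int -> int) :=
  [set w \o u | u in parabolic t n].

Definition min_reps (t : quotient_type) (n : nat) : set (int -> int) :=
  [set w | affine_group t n w /\
     forall v, left_coset t n w v -> (len t n w <= len t n v)%N].

Definition descent (t : quotient_type) (n : nat) (i : 'I_n.+1)
    (w : int -> int) : Prop :=
  (len t n (gen t i \o w) < len t n w)%N.

Definition ascent (t : quotient_type) (n : nat) (i : 'I_n.+1)
    (w : int -> int) : Prop :=
  (len t n w < len t n (gen t i \o w))%N /\ min_reps t n (gen t i \o w).

(* Labels m (2n+1) + i with i in {1, ..., 2n}. *)
Definition entry (n : nat) : set int :=
  [set b : int | (b %% (period n)%:Z)%Z != 0].

(* The flush abacus of w, as its set of beads: on each runner, the entries up
   to the lowest bead, which is the w(j), 1 <= j <= 2n, lying on it. *)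
Definition abacus (n : nat) (w : int -> int) : set int :=
  [set b : int | entry n b /\
     exists j : nat, [/\ (1 <= j <= 2 * n)%N,
       (b = w j%:Z %[mod (period n)%:Z])%Z & b <= w j%:Z]].

Definition gaps (n : nat) (w : int -> int) : set int :=
  entry n `\` abacus n w.

(* Diagrams are sets of boxes (row, column) with 1-based coordinates. *)
Definition diagram := set (nat * nat).

Definition is_partition (D : diagram) : Prop :=
  [/\ finite_set D,
      forall i j, D (i, j) -> (0 < i)%N /\ (0 < j)%N &
      forall i j i' j', D (i, j) ->
        (0 < i' <= i)%N -> (0 < j' <= j)%N -> D (i', j')].

(* On the boundary path, read from the southwest to the northeast, the row i
   is bounded by the i-th north-step (bead) from the end, and the column j by
   the j-th east-step (gap) from the start; the box (i, j) is in the diagram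
   when that gap is read before that bead. *)
Definition core (n : nat) (w : int -> int) : diagram :=
  [set p | exists b g : int,
     [/\ abacus n w b, gaps n w g, g < b,
         [set b' | abacus n w b' /\ b <= b'] #= `I_(p.1) &
         [set g' | gaps n w g' /\ g' <= g] #= `I_(p.2)]].

(* The default values of [xget] in the next two definitions are not used on
   affine_group t n, resp. on the image of min_reps t n by core n. *)
Definition min_rep (t : quotient_type) (n : nat) (w : int -> int) :
    int -> int :=
  xget (fun x : int => x) [set v : int -> int | min_reps t n v /\ left_coset t n v = left_coset t n w].

Definition core_inv (t : quotient_type) (n : nat) (D : diagram) : int -> int :=
  xget (fun x : int => x) [set w : int -> int | min_reps t n w /\ core n w = D].

Definition act (t : quotient_type) (n : nat) (g : int -> int) (D : diagram) :
    diagram :=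
  core n (min_rep t n (g \o core_inv t n D)).

(* (j - i) || (2n) *)
Definition diag_class (n i j : nat) : nat :=
  `|((j%:Z - i%:Z) %% (2 * n)%:Z)%Z|%N.

Definition fixed_residue (n i j : nat) : nat :=
  let c := diag_class n i j in if (c <= n)%N then c else (2 * n - c)%N.

(* The diagonals of the escalators and of the descalators, from left to right
   along a row. In the ranks where they are used, every component is a strip
   of three consecutive diagonals. *)
Definition escalator (n : nat) : seq nat := [:: n.-1; n; n.+1].
Definition descalator (n : nat) : seq nat := [:: (2 * n).-1; 0%N; 1%N].

Definition row_ends (D : diagram) (i c : nat) : Prop :=
  forall j, (0 < j)%N -> D (i, j) <-> (j <= c)%N.

Definition transpose (D : diagram) : diagram := [set p | D (p.2, p.1)].

(* The residues of the k-th cell c_(k+1) of a row of a strip when the row of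
   the partition ends d cells after the one preceding c_1; (a, b) is (n-1, n)
   for escalators and (1, 0) for descalators. *)
Definition strip_residues (a b d k : nat) : seq nat :=
  match d, k with
  | 0, 0 => [:: a; b] | 0, 1 => [:: b]
  | 1, 0 => [:: a]    | 1, 1 => [:: b] | 1, 2 => [:: b]
  | 2, 0 => [:: b]    | 2, 1 => [:: b] | 2, 2 => [:: a]
                      | 3, 1 => [:: b] | 3, 2 => [:: a; b]
  | _, _ => [::]
  end%N.

Definition upper_residue (strip : seq nat) (a b n : nat) (D : diagram)
    (i j r : nat) : Prop :=
  let k := index (diag_class n i j) strip in
  exists2 d : nat, row_ends D i ((j - k).-1 + d)%N &
    r \in strip_residues a b d k.

Definition strip_residue (strip : seq nat) (a b n : nat) (D : diagram)
    (i j r : nat) : Prop :=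
  if (i < j)%N then upper_residue strip a b n D i j r
  else upper_residue strip a b n (transpose D) j i r.

Definition main_residue (i j r : nat) : Prop :=
  if i == j then r = 0%N
  else if ((i + j) %% 4 == 1)%N then r = 1%N else r = 0%N.

Definition has_residue (t : quotient_type) (n : nat) (D : diagram) (r : nat)
    (p : nat * nat) : Prop :=
  let: (i, j) := p in
  let c := diag_class n i j in
  [/\ (0 < i)%N, (0 < j)%N &
    if sn_is_D t && (c \in escalator n) then
      strip_residue (escalator n) n.-1 n n D i j r
    else if s0_is_D t && (c \in descalator n) then
      if (i <= j.+1)%N && (j <= i.+1)%N then main_residue i j r
      else strip_residue (descalator n) 1 0 n D i j r
    else r = fixed_residue n i j].

Definition share_edge (p q : nat * nat) : Prop :=
  (p.1 = q.1 /\ (p.2 = q.2.+1 \/ q.2 = p.2.+1)) \/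
  (p.2 = q.2 /\ (p.1 = q.1.+1 \/ q.1 = p.1.+1)).

Definition connected (t : quotient_type) (n : nat) (D : diagram) (r : nat)
    (p q : nat * nat) : Prop :=
  [/\ share_edge p q, has_residue t n D r p & has_residue t n D r q].

Definition component (t : quotient_type) (n : nat) (D : diagram) (r : nat) :
    set diagram :=
  [set K | exists2 p, has_residue t n D r p &
     K = [set q | clos_refl_trans _ (connected t n D r) p q]].

(* Only boxes outside (inside) the diagram can be added to (removed from) it. *)
Definition addable (D K : diagram) : Prop :=
  K `&` D = set0 /\ is_partition (D `|` K).

Definition removable (D K : diagram) : Prop :=
  K `<=` D /\ is_partition (D `\` K).

Definition add_components (t : quotient_type) (n : nat) (r : nat)
    (D : diagram) : diagram :=
  D `|` \bigcup_(K in [set K | component t n D r K /\ addable D K]) K.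

Definition remove_components (t : quotient_type) (n : nat) (r : nat)
    (D : diagram) : diagram :=
  D `\` \bigcup_(K in [set K | component t n D r K /\ removable D K]) K.

(* Main.v *)
(* Put u = w^-1 and N = 2n + 1. An entry b is a bead of the abacus of w exactly
   when u b < N, so s_i acts on abaci by permuting entries. Number the entries
   in reading order and let F c be the number of beads beyond position c; the
   box (i, j) lies in the core of w iff i <= F (j - i). The generator s_i
   exchanges neighbouring positions, or for s_0^D and s_n^D positions at
   distance two, and thereby changes F only near the diagonals congruent to i or
   -i modulo 2n. Near such a diagonal the two (resp. four) exchanged positions
   determine the residues and the addable and removable components: if s_i moves
   the beads consistently forward (backward) the boxes gained (lost) are the
   addable (removable) i-components, and any other component of residue i either
   meets both the diagram and its complement or is blocked by a neighbouring box.
   The symmetry b <-> 2N - b and the flushness of the abacus exclude the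
   configurations above the main diagonal for which this would fail, and on the
   main descalator the evenness of F 0 puts the boxes into 2 x 2 blocks.

   Whether beads move forward or backward is decided by comparing u x / N and
   u y / N, where s_i is the reflection exchanging x < y. An exchange argument on
   words shows that u y < u x forces len (s_i w) < len w, and this identifies
   the three cases with ascents, descents and fixed cosets. *)
From Stdlib Require Import Relation_Operators Operators_Properties.
Require Import Defs.
From mathcomp Require Import all_boot all_order all_algebra.
From mathcomp Require Import boolp classical_sets functions cardinality.
From mathcomp Require Import zify.

Set Implicit Arguments.
Unset Strict Implicit.
Unset Printing Implicit Defensive.

Import Order.TTheory GRing.Theory Num.Theory.

Local Open Scope classical_set_scope.
Local Open Scope card_scope.
Local Open Scope ring_scope.

(** * Generators and affine roots *)

(** The group is given by parity conditions but the length by words, so the two descriptions must be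
    matched: [energy] drops along right descents, and an element without right descents is the
    identity up to the values -1 at 1 and n + 1 at n, which parity excludes. A generator of type D
    also reverses pairs that no reflection of the group exchanges ([s_0^D] reverses -1 < 1), so the
    exchange argument is confined to [affine_root]. The comparison of quotients is written with
    thresholds, [u y < m * N -> u x < m * N] for all m: thresholds are preserved by the parabolic
    subgroup and pass to translates and negatives of a pair. If both directions hold, the new core
    is the old one enlarged and also the old one diminished, hence equal to it. [act] chooses a
    preimage and a representative; this is harmless because a core determines its beads and the
    beads depend only on the coset. Strips off the main diagonal are studied above it, and
    transposition gives those below. *)

Lemma periodE n : (period n)%:Z = 2 * n%:Z + 1.
Proof. by rewrite /period; lia. Qed.

(** Products [q * N] of two unknowns are opaque to [lia]. This split is linear in the atoms [q * N]
    and [q' * N], which lets it compare quotients. *)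
Lemma mulz_cases (N q q' : int) : 0 <= N ->
  [\/ q' = q, q' = q + 1, q' * N >= q * N + 2 * N | q' * N <= q * N - N].
Proof.
move=> N0; have [->|[->|[h|h]]] : q' = q \/ q' = q + 1 \/ q + 2 <= q' \/ q' <= q - 1.
- by lia.
- by constructor 1.
- by constructor 2.
- by constructor 3; have := ler_wpM2r N0 h; lia.
- by constructor 4; have := ler_wpM2r N0 h; lia.
Qed.

Section Reflections.

Variable n : nat.
Local Notation N := ((period n)%:Z).

Lemma centered_div (x : int) :
  exists q r : int, x = q * N + r /\ - n%:Z <= r <= n%:Z.
Proof.
have e := periodE n; have := divz_eq x N.
have [r0 rN] : 0 <= (x %% N)%Z /\ (x %% N)%Z < N by split; lia.
case: (lerP (x %% N)%Z n) => h xE.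
  by exists (x %/ N)%Z, (x %% N)%Z; split=> //; lia.
by exists ((x %/ N)%Z + 1), ((x %% N)%Z - N); split; lia.
Qed.

(** Remainders between -n and n, rather than between 0 and 2n, make oddness visible: on them the
    extension is the odd function prolonging [f]. *)
Lemma mirror_ext_centered f (q r : int) : - n%:Z <= r <= n%:Z ->
  mirror_ext n f (q * N + r) =
  q * N + (if r == 0 then 0 else if 0 < r then f `|r|%N else - f `|r|%N).
Proof.
have e := periodE n => hr; rewrite /mirror_ext.
have [r0|r0] := lerP 0 r.
  have -> : ((q * N + r) %% N)%Z = r by rewrite modzMDl modz_small; lia.
  have -> : ((q * N + r) %/ N)%Z = q by rewrite divzMDl ?divz_small; lia.
  have [->|h] := eqVneq r 0; first by rewrite addr0.
  rewrite absz_eq0 (negPf h).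
  have -> : (`|r| <= n)%N by lia.
  by have -> : 0 < r by lia.
have -> : q * N + r = (q - 1) * N + (N + r) by lia.
have -> : (((q - 1) * N + (N + r)) %% N)%Z = N + r by rewrite modzMDl modz_small; lia.
have -> : (((q - 1) * N + (N + r)) %/ N)%Z = q - 1.
  by rewrite divzMDl ?divz_small; lia.
have [h|h] := eqVneq (absz (N + r)) 0%N; first by lia.
have [h'|h'] := leqP (absz (N + r)) n; first by lia.
have -> : (r == 0) = false by lia.
have -> : (0 < r) = false by lia.
have -> : (period n - absz (N + r)%R = `|r|)%N by lia.
by lia.
Qed.

Definition multiple (x : int) : Prop := exists m : int, x = m * N.

(** The affine reflection of a pair: for an odd periodic map, exchanging x and y forces the exchange
    of their negatives and of all translates. Fixing everything else makes the map unique. *)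
Definition reflects (x y : int) (r : int -> int) : Prop :=
  [/\ forall m : int, r (x + m * N) = y + m * N,
      forall m : int, r (y + m * N) = x + m * N,
      forall m : int, r (- x + m * N) = - y + m * N,
      forall m : int, r (- y + m * N) = - x + m * N &
      forall z, (forall m, [/\ z <> x + m * N, z <> y + m * N,
        z <> - x + m * N & z <> - y + m * N]) -> r z = z].

Lemma reflects_uniq x y r r' : reflects x y r -> reflects x y r' -> r = r'.
Proof.
move=> [a1 a2 a3 a4 a5] [b1 b2 b3 b4 b5]; apply/funext => z.
have [[m [->|[->|[->|->]]]]|h] := EM (exists m : int, z = x + m * N \/
  (z = y + m * N \/ (z = - x + m * N \/ z = - y + m * N))).
- by rewrite a1 b1.
- by rewrite a2 b2.
- by rewrite a3 b3.
- by rewrite a4 b4.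
have h' : forall m, [/\ z <> x + m * N, z <> y + m * N,
        z <> - x + m * N & z <> - y + m * N].
  by move=> m; split=> e; apply: h; exists m; tauto.
by rewrite a5 // b5.
Qed.

Lemma reflects_translate x y k r : reflects x y r ->
  reflects (x + k * N) (y + k * N) r.
Proof.
move=> [a1 a2 a3 a4 a5]; split=> [m|m|m|m|z h].
- have -> : x + k * N + m * N = x + (k + m) * N by lia.
  by rewrite a1; lia.
- have -> : y + k * N + m * N = y + (k + m) * N by lia.
  by rewrite a2; lia.
- have -> : - (x + k * N) + m * N = - x + (m - k) * N by lia.
  by rewrite a3; lia.
- have -> : - (y + k * N) + m * N = - y + (m - k) * N by lia.
  by rewrite a4; lia.
by apply: a5 => m; split=> e; [case: (h (m - k))|case: (h (m - k))
  |case: (h (m + k))|case: (h (m + k))]; lia.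
Qed.

Lemma reflects_opp x y r : reflects x y r -> reflects (- y) (- x) r.
Proof.
move=> [a1 a2 a3 a4 a5]; split=> [m|m|m|m|z h]; rewrite ?opprK //.
by apply: a5 => m; have := h m; rewrite !opprK => -[].
Qed.

Lemma reflects_conj x y r (s : int -> int) :
  involutive s -> (forall z m : int, s (z + m * N) = s z + m * N) ->
  (forall z : int, s (- z) = - s z) -> reflects x y r ->
  reflects (s x) (s y) (s \o r \o s).
Proof.
move=> sK sN sO [a1 a2 a3 a4 a5]; split=> [m|m|m|m|z h] /=.
- by rewrite sN sK a1 sN.
- by rewrite sN sK a2 sN.
- by rewrite sN sO sK a3 sN sO.
- by rewrite sN sO sK a4 sN sO.
rewrite a5 ?sK // => m; have [h1 h2 h3 h4] := h m.
split=> e; [apply: h1|apply: h2|apply: h3|apply: h4];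
  by rewrite -[z]sK e sN ?sO.
Qed.

End Reflections.

Section Generators.

Variables (t : quotient_type) (n : nat).
Local Notation N := ((period n)%:Z).

(** Each generator is pinned down by one pair that it exchanges. The larger member can be i + 1 in
    all five cases, so only the smaller one depends on the type. *)
Definition root1 (i : nat) : int :=
  if i == 0%N then if s0_is_D t then - 2 else - 1
  else if (i == n) && sn_is_D t then n%:Z - 1 else i%:Z.

Definition root2 (i : nat) : int := i%:Z + 1.

Variant gen_spec (i : nat) (g : int -> int) : Type :=
| GenS of (0 < i < n)%N & root1 i = i%:Z &
    (forall q r : int, - n%:Z <= r <= n%:Z -> g (q * N + r) = q * N +
       (if r == i then i%:Z + 1 else if r == i%:Z + 1 then i%:Z
        else if r == - i%:Z then - i%:Z - 1 else if r == - i%:Z - 1 then - i%:Z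
        else r))
| Gen0C of i = 0%N & s0_is_D t = false & root1 i = - 1 &
    (forall q r : int, - n%:Z <= r <= n%:Z -> g (q * N + r) = q * N +
       (if r == 1 then - 1 else if r == - 1 then 1 else r))
| Gen0D of i = 0%N & s0_is_D t = true & (2 < n)%N & root1 i = - 2 &
    (forall q r : int, - n%:Z <= r <= n%:Z -> g (q * N + r) = q * N +
       (if r == 1 then - 2 else if r == 2 then - 1
        else if r == - 1 then 2 else if r == - 2 then 1 else r))
| GennC of i = n & sn_is_D t = false & (1 < n)%N & root1 i = n%:Z &
    (forall q r : int, - n%:Z <= r <= n%:Z -> g (q * N + r) = q * N +
       (if r == n then n%:Z + 1 else if r == - n%:Z then - n%:Z - 1 else r))
| GennD of i = n & sn_is_D t = true & (2 < n)%N & root1 i = n%:Z - 1 &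
    (forall q r : int, - n%:Z <= r <= n%:Z -> g (q * N + r) = q * N +
       (if r == n%:Z - 1 then n%:Z + 1 else if r == n then n%:Z + 2
        else if r == - n%:Z + 1 then - n%:Z - 1
        else if r == - n%:Z then - n%:Z - 2 else r)).

Hypothesis hn : (min_rank t <= n)%N.

Lemma rank_gt1 : (1 < n)%N. Proof. by move: hn; case: t => /=; lia. Qed.
Lemma rank_s0D : s0_is_D t -> (2 < n)%N.
Proof. by move: hn; case: t => /=; lia. Qed.
Lemma rank_snD : sn_is_D t -> (2 < n)%N.
Proof. by move: hn; case: t => /=; lia. Qed.

Lemma genP (i : 'I_n.+1) : gen_spec i (gen t i).
Proof.
have n1 := rank_gt1; have nD := rank_s0D; have nD' := rank_snD.
rewrite /gen; have [i0|i0] := eqVneq (i : nat) 0%N.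
  case: (boolP (s0_is_D t)) => [h|/negbTE h].
    apply: Gen0D; [by []|by []|exact: nD|by rewrite /root1 i0 h|move=> q r hr].
    rewrite mirror_ext_centered //; congr (_ + _).
    by rewrite /window_s0D; case: (ltrP 0 r) => ?; do ![case: eqP => ?]; lia.
  apply: Gen0C; [by []|by []|by rewrite /root1 i0 h|move=> q r hr].
  rewrite mirror_ext_centered //; congr (_ + _).
  by rewrite /window_s0C; case: (ltrP 0 r) => ?; do ![case: eqP => ?]; lia.
have [iN|iN] := eqVneq (i : nat) n.
  case: (boolP (sn_is_D t)) => [h|/negbTE h].
    apply: GennD; [by []|by []|exact: nD'|by rewrite /root1 (negPf i0) iN eqxx h|move=> q r hr].
    rewrite mirror_ext_centered //; congr (_ + _).
    by rewrite /window_snD; case: (ltrP 0 r) => ?; do ![case: eqP => ?]; lia.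
  apply: GennC; [by []|by []|by []|by rewrite /root1 (negPf i0) h andbF iN|move=> q r hr].
  rewrite mirror_ext_centered //; congr (_ + _).
  by rewrite /window_snC; case: (ltrP 0 r) => ?; do ![case: eqP => ?]; lia.
apply: GenS; [by have := ltn_ord i; lia|by rewrite /root1 (negPf i0) (negPf iN)|].
move=> q r hr; rewrite mirror_ext_centered //; congr (_ + _).
by rewrite /window_s; case: (ltrP 0 r) => ?; do ![case: eqP => ?]; lia.
Qed.

Lemma gen_period (i : 'I_n.+1) (x m : int) : gen t i (x + m * N) = gen t i x + m * N.
Proof.
have [q [r [-> hr]]] := centered_div n x.
have -> : q * N + r + m * N = (q + m) * N + r by lia.
by case: (genP i) => [_ _ E|_ _ _ E|_ _ _ _ E|_ _ _ _ E|_ _ _ _ E]; rewrite !E //; lia.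
Qed.

Ltac gen_cases i E :=
  case: (genP i) => [? R1 E|? ? R1 E|? ? ? R1 E|? ? ? R1 E|? ? ? R1 E].

Lemma gen_opp (i : 'I_n.+1) (x : int) : gen t i (- x) = - gen t i x.
Proof.
have [q [r [-> hr]]] := centered_div n x.
have -> : - (q * N + r) = (- q) * N + (- r) by lia.
have hr' : - n%:Z <= - r <= n%:Z by lia.
have e := periodE n.
by gen_cases i E; rewrite !E //; do ?[case: eqP => ?]; lia.
Qed.

Lemma genK (i : 'I_n.+1) : involutive (gen t i).
Proof.
move=> x; have [q [r [-> hr]]] := centered_div n x.
have e := periodE n; have n1 := rank_gt1.
gen_cases i E; rewrite E //.
- by do ?[case: eqP => ?]; rewrite E; do ?[case: eqP => ?]; lia.
- by do ?[case: eqP => ?]; rewrite E; do ?[case: eqP => ?]; lia.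
- by do ?[case: eqP => ?]; rewrite E; do ?[case: eqP => ?]; lia.
(* In the two [s_n] cases the images leave the centred window, so they are rewritten around the
   neighbouring multiple of N before the formula is applied again. *)
- do ?[case: eqP => ?].
  + have -> : q * N + (n%:Z + 1) = (q + 1) * N + (- n%:Z) by lia.
    by rewrite E; do ?[case: eqP => ?]; lia.
  + have -> : q * N + (- n%:Z - 1) = (q - 1) * N + n%:Z by lia.
    by rewrite E; do ?[case: eqP => ?]; lia.
  + by rewrite E; do ?[case: eqP => ?]; lia.
- do ?[case: eqP => ?].
  + have -> : q * N + (n%:Z + 1) = (q + 1) * N + (- n%:Z) by lia.
    by rewrite E; do ?[case: eqP => ?]; lia.
  + have -> : q * N + (n%:Z + 2) = (q + 1) * N + (- n%:Z + 1) by lia.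
    by rewrite E; do ?[case: eqP => ?]; lia.
  + have -> : q * N + (- n%:Z - 1) = (q - 1) * N + n%:Z by lia.
    by rewrite E; do ?[case: eqP => ?]; lia.
  + have -> : q * N + (- n%:Z - 2) = (q - 1) * N + (n%:Z - 1) by lia.
    by rewrite E; do ?[case: eqP => ?]; lia.
  + by rewrite E; do ?[case: eqP => ?]; lia.
Qed.

Lemma gen_mirrored (i : 'I_n.+1) : mirrored_perm n (gen t i).
Proof.
split=> [|x|]; [by exists (gen t i); apply: genK| |exact: gen_opp].
by have := gen_period i x 1; rewrite mul1r.
Qed.

Lemma gen_reflects (i : 'I_n.+1) : reflects n (root1 i) (root2 i) (gen t i).
Proof.
have K x y : gen t i x = y -> gen t i y = x by move=> <-; rewrite genK.
have e := periodE n; have n1 := rank_gt1.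
suff [h h'] : gen t i (root1 i) = root2 i /\
    forall z, (forall m, [/\ z <> root1 i + m * N, z <> root2 i + m * N,
        z <> - root1 i + m * N & z <> - root2 i + m * N]) -> gen t i z = z.
  split=> [m|m|m|m|//]; rewrite gen_period ?gen_opp ?h //; by rewrite (K _ _ h).
split.
  rewrite /root2 -[X in gen _ _ X]add0r -(mul0r N).
  by gen_cases i E; rewrite R1 E; do ?[case: eqP => //= ?]; lia.
move=> z hz; have [q [r [ze hr]]] := centered_div n z.
have := hz q; have := hz (q + 1); have := hz (q - 1).
rewrite /root2 ze.
by gen_cases i E; rewrite R1 E // => -[? ? ? ?] [? ? ? ?] [? ? ? ?];
  do ?[case: eqP => //= ?]; lia.
Qed.

(* Among the reflections of the group of type C/C, those with x + y an even (odd)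
   multiple of N are the conjugates of s_0^C (of s_n^C); they are lost when the
   corresponding generator is of type D. *)
Definition affine_root (x y : int) : Prop :=
  [/\ ~ multiple n x, ~ multiple n y,
    s0_is_D t -> forall m : int, x + y <> 2 * m * N &
    sn_is_D t -> forall m : int, x + y <> (2 * m + 1) * N].

(** A simple reflection makes no positive root negative but its own. Entries move by at most 3, so
    the quotients of x < y with reversed images are equal or consecutive, and a finite check on
    remainders is left. *)
Lemma gen_inversion (i : 'I_n.+1) x y : affine_root x y ->
  x < y -> gen t i y < gen t i x -> reflects n x y (gen t i).
Proof.
have e := periodE n; have n1 := rank_gt1.
move=> [hx hy h0 h1] xy gxy.
have R := gen_reflects i.
suff [m [[-> ->]|[-> ->]]] : exists m : int,
    (x = root1 i + m * N /\ y = root2 i + m * N) \/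
    (x = - root2 i + m * N /\ y = - root1 i + m * N).
- exact: reflects_translate.
- by apply: reflects_translate; apply: reflects_opp.
have [q [r [xe hr]]] := centered_div n x; have [q' [r' [ye hr']]] := centered_div n y.
have r0 : r <> 0 by move=> r0; apply: hx; exists q; lia.
have r0' : r' <> 0 by move=> r0'; apply: hy; exists q'; lia.
have N0 : 0 <= N by lia.
have near (z : int) : gen t i z - 3 <= z <= gen t i z + 3.
  have [p [s [-> hs]]] := centered_div n z.
  by gen_cases i E; rewrite E //; do ![case: eqP => //= ?]; lia.
have {near} [Q|Q] : q' = q \/ q' = q + 1.
- have := near x; have := near y; move: gxy; rewrite xe ye.
  by have [Q|Q|Q|Q] := mulz_cases q q' N0; [left|right| |]; lia.
- subst q'; have {gxy xy} [rr g] : r < r' /\ gen t i y < gen t i x by lia.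
  rewrite xe ye.
  suff : (r = root1 i /\ r' = root2 i) \/ (r = - root2 i /\ r' = - root1 i).
    by move=> [[-> ->]|[-> ->]]; exists q; [left|right]; split; apply: addrC.
  (* This discards -1 < 1 and -2 < 2, which [s_0^D] reverses as well. *)
  have {}h0 : s0_is_D t -> r + r' <> 0 by move=> h; have := h0 h q; lia.
  rewrite /root2; move: g; rewrite xe ye.
  gen_cases i E; rewrite R1 !E // ltrD2l => {E xe ye h1 R R1 hx hy N0}; do ![case: eqP => //= ?]; first [clear h0; lia|lia].
- subst q'; have {gxy xy} [rr g] : r < r' + N /\ gen t i y < gen t i x by lia.
  rewrite xe ye.
  suff : (r = root1 i /\ r' = root2 i - N) \/ (r = N - root2 i /\ r' = - root1 i).
    by move=> [[-> ->]|[-> ->]]; [exists q; left|exists (q + 1); right]; split; lia.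
  (* Likewise for [s_n^D] and the pairs n < n + 1 and n - 1 < n + 2, whose sum is N. *)
  have {}h1 : sn_is_D t -> r + r' <> 0 by move=> h; have := h1 h q; lia.
  rewrite /root2; move: g; rewrite xe ye.
  gen_cases i E; rewrite R1 !E // mulrDl mul1r -addrA ltrD2l => {E xe ye h0 R R1 hx hy N0}; do ![case: eqP => //= ?]; first [clear h1; lia|lia].
Qed.

Lemma gen_le0 (i : 'I_n.+1) (x : int) : i != 0%N :> nat -> (gen t i x <= 0) = (x <= 0).
Proof.
have e := periodE n; have N0 : 0 <= N by lia.
have [q [r [-> hr]]] := centered_div n x.
have Q : [\/ q = 0, q = -1, q * N >= N | q * N <= - 2 * N].
  have [->|h|h|h] := mulz_cases q 0 N0; [constructor 1|constructor 2|constructor 4|constructor 3]; lia.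
gen_cases i E; rewrite E //; do ![case: eqP => //= ?]; case: Q => Q; rewrite ?Q; lia.
Qed.

Lemma gen_len (i : 'I_n.+1) (x : int) : i != n :> nat -> (gen t i x <= n) = (x <= n).
Proof.
have e := periodE n; have N0 : 0 <= N by lia.
have [q [r [-> hr]]] := centered_div n x.
have Q : [\/ q = 0, q = 1, q * N >= 2 * N | q * N <= - N].
  have [->|h|h|h] := mulz_cases 0 q N0; [constructor 1|constructor 2|constructor 3|constructor 4]; lia.
gen_cases i E; rewrite E //; do ![case: eqP => //= ?]; case: Q => Q; rewrite ?Q; lia.
Qed.

(** The threshold 0 is carried to N by x -> N - x. This is the threshold that separates beads from
    gaps. *)
Lemma gen_ltN (i : 'I_n.+1) (x : int) : i != 0%N :> nat -> (gen t i x < N) = (x < N).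
Proof.
move=> i0; have := gen_le0 (N - x) i0.
rewrite -[N - x]opprB gen_opp.
have -> : x - N = x + (- 1) * N by lia.
by rewrite gen_period; lia.
Qed.

Lemma gen0D_le0 (i : 'I_n.+1) (x : int) : i = 0%N :> nat -> s0_is_D t ->
  (gen t i x <= 0) = (x <= 0) (+) (x \in [:: -2; -1; 1; 2]).
Proof.
have e := periodE n; have N0 : 0 <= N by lia.
have [q [r [-> hr]]] := centered_div n x.
have Q : [\/ q = 0, q = -1, q * N >= N | q * N <= - 2 * N].
  have [->|h|h|h] := mulz_cases q 0 N0; [constructor 1|constructor 2|constructor 4|constructor 3]; lia.
have n1 := rank_gt1.
gen_cases i E => i0 sD; rewrite ?E //; last 3 first.
- rewrite !inE; case: Q => Q; rewrite ?Q ?mul0r ?add0r;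
    do ![case: eqP => //= ?]; lia.
all: lia.
Qed.

Lemma gennD_len (i : 'I_n.+1) (x : int) : i = n :> nat -> sn_is_D t ->
  (gen t i x <= n) = (x <= n) (+) (x \in [:: n%:Z - 1; n%:Z; n%:Z + 1; n%:Z + 2]).
Proof.
have e := periodE n; have N0 : 0 <= N by lia.
have [q [r [-> hr]]] := centered_div n x.
have Q : [\/ q = 0, q = 1, q * N >= 2 * N | q * N <= - N].
  have [->|h|h|h] := mulz_cases 0 q N0; [constructor 1|constructor 2|constructor 3|constructor 4]; lia.
have n1 := rank_gt1.
gen_cases i E => i0 sD; rewrite ?E //; last 1 first.
  rewrite !inE; case: Q => Q; rewrite ?Q ?mul0r ?add0r;
   do ![case: eqP => //= ?]; lia.
all: lia.
Qed.

End Generators.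
(** * Words, lengths and minimal representatives *)

Section Parity.

Variable T : Type.

Definition toggle (a : T) (A : set T) : set T :=
  [set x | (x = a /\ ~ A x) \/ (x <> a /\ A x)].

Lemma toggle_card (a : T) (A : set T) k :
  A #= `I_k -> exists2 k', odd k' = ~~ odd k & toggle a A #= `I_k'.
Proof.
move=> Ak; have [Aa|Aa] := EM (A a).
  have -> : toggle a A = A `\ a.
    apply/seteqP; split=> x; rewrite /toggle /=.
      by move=> [[-> //]|[xa Ax]]; split.
    by move=> [Ax xa]; right.
  have : finite_set (A `\ a).
    by apply: (sub_finite_set (@subDsetl _ _ _)); apply/finite_setP; exists k.
  move=> /finite_setP[m Am]; exists m => //.
  have Am' : A #= `I_m.+1 by apply/eq_cardSP; exists a.
  have /card_eq_II -> : `I_k #= `I_m.+1.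
    by apply: card_eq_trans Am'; rewrite card_eq_sym.
  by rewrite /= negbK.
exists k.+1 => //; apply/eq_cardSP; exists a; first by left.
have -> // : toggle a A `\ a = A.
apply/seteqP; split=> x; rewrite /toggle /=.
  by move=> [[[-> //]|[xa Ax]] _].
move=> Ax; have xa : x <> a by move=> xa; apply: Aa; rewrite -xa.
by split=> //; right.
Qed.

End Parity.

(** A generator of type D changes the set of its own parity condition in exactly two elements, which
    is why the parity survives. *)
Lemma even_card_toggle2 (a b : int) (A C : set int) : a <> b ->
  (forall x, x <> a -> x <> b -> C x <-> A x) ->
  (C a <-> ~ A a) -> (C b <-> ~ A b) -> even_card A -> even_card C.
Proof.
move=> ab h ha hb [k ko Ak].
have [k1 o1 A1] := toggle_card a Ak; have [k2 o2 A2] := toggle_card b A1.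
exists k2; first by rewrite o2 o1 negbK.
have -> // : C = toggle b (toggle a A).
apply/seteqP; split=> x; rewrite /toggle /=; have [->|xa] := EM (x = a);
 have [xb|xb] := EM (x = b); try (by subst); subst; try have := h _ xa xb; tauto.
Qed.

(** * Mirrored permutations and their inverses *)

Section Mirrored.

Variable n : nat.
Local Notation N := ((period n)%:Z).

Definition inverses (w u : int -> int) := cancel w u /\ cancel u w.

Lemma mirrored_inverse w : mirrored_perm n w -> exists u, inverses w u.
Proof. by move=> [[u wu uw] _ _]; exists u. Qed.

Lemma mirrored_shift w (x m : int) : mirrored_perm n w ->
  w (x + m * N) = w x + m * N.
Proof.
move=> [_ wN _].
have H (k : nat) (y : int) : w (y + k%:Z * N) = w y + k%:Z * N.
  elim: k => [|k IH]; first by rewrite !mul0r !addr0.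
  have -> : k.+1%:Z = k%:Z + 1 by lia.
  by rewrite mulrDl mul1r addrA wN IH; lia.
case: m => k; first exact: H.
have := H k.+1 (x - k.+1%:Z * N); rewrite subrK NegzE mulNr => ->.
by rewrite addrK.
Qed.

Lemma mirrored_id : mirrored_perm n id.
Proof. by split=> //; exists id. Qed.

Lemma mirrored_comp w v : mirrored_perm n w -> mirrored_perm n v ->
  mirrored_perm n (w \o v).
Proof.
move=> [wb wN wo] [vb vN vo]; split=> [|x|x] /=; first exact: bij_comp.
- by rewrite vN wN.
- by rewrite vo wo.
Qed.

Lemma mirrored_inv w u : mirrored_perm n w -> inverses w u -> mirrored_perm n u.
Proof.
move=> [_ wN wo] [wu uw]; split; first by exists w.
- by move=> x; apply: (can_inj wu); rewrite uw wN uw.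
- by move=> x; apply: (can_inj wu); rewrite uw wo uw.
Qed.

Lemma inversesC w u : inverses w u -> inverses u w.
Proof. by case. Qed.

Lemma mirrored0 w : mirrored_perm n w -> w 0 = 0.
Proof. by move=> [_ _ wo]; have := wo 0; rewrite oppr0; move: (w 0) => z; lia. Qed.

Lemma mirrored_multiple w x : mirrored_perm n w ->
  multiple n (w x) <-> multiple n x.
Proof.
move=> wm; have H v y : mirrored_perm n v -> multiple n y -> multiple n (v y).
  move=> vm [m ->]; exists m.
  by have := mirrored_shift 0 m vm; rewrite !add0r (mirrored0 vm) add0r.
have [u [wu uw]] := mirrored_inverse wm; split; last exact: H.
by move=> h; rewrite -[x]wu; apply: H => //; exact: mirrored_inv wm _.
Qed.

Lemma mirrored_sum w x y m : mirrored_perm n w ->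
  x + y = m * N <-> w x + w y = m * N.
Proof.
move=> wm; have H v a b : mirrored_perm n v -> a + b = m * N -> v a + v b = m * N.
  move=> vm ab; have -> : b = - a + m * N by lia.
  by rewrite mirrored_shift //; case: vm => _ _ ->; lia.
have [u [wu uw]] := mirrored_inverse wm; split; first exact: H.
by move=> h; rewrite -[x]wu -[y]wu; apply: H => //; exact: mirrored_inv wm _.
Qed.

End Mirrored.

(** * Exchange property, and closure of the groups under generators and inverses *)

Section Group.

Variables (t : quotient_type) (n : nat).
Local Notation N := ((period n)%:Z).
Hypothesis hn : (min_rank t <= n)%N.

Lemma inverses_gen (i : 'I_n.+1) w u : inverses w u ->
  inverses (gen t i \o w) (u \o gen t i).
Proof.
move=> [wu uw]; split=> x /=; first by rewrite genK.
by rewrite uw genK.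
Qed.

(** The excluded sums x + y are multiples of N, and an odd periodic bijection preserves x + y = m N.
    Hence a root can be followed along a word. *)
Lemma affine_root_image w x y : mirrored_perm n w ->
  affine_root t n x y -> affine_root t n (w x) (w y).
Proof.
move=> wm [hx hy h0 h1]; split.
- by move=> /(proj1 (mirrored_multiple _ wm)).
- by move=> /(proj1 (mirrored_multiple _ wm)).
- by move=> h m /(proj2 (mirrored_sum x y _ wm)); apply: h0.
- by move=> h m /(proj2 (mirrored_sum x y _ wm)); apply: h1.
Qed.

Lemma word_prod_cat (s1 s2 : seq 'I_n.+1) :
  word_prod t (s1 ++ s2) = word_prod t s1 \o word_prod t s2.
Proof. by elim: s1 => //= i s1 ->. Qed.

Lemma word_prod_rcons (s : seq 'I_n.+1) i :
  word_prod t (rcons s i) = word_prod t s \o gen t i.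
Proof. by rewrite -cats1 word_prod_cat. Qed.

Lemma word_prod_mirrored (s : seq 'I_n.+1) : mirrored_perm n (word_prod t s).
Proof.
elim: s => [|i s IH] /=; first exact: mirrored_id.
by apply: mirrored_comp => //; apply: gen_mirrored.
Qed.

Lemma word_prod_rev (s : seq 'I_n.+1) :
  inverses (word_prod t s) (word_prod t (rev s)).
Proof.
elim: s => [|i s [IH1 IH2]] //=; rewrite rev_cons word_prod_rcons.
by apply: inverses_gen.
Qed.

(* Along the word the root (x, y) must become negative at some letter, and at
   that letter it is the root of the letter, which can then be deleted. *)
Lemma exchange (s : seq 'I_n.+1) (a b x y : int) r :
  affine_root t n x y -> reflects n x y r ->
  word_prod t s a = x -> word_prod t s b = y -> x < y -> b < a ->
  exists s' : seq 'I_n.+1, size s = (size s').+1 /\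
    word_prod t s' = r \o word_prod t s.
Proof.
elim: s x y r => [|j s IH] x y r xyr rr /=; first by move=> -> ->; lia.
move=> sa sb xy ba.
have gj : mirrored_perm n (gen t j) by exact: gen_mirrored.
have [h|h|h] := ltgtP (gen t j x) (gen t j y).
- have [||||s' [e1 e2]] := IH (gen t j x) (gen t j y) (gen t j \o r \o gen t j) _ _ _ _ h ba.
  + exact: affine_root_image.
  + apply: reflects_conj => //; first exact: genK.
    * by move=> z m; rewrite gen_period.
    * by move=> z; rewrite gen_opp.
  + by rewrite -sa genK.
  + by rewrite -sb genK.
  exists (j :: s'); rewrite /= e1 e2; split=> //.
  by apply/funext => z /=; rewrite genK.
- exists s; split=> //; apply/funext => z /=.
  by rewrite (reflects_uniq rr (gen_inversion hn xyr xy h)) genK.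
- by have := inv_inj (genK hn j) h; lia.
Qed.

(** Both parity conditions have this shape, with h = 0 and h = n, so one argument serves for
    both. *)
Definition ramp_set (h : int) (w : int -> int) : set int :=
  [set x : int | x <= h /\ h + 1 <= w x].

(** The generator carries e1, e2 and their mirror images across the threshold. Of the preimages of e
    and k - e exactly one, [fold e], is at most h, so membership changes at [fold e1] and [fold e2]
    only. The mirror constant k is 0 for h = 0 and N for h = n. *)
Lemma ramp_set_gen (h k e1 e2 : int) g w u : inverses w u ->
  (forall z : int, u (k - z) = k - u z) ->
  (u e1 <= h) = ~~ (k - u e1 <= h) -> (u e2 <= h) = ~~ (k - u e2 <= h) ->
  e1 <> e2 -> e1 <> k - e2 ->
  (forall z : int, (g z <= h) = (z <= h) (+) (z \in [:: k - e2; k - e1; e1; e2])) ->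
  even_card (ramp_set h w) -> even_card (ramp_set h (g \o w)).
Proof.
move=> [wu uw] uk h1 h2 e12 e12' gh.
pose fold e := if u e <= h then u e else k - u e.
have wk (z : int) : w (k - z) = k - w z by apply: (can_inj uw); rewrite wu uk wu.
have wf (e : int) : (w (fold e) = e /\ fold e = u e) \/ (w (fold e) = k - e /\ fold e = k - u e).
  by rewrite /fold; case: ifP => _; [left|right]; rewrite ?wk uw.
have fh (e : int) : (u e <= h) = ~~ (k - u e <= h) -> fold e <= h.
  by rewrite /fold; case: ifP => //; lia.
have f1 := fh _ h1; have f2 := fh _ h2.
apply: (@even_card_toggle2 (fold e1) (fold e2)).
- have := wf e1; have := wf e2 => A B C; rewrite C in B; lia.
- move=> x x1 x2; rewrite /ramp_set /=.
  have [xh|xh] := lerP x h; last by split; lia.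
  suff : w x \notin [:: k - e2; k - e1; e1; e2].
    by have := gh (w x); move=> /[swap] /negbTE ->; rewrite addbF; lia.
  have K (e : int) : (u e <= h) = ~~ (k - u e <= h) -> x <> fold e -> w x <> e /\ w x <> k - e.
    rewrite /fold => he; case: ifP => ue xe; split=> we.
    - by apply: xe; rewrite -we wu.
    - have := wu x; rewrite we uk => ex; lia.
    - by have := wu x; rewrite we => ex; lia.
    - by apply: xe; rewrite -[x]wu we uk.
  have [? ?] := K _ h1 x1; have [? ?] := K _ h2 x2.
  by rewrite !inE; apply/negP; lia.
- have := gh (w (fold e1)); rewrite /ramp_set /= !inE; have := wf e1; lia.
- have := gh (w (fold e2)); rewrite /ramp_set /= !inE; have := wf e2; lia.
Qed.

Lemma affine_gen_l (i : 'I_n.+1) w :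
  affine_group t n w -> affine_group t n (gen t i \o w).
Proof.
move=> [wm w0 w1]; have n1 := rank_gt1 hn; have nD := rank_s0D hn; have nD' := rank_snD hn.
have e := periodE n.
have [u wu] := mirrored_inverse wm; have um := mirrored_inv wm wu.
have unz (z : int) : 0 < z < N -> u z <> 0.
  move=> hz uz; case: wu => _ uw; have := uw z; rewrite uz (mirrored0 wm); lia.
have uo (z : int) : u (- z) = - u z by case: um.
split; first by apply: mirrored_comp => //; apply: gen_mirrored.
- move=> sD; have := w0 sD.
  rewrite -[X in even_card X -> _]/(ramp_set 0 w) -[X in _ -> even_card X]/(ramp_set 0 _).
  have [i0|i0] := eqVneq (i : nat) 0%N.
    apply: (@ramp_set_gen 0 0 1 2 _ _ _ wu); rewrite ?sub0r //.
    + by move=> z; rewrite !sub0r.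
    + have := @unz 1; lia.
    + have := @unz 2; have := nD sD; lia.
    + by move=> z; rewrite gen0D_le0.
  suff -> : ramp_set 0 (gen t i \o w) = ramp_set 0 w by [].
  by apply/seteqP; split=> x; rewrite /ramp_set /=; have := gen_le0 hn (w x) i0; lia.
- move=> sD; have := w1 sD.
  have -> : n.+1%:Z = n%:Z + 1 by lia.
  rewrite -[X in even_card X -> _]/(ramp_set n w) -[X in _ -> even_card X]/(ramp_set n _).
  have uN (z : int) : u (N - z) = N - u z.
    by rewrite addrC -[X in _ + X]mul1r mirrored_shift // uo; lia.
  have [i0|i0] := eqVneq (i : nat) n.
    apply: (@ramp_set_gen n N (n%:Z + 1) (n%:Z + 2) _ _ _ wu) => //; rewrite ?e; try lia.
    + move=> z; rewrite (gennD_len hn) //; congr (_ (+) _).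
      by rewrite !inE; lia.
  suff -> : ramp_set n (gen t i \o w) = ramp_set n w by [].
  by apply/seteqP; split=> x; rewrite /ramp_set /=; have := gen_len hn (w x) i0; lia.
Qed.

(** The injective map x -> k - w x carries the set counted for w onto the set counted for its
    inverse, with k = 0 or k = N as before. *)
Lemma affine_inv w u : inverses w u -> affine_group t n w -> affine_group t n u.
Proof.
move=> wu [wm w0 w1]; have um := mirrored_inv wm wu.
have [wuK uwK] := wu; have e := periodE n.
have K (h k : int) : (forall z : int, z <= h -> u (k - z) = k - u z) ->
    (forall x, x <= h -> h + 1 <= w x -> k - w x <= h /\ h + 1 <= k - x) ->
    (forall x, x <= h -> h + 1 <= u x -> k - u x <= h /\ h + 1 <= k - x) ->
    (forall z : int, w (k - z) = k - w z) ->
    even_card (ramp_set h w) -> even_card (ramp_set h u).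
  move=> uk hw hu wk [m mo Am]; exists m => //.
  apply: card_eq_trans Am.
  have -> : ramp_set h u = (fun x => k - w x) @` ramp_set h w.
    apply/seteqP; split=> x /=.
      move=> [xh hx]; have [a b] := hu _ xh hx.
      by exists (k - u x); [split=> //; rewrite wk uwK|rewrite wk uwK; lia].
    move=> [y [yh hy] <-]; have [a b] := hw _ yh hy.
    split=> //; have -> // : u (k - w y) = k - y.
    by apply: (can_inj wuK); rewrite uwK wk.
  apply: inj_card_eq => x y _ _ /= exy.
  by apply: (can_inj wuK); lia.
have uo (z : int) : u (- z) = - u z by case: um.
have wo (z : int) : w (- z) = - w z by case: wm.
split=> //.
- move=> /w0; apply: (K 0 0).
  + by move=> z _; rewrite !sub0r.
  + move=> x; have [->|] := eqVneq x 0; first by rewrite (mirrored0 wm).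
    by lia.
  + move=> x; have [->|] := eqVneq x 0; first by rewrite (mirrored0 um).
    by lia.
  + by move=> z; rewrite !sub0r.
- have en : n.+1%:Z = n%:Z + 1 by lia.
  rewrite en in w1 *; move=> /w1; apply: (K n N); try (by move=> x; lia).
  + by move=> z _; rewrite addrC -[X in _ + X]mul1r mirrored_shift // uo; lia.
  + by move=> z; rewrite addrC -[X in _ + X]mul1r mirrored_shift // wo; lia.
Qed.

Lemma affine_gen_r (i : 'I_n.+1) w :
  affine_group t n w -> affine_group t n (w \o gen t i).
Proof.
move=> wg; have [wm _ _] := wg; have [u wu] := mirrored_inverse wm.
have ug := affine_gen_l i (affine_inv wu wg).
apply: affine_inv ug; apply: inverses_gen; exact: inversesC.
Qed.

End Group.
Lemma ltr_sum_change (n : nat) (F G : nat -> int) (s : seq nat) :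
  uniq s -> all (gtn n) s ->
  (forall k, (k < n)%N -> k \notin s -> G k = F k) ->
  \sum_(k <- s) G k < \sum_(k <- s) F k -> \sum_(k < n) G k < \sum_(k < n) F k.
Proof.
move=> us sn GF lt.
have split_sum (H : nat -> int) : \sum_(k < n) H k =
    \sum_(k <- s) H k + \sum_(0 <= k < n | k \notin s) H k.
  rewrite -(big_mkord predT H) (bigID (mem s)) /=; congr (_ + _).
  rewrite -big_filter; apply: perm_big; apply: uniq_perm => //.
    by rewrite filter_uniq // iota_uniq.
  move=> k; rewrite mem_filter mem_index_iota /=.
  by case ks: (k \in s) => //=; have /allP/(_ _ ks) := sn.
rewrite !split_sum (_ : \sum_(0 <= k < n | k \notin s) G k =
    \sum_(0 <= k < n | k \notin s) F k) ?ltrD2r //.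
by rewrite big_nat_cond [RHS]big_nat_cond; apply: eq_bigr => k /andP[/andP[_ kn] /GF->].
Qed.

(** * Length, and minimality of coset representatives *)

Section Length.

Variables (t : quotient_type) (n : nat).
Local Notation N := ((period n)%:Z).
Hypothesis hn : (min_rank t <= n)%N.

Lemma near_zero (g f : int -> int) :
  (forall q r : int, - n%:Z <= r <= n%:Z -> g (q * N + r) = q * N + f r) ->
  forall r : int, - n%:Z <= r <= n%:Z -> g r = f r.
Proof. by move=> E r /(E 0); rewrite mul0r !add0r. Qed.

(* The squared distance of (w 1, ..., w n) to the point (1, ..., n) of the
   fundamental alcove: it decreases when a right descent is removed. *)
Definition energy (w : int -> int) : int :=
  \sum_(k < n) (w k.+1%:Z - k.+1%:Z) ^+ 2.

(** Right multiplication reflects the point (w 1, ..., w n) in a wall of the fundamental alcove. In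
    the five cases the energy drops by 2, 2, 6, 1 and 4 times [w (root1 t n i) - w (root2 i)]. *)
Lemma energy_gen (i : 'I_n.+1) w : mirrored_perm n w ->
  w (root2 i) < w (root1 t n i) -> energy (w \o gen t i) < energy w.
Proof.
move=> wm; have e := periodE n; have n1 := rank_gt1 hn.
have wo (z : int) : w (- z) = - w z by case: wm.
have wN (z : int) : w (N - z) = N - w z.
  by rewrite addrC -[X in _ + X]mul1r mirrored_shift // wo; lia.
rewrite /energy /root2.
case: (genP hn i) => [i0 -> E|i0 sD -> E|i0 sD n2 -> E|i0 sD n2 -> E|i0 sD n2 -> E] d;
  have {}E := near_zero E; rewrite /= in E.
- apply: (@ltr_sum_change n (fun k => (w k.+1%:Z - k.+1%:Z) ^+ 2)
     (fun k => ((w \o gen t i) k.+1%:Z - k.+1%:Z) ^+ 2) [:: i.-1; i : nat]).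
  + by rewrite /= inE; lia.
  + by rewrite /=; lia.
  + move=> k kn; rewrite !inE /= E; last by lia.
    by do ![case: eqP => //= ?]; lia.
  rewrite !big_cons !big_nil /= !E; try lia.
  have -> : i.-1.+1 = i :> nat by lia.
  rewrite !eqxx; have -> : (i.+1%:Z == i) = false by lia.
  have -> : i.+1%:Z == i%:Z + 1 by lia.
  move: d; have -> : i.+1%:Z = i%:Z + 1 by lia.
  by move: (w 1) => x; rewrite !expr2; lia.
- apply: (@ltr_sum_change n (fun k => (w k.+1%:Z - k.+1%:Z) ^+ 2)
     (fun k => ((w \o gen t i) k.+1%:Z - k.+1%:Z) ^+ 2) [:: 0%N]) => //.
  + by rewrite /=; lia.
  + move=> k kn; rewrite !inE /= E; last by lia.
    by do ![case: eqP => //= ?]; lia.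
  rewrite !big_cons !big_nil /= !E; try lia.
  move: d; rewrite i0 add0r -[1%Z]/(1 : int) (_ : (1 == 1 :> int) = true) // !wo.
  by move: (w 1) => x; rewrite !expr2; lia.
- apply: (@ltr_sum_change n (fun k => (w k.+1%:Z - k.+1%:Z) ^+ 2)
     (fun k => ((w \o gen t i) k.+1%:Z - k.+1%:Z) ^+ 2) [:: 0%N; 1%N]) => //.
  + by rewrite /=; lia.
  + move=> k kn; rewrite !inE /= E; last by lia.
    by do ![case: eqP => //= ?]; lia.
  rewrite !big_cons !big_nil /= !E; try lia.
  move: d; rewrite i0 add0r -[1%Z]/(1 : int) -[2%Z]/(2 : int).
  rewrite (_ : (1 == 1 :> int) = true) // (_ : (2 == 1 :> int) = false) //.
  by rewrite (_ : (2 == 2 :> int) = true) // !wo; move: (w 1) (w 2) => x y; rewrite !expr2; lia.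
- apply: (@ltr_sum_change n (fun k => (w k.+1%:Z - k.+1%:Z) ^+ 2)
     (fun k => ((w \o gen t i) k.+1%:Z - k.+1%:Z) ^+ 2) [:: n.-1]) => //.
  + by rewrite /=; lia.
  + move=> k kn; rewrite !inE /= E; last by lia.
    by do ![case: eqP => //= ?]; lia.
  rewrite !big_cons !big_nil /= !E; try lia.
  have -> : n.-1.+1 = n :> nat by lia.
  move: d; rewrite eqxx i0; have -> : n%:Z + 1 = N - n%:Z by lia.
  by rewrite wN e !expr2; lia.
- apply: (@ltr_sum_change n (fun k => (w k.+1%:Z - k.+1%:Z) ^+ 2)
     (fun k => ((w \o gen t i) k.+1%:Z - k.+1%:Z) ^+ 2) [:: n.-2; n.-1]) => //.
  + by rewrite /= inE; lia.
  + by rewrite /=; lia.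
  + move=> k kn; rewrite !inE /= E; last by lia.
    by do ![case: eqP => //= ?]; lia.
  rewrite !big_cons !big_nil /= !E; try lia.
  have -> : n.-1.+1 = n :> nat by lia.
  have -> : n.-2.+1 = n.-1 :> nat by lia.
  have -> : n.-1%:Z = n%:Z - 1 by lia.
  rewrite !eqxx; have -> : (n%:Z == n%:Z - 1) = false by lia.
  move: d; rewrite i0; have -> : n%:Z + 1 = N - n%:Z by lia.
  have -> : n%:Z + 2 = N - (n%:Z - 1) by lia.
  by rewrite !wN e !expr2; lia.
Qed.

Lemma even_card_set1 (A : set int) (a : int) :
  (forall x, A x <-> x = a) -> ~ even_card A.
Proof.
move=> Aa [k ko Ak]; have eA : A = [set a] by apply/seteqP; split=> x /Aa.
suff /card_eq_II k1 : `I_k #= `I_1 by rewrite k1 in ko.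
by rewrite eA card_eq_sym in Ak; apply: card_eq_trans Ak card_set1.
Qed.

(** The integers w 1, ..., w n increase and are hemmed in at both ends by the conditions at [s_0]
    and [s_n], which forces w k = k for 2 <= k < n. In type D the end values may still be -1 and n +
    1, but then the set of a parity condition would be a singleton. *)
Lemma affine_no_descent w : affine_group t n w ->
  (forall i : 'I_n.+1, w (root1 t n i) < w (root2 i)) -> w = id.
Proof.
move=> [wm par0 parn] asc; have e := periodE n; have n1 := rank_gt1 hn.
have wo (z : int) : w (- z) = - w z by case: wm.
have wN (z : int) : w (N - z) = N - w z.
  by rewrite addrC -[X in _ + X]mul1r mirrored_shift // wo; lia.
pose v (k : nat) := w k%:Z.
have inc (k : nat) : (0 < k < n)%N -> v k < v k.+1.
  move=> hk; have ki : (k < n.+1)%N by lia.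
  have := asc (Ordinal ki); rewrite /root1 /root2 /= /v.
  have -> : (k == 0%N) = false by lia.
  have -> : (k == n) = false by lia.
  by have -> : k.+1%:Z = k%:Z + 1 by lia.
have h0 := asc ord0; have hmax := asc ord_max; move: h0 hmax.
rewrite /root1 /root2 /= add0r -[1 : int]/(1%N%:Z) eqxx.
have -> : (n == 0%N) = false by lia.
have -> : n%:Z + 1%N%:Z = N - n%:Z by lia.
rewrite wN andTb => h0 hmax.
have v1 : v 1%N <> 0.
  move=> v10; have [wb _ _] := wm; have := bij_inj wb.
  by move=> /(_ 1%N%:Z 0); rewrite -/(v 1%N) v10 (mirrored0 wm) => /(_ erefl).
have {}h0 : if s0_is_D t then - v 2%N < v 1%N else 0 < v 1%N.
  rewrite /v; move: h0; case: (s0_is_D t).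
    by rewrite -[- 2]/(- (2%N%:Z)) wo.
  by rewrite -[- 1]/(- (1%N%:Z)) wo; move: (w 1%N) => z; lia.
have {}hmax : if sn_is_D t then v n.-1 < N - v n else v n < N - v n.
  move: hmax; rewrite /v; case: (sn_is_D t) => //.
  by have -> : n%:Z - 1%N%:Z = n.-1%:Z by lia.
have lower (k : nat) : (2 <= k <= n)%N -> k%:Z <= v k.
  elim: k => [|k IH] hk; first by lia.
  have [k1|k1] := eqVneq k 1%N.
    subst k; have := inc 1%N n1; move: h0; case: (s0_is_D t) => /=; lia.
  by have := IH _; have := inc k; lia.
have upper (k : nat) : (k < n)%N -> v (n - k.+1)%N <= (n - k.+1)%N%:Z.
  elim: k => [|k IH] hk.
    have := inc n.-1; have -> : n.-1.+1 = n by lia.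
    by rewrite subn1; move: hmax; case: (sn_is_D t) => /=; lia.
  have [k1|k1] := eqVneq (n - k.+2)%N 0%N.
    by rewrite k1 /v (mirrored0 wm).
  have := inc (n - k.+2)%N; have -> : (n - k.+2).+1 = (n - k.+1)%N by lia.
  by have := IH; lia.
have mid (k : nat) : (2 <= k < n)%N -> v k = k%:Z.
  move=> hk; have := lower k; have := upper (n - k.+1)%N.
  have -> : (n - (n - k.+1).+1)%N = k by lia.
  by lia.
have v1E : v 1%N = 1 \/ (s0_is_D t /\ v 1%N = -1).
  have := upper (n - 2)%N; have -> : (n - (n - 2).+1)%N = 1%N by lia.
  move: h0 (rank_s0D hn); case: (s0_is_D t) => /= h0 h2; last by lia.
  have := mid 2%N; have := inc 1%N; lia.
have vnE : v n = n%:Z \/ (sn_is_D t /\ v n = n%:Z + 1).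
  have := lower n.
  move: hmax (rank_snD hn); case: (sn_is_D t) => /= hmax h2; last by lia.
  have := mid n.-1; lia.
have wE (q r : int) : w (q * N + r) = q * N + w r.
  by rewrite addrC mirrored_shift // addrC.
have wr (r : int) : - n%:Z <= r <= n%:Z ->
    exists2 k : nat, (r = k%:Z /\ w r = v k \/ r = - k%:Z /\ w r = - v k) & (k <= n)%N.
  move=> hr; exists `|r|%N; last by lia.
  rewrite /v; case: (lerP 0 r) => r0; [left|right].
    by rewrite gez0_abs.
  by rewrite ltz0_abs // wo !opprK.
have v0 : v 0%N = 0 by exact: (mirrored0 wm).
have vE (k : nat) : (k <= n)%N -> k = 0%N \/ k = 1%N \/ k = n \/ v k = k%:Z.
  have := mid k; lia.
have bound (r : int) : - n%:Z <= r <= n%:Z -> `|w r| <= n%:Z + 1.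
  by move=> /wr[k H kn]; have K := vE k kn; case: K => [K|[K|[K|K]]]; rewrite ?K in H; lia.
have N0 : 0 <= N by lia.
have {}v1E : v 1%N = 1.
  case: v1E => // -[sD v1E]; case: (@even_card_set1 _ (- 1%N%:Z) _ (par0 sD)).
  move=> x /=; split; last by move=> ->; rewrite wo -/(v 1%N) v1E.
  have [q [r [-> hr]]] := centered_div n x; rewrite wE => -[].
  have := bound r hr; have [k H kn] := wr r hr; have K := vE k kn.
  have [Q|Q|Q|Q] := mulz_cases q 0 N0; try lia.
  by rewrite -Q; case: K => [K|[K|[K|K]]]; rewrite ?K in H; lia.
have {}vnE : v n = n%:Z.
  case: vnE => // -[sD vnE]; case: (@even_card_set1 _ n%:Z _ (parn sD)).
  move=> x /=; split; last by move=> ->; rewrite -/(v n) vnE; lia.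
  have [q [r [-> hr]]] := centered_div n x; rewrite wE => -[].
  have := bound r hr; have [k H kn] := wr r hr; have K := vE k kn.
  have [Q|Q|Q|Q] := mulz_cases q 0 N0; try lia.
  by rewrite -Q; case: K => [K|[K|[K|K]]]; rewrite ?K in H; lia.
apply/funext => x; have [q [r [-> hr]]] := centered_div n x; rewrite wE.
have [k H kn] := wr r hr; have K := vE k kn.
by case: K => [K|[K|[K|K]]]; rewrite ?K in H; rewrite /=; lia.
Qed.

(** Right descents are stripped off while there are any. The energy is a nonnegative integer, so
    this stops, and it stops at the identity. *)
Lemma affine_word w : affine_group t n w ->
  exists s : seq 'I_n.+1, word_prod t s = w.
Proof.
have [m] := ubnP (absz (energy w)); elim: m w => // m IH w wm wg.
have [mir _ _] := wg.
have [[i wi]|asc] := EM (exists i : 'I_n.+1, w (root2 i) < w (root1 t n i)).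
  have E0 : 0 <= energy (w \o gen t i).
    by apply: sumr_ge0 => k _; exact: sqr_ge0.
  have [||s sE] := IH (w \o gen t i).
  - by have := energy_gen mir wi; lia.
  - exact: affine_gen_r.
  exists (rcons s i); rewrite word_prod_rcons sE.
  by apply/funext => x /=; rewrite genK.
exists [::]; rewrite /= (@affine_no_descent w) // => i.
have [//|h|h] := ltgtP (w (root1 t n i)) (w (root2 i)).
  by case: asc; exists i.
have [wb _ _] := mir; have := bij_inj wb h.
by have := ltn_ord i; have := rank_gt1 hn; rewrite /root1 /root2; do ![case: ifP => //= ?]; lia.
Qed.

Lemma word_affine (s : seq 'I_n.+1) : affine_group t n (word_prod t s).
Proof.
elim: s => [|i s IH] /=; last exact: affine_gen_l.
split; first exact: mirrored_id.
all: move=> _; exists 0%N => //; have -> : `I_0 = set0 :> set nat by apply/seteqP; split.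
all: by rewrite card_eq0; apply/eqP/seteqP; split=> x //=; lia.
Qed.

(** Since every element of the group is a word, the default of [xget] does not occur and [len] is
    the true Coxeter length. *)
Lemma lenP w : affine_group t n w ->
  (exists2 s : seq 'I_n.+1, size s = len t n w & word_prod t s = w) /\
  (forall s : seq 'I_n.+1, word_prod t s = w -> (len t n w <= size s)%N).
Proof.
move=> /affine_word[s sw]; rewrite /len; case: xgetP => // /(_ _) none.
have ex : exists k, `[< exists2 s : seq 'I_n.+1, size s = k & word_prod t s = w >].
  by exists (size s); apply/asboolP; exists s.
have [k /asboolP kw kmin] := ex_minnP ex.
by case: (none k); split=> // s' s'w; apply: kmin; apply/asboolP; exists s'.
Qed.

Lemma root_affine (i : 'I_n.+1) : affine_root t n (root1 t n i) (root2 i).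
Proof.
have e := periodE n; have n1 := rank_gt1 hn; have N0 : 0 <= N by lia.
have K (c d : int) : 0 < c < N -> c <> d * N.
  by move=> c0 cd; have [Q|Q|Q|Q] := mulz_cases 0 d N0; subst; lia.
have K' (c d : int) : 0 < c < N -> - c <> d * N.
  by move=> c0 cd; apply: (K c (- d)) => //; lia.
have K0 (d : int) : (2 * d + 1) * N <> 0.
  by move=> cd; have [Q|Q|Q|Q] := mulz_cases 0 (2 * d + 1) N0; lia.
have KN (d : int) : N <> 2 * d * N.
  by move=> cd; have [Q|Q|Q|Q] := mulz_cases 0 (2 * d) N0; lia.
split.
- move=> [m]; rewrite /multiple.
  case: (genP hn i) => [i0 -> _|i0 sD -> _|i0 sD n2 -> _|i0 sD n2 -> _|i0 sD n2 -> _];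
  first [by apply: K; lia|by apply: K'; lia].
- by move=> [m]; rewrite /root2; apply: K; have := ltn_ord i; lia.
- rewrite /root2; case: (genP hn i) => [i0 -> _|i0 sD -> _|i0 sD n2 -> _|i0 sD n2 -> _|i0 sD n2 -> _] // s m.
  + by apply: K; lia.
  + by rewrite sD in s.
  + by have := K' 1 (2 * m); rewrite i0 add0r; apply; lia.
  + by have := KN m; rewrite i0; lia.
  + by have := K (2 * n%:Z) (2 * m); rewrite i0; lia.
- rewrite /root2; case: (genP hn i) => [i0 -> _|i0 sD -> _|i0 sD n2 -> _|i0 sD n2 -> _|i0 sD n2 -> _] // s m.
  + by apply: K; lia.
  + by have := K0 m; rewrite i0 add0r; lia.
  + by have := K' 1 (2 * m + 1); rewrite i0 add0r; apply; lia.
  + by rewrite sD in s.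
  + by have := K (2 * n%:Z) (2 * m + 1); rewrite i0; lia.
Qed.

Lemma root1_lt_root2 (i : 'I_n.+1) : root1 t n i < root2 i.
Proof.
have := ltn_ord i; have := rank_gt1 hn; rewrite /root2.
by case: (genP hn i) => [i0 -> _|i0 sD -> _|i0 sD n2 -> _|i0 sD n2 -> _|i0 sD n2 -> _]; lia.
Qed.

Lemma gen_root1 (i : 'I_n.+1) : gen t i (root1 t n i) = root2 i.
Proof. by have [h _ _ _ _] := gen_reflects hn i; have := h 0; rewrite mul0r !addr0. Qed.

Lemma gen_root2 (i : 'I_n.+1) : gen t i (root2 i) = root1 t n i.
Proof. by rewrite -gen_root1 genK. Qed.

(** The exchange property deletes a letter from a shortest word for w. *)
Lemma len_gen_lt (i : 'I_n.+1) w a b : affine_group t n w ->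
  w a = root1 t n i -> w b = root2 i -> b < a -> (len t n (gen t i \o w) < len t n w)%N.
Proof.
move=> wg wa wb ba; have [[s <- sw] _] := lenP wg.
have [||s' [-> e]] := @exchange t n hn s a b _ _ _ (root_affine i) (gen_reflects hn i)
  _ _ (root1_lt_root2 i) ba; rewrite ?sw //.
rewrite ltnS; rewrite sw in e; rewrite -e.
by have [_] := lenP (word_affine s'); apply.
Qed.

Lemma len_gen_gt (i : 'I_n.+1) w a b : affine_group t n w ->
  w a = root1 t n i -> w b = root2 i -> a < b -> (len t n w < len t n (gen t i \o w))%N.
Proof.
move=> wg wa wb ab.
have := @len_gen_lt i (gen t i \o w) b a (affine_gen_l hn i wg).
rewrite /= wa wb gen_root1 gen_root2 => /(_ erefl erefl ab).
by have -> : gen t i \o (gen t i \o w) = w by apply/funext => x /=; rewrite genK.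
Qed.

Lemma len_gen_le (i : 'I_n.+1) w : affine_group t n w ->
  (len t n (gen t i \o w) <= (len t n w).+1)%N.
Proof.
move=> wg; have [[s <- sw] _] := lenP wg.
by have [_ /(_ (i :: s))] := lenP (affine_gen_l hn i wg); apply; rewrite /= sw.
Qed.

(** The letters avoid [s_0], the only generator that moves integers across multiples of N. Hence the
    beads, and separation by a multiple of N, depend only on the coset. *)
Lemma parabolic_word_lt (s : seq 'I_n.+1) (m x : int) :
  (forall i, i \in s -> (0 < i)%N) -> (word_prod t s x < m * N) = (x < m * N).
Proof.
elim: s => [|i s IH] //= hs; rewrite -IH; last first.
  by move=> j js; apply: hs; rewrite inE js orbT.
set y := word_prod t s x.
have := @gen_ltN t n hn i (y + (1 - m) * N).
rewrite gen_period // => H; have : i != 0%N :> nat by have := hs i; rewrite inE eqxx; lia.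
by move=> /H; lia.
Qed.

Lemma parabolic_comp p q : parabolic t n p -> parabolic t n q -> parabolic t n (p \o q).
Proof.
move=> [s hs ->] [s' hs' ->]; exists (s ++ s'); last by rewrite word_prod_cat.
by move=> i; rewrite mem_cat => /orP[/hs|/hs'].
Qed.

Lemma parabolic_inv p : parabolic t n p -> exists2 q, parabolic t n q & inverses p q.
Proof.
move=> [s hs ->]; exists (word_prod t (rev s)); last exact: word_prod_rev.
by exists (rev s) => // i; rewrite mem_rev => /hs.
Qed.

Lemma parabolic_lt p (m x : int) : parabolic t n p -> (p x < m * N) = (x < m * N).
Proof. by move=> [s hs ->]; apply: parabolic_word_lt. Qed.

Lemma left_coset_refl w : left_coset t n w w.
Proof. by exists id => //; exists [::]. Qed.

Lemma left_coset_eq w v : left_coset t n w v -> left_coset t n v = left_coset t n w.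
Proof.
move=> [p hp <-]; apply/seteqP; split=> x [q hq <-].
  by exists (p \o q); first exact: parabolic_comp.
have [p' hp' [pp' p'p]] := parabolic_inv hp.
exists (p' \o q); first exact: parabolic_comp.
by apply/funext => y /=; rewrite p'p.
Qed.

Lemma left_coset_affine w v : affine_group t n w -> left_coset t n w v ->
  affine_group t n v.
Proof.
move=> wg [p [s _ ->] <-]; elim/last_ind: s => [|s i IH] //.
rewrite word_prod_rcons; exact: (@affine_gen_r _ _ hn i (w \o word_prod t s)).
Qed.

Lemma min_reps_exists w : affine_group t n w ->
  exists2 v, min_reps t n v & left_coset t n v = left_coset t n w.
Proof.
move=> wg.
have ex : exists k, `[< exists2 v, left_coset t n w v & len t n v = k >].
  by exists (len t n w); apply/asboolP; exists w => //; exact: left_coset_refl.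
have [k /asboolP[v wv vk] kmin] := ex_minnP ex.
exists v; last exact: left_coset_eq.
split; first exact: left_coset_affine wv.
by move=> x; rewrite (left_coset_eq wv) vk => wx; apply: kmin; apply/asboolP; exists x.
Qed.

(** For p in the parabolic subgroup, the inverse of p keeps a and b on their sides of m N, so [s_i]
    lengthens w p too. Then len (s_i w p) > len (w p) >= len w, while len (s_i w) <= len w + 1, so
    s_i w is shortest in its coset. *)
Lemma min_reps_gen (i : 'I_n.+1) w a b (m : int) : min_reps t n w ->
  w a = root1 t n i -> w b = root2 i -> a < m * N -> m * N <= b ->
  ascent t i w.
Proof.
move=> [wg wmin] wa wb am mb.
split; first by apply: (len_gen_gt wg wa wb); lia.
split; first exact: affine_gen_l.
move=> x [p hp <-]; have [q hq [pq qp]] := parabolic_inv hp.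
have wp : left_coset t n w (w \o p) by exists p.
have /= := @len_gen_gt i (w \o p) (q a) (q b) (left_coset_affine wg wp).
rewrite /= !qp => /(_ wa wb).
have := parabolic_lt m a hq; have := parabolic_lt m b hq => hb ha.
have /[swap]/[apply] : q a < q b by lia.
have := wmin _ wp; have := len_gen_le i wg.
have -> : gen t i \o w \o p = gen t i \o (w \o p) by [].
by lia.
Qed.

End Length.
(** * Abaci, profiles and cores *)

(** A profile vanishes far to the right and is determined leftwards, so its properties are proved by
    this induction. *)
Lemma int_down_ind (P : int -> Prop) (C : int) :
  (forall c, C <= c -> P c) -> (forall c, P c -> P (c - 1)) -> forall c, P c.
Proof.
move=> hC hP c; have H (k : nat) : P (C - k%:Z).
  elim: k => [|k IH]; first by apply: hC; lia.
  have -> : C - k.+1%:Z = C - k%:Z - 1 by lia.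
  exact: hP.
have [h|h] := lerP C c; first exact: hC.
have -> : c = C - (absz (C - c)%R)%:Z by lia.
exact: H.
Qed.

Lemma int_const (D : int -> int) :
  (forall c : int, D (c - 1) = D c) -> forall c : int, D c = D 0.
Proof.
move=> h c; have H (k : nat) (a : int) : D (a - k%:Z) = D a.
  elim: k => [|k IH]; first by rewrite subr0.
  have -> : a - k.+1%:Z = a - k%:Z - 1 by lia.
  by rewrite h.
have [c0|c0] := lerP 0 c.
  by rewrite -(H (absz c) c); congr D; lia.
by rewrite -(H (absz c) 0); congr D; lia.
Qed.

Section Profile.

Implicit Types (B : int -> bool) (F : int -> int).

(* F c is the number of beads at positions larger than c. *)
Definition profile B F : Prop :=
  (forall c : int, F (c - 1) = F c + (B c : nat)%:Z) /\
  (exists C : int, forall c : int, C <= c -> F c = 0).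

Lemma profile_exists B (C : int) : (forall p : int, C <= p -> ~~ B p) ->
  exists F, profile B F.
Proof.
move=> hB; exists (fun c => if C <= c then 0 else
  \sum_(k < absz (C - c)%R) (B (C - k%:Z) : nat)%:Z); split; last first.
  by exists C => c ->.
move=> c; case: (lerP C (c - 1)) => h1.
  have -> : (C <= c) by lia.
  by rewrite (negPf (hB _ _)) //; lia.
have -> : absz (C - (c - 1))%R = (absz (C - c)%R).+1 by lia.
rewrite big_ord_recr /=; case: lerP => h2.
  have -> : absz (C - c)%R = 0%N by lia.
  by rewrite big_ord0 subr0; have -> : C = c by lia.
by congr (_ + (B _ : nat)%:Z); lia.
Qed.

Lemma profile_unique B F G : profile B F -> profile B G -> forall c, F c = G c.
Proof.
move=> [hF [C FC]] [hG [C' GC]]; apply: (@int_down_ind _ (Num.max C C')).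
  by move=> c hc; rewrite FC ?GC //; lia.
by move=> c e; rewrite hF hG e.
Qed.

Lemma profile_step B F (c : int) : profile B F -> F (c - 1) = F c + (B c : nat)%:Z.
Proof. by case. Qed.

Lemma profile_ge0 B F (c : int) : profile B F -> 0 <= F c.
Proof.
move=> [hF [C FC]]; move: c; apply: (@int_down_ind _ C) => c.
  by move=> /FC ->.
by rewrite hF; case: (B c); lia.
Qed.

Lemma profile_shift B F (c : int) (k : nat) : profile B F ->
  F (c + k%:Z) <= F c <= F (c + k%:Z) + k%:Z.
Proof.
move=> [hF _]; elim: k => [|k IH]; first by rewrite !addr0; lia.
have := hF (c + k.+1%:Z); have -> : c + k.+1%:Z - 1 = c + k%:Z by lia.
by case: (B _); lia.
Qed.

Lemma profile_le B F (c d : int) : profile B F -> c <= d -> F d <= F c <= F d + (d - c).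
Proof.
move=> pF cd; have := profile_shift c (absz (d - c)%R) pF.
have -> : (absz (d - c)%R)%:Z = d - c by lia.
by have -> : c + (d - c) = d by lia.
Qed.

(** The quantity F (- c) - F c - c is constant, because B c + B (1 - c) = 1. For diagrams this is
    invariance under transposition. *)
Lemma profile_sym B F : profile B F -> (forall p : int, B (1 - p) = ~~ B p) ->
  forall c : int, F (- c) = F c + c.
Proof.
move=> [hF _] anti c.
suff : F (- c) - F c - c = F (- 0) - F 0 - 0 by rewrite oppr0 subrr subr0; lia.
apply: (@int_const (fun c => F (- c) - F c - c)) => {}c.
have := hF c; have := hF (1 - c); rewrite anti.
have -> : 1 - c - 1 = - c by lia.
have -> : 1 - c = - (c - 1) by lia.
by case: (B c) => /=; lia.
Qed.

Lemma profile_bead B F (i : nat) (c : int) : profile B F -> (0 < i)%N ->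
  i%:Z <= F c -> exists p : int, [/\ c < p, B p & F (p - 1) = i%:Z].
Proof.
move=> pF i0; have [hF [C FC]] := pF; move: c.
apply: (@int_down_ind _ C) => [c /FC -> |c IH hc]; first by lia.
have [h|h] := lerP i%:Z (F c).
  by have [p [p1 p2 p3]] := IH h; exists p; split=> //; lia.
by exists c; have := hF c; case: (B c) => /= E; split=> //; lia.
Qed.

Lemma profile_card B F (c : int) : profile B F ->
  [set p : int | B p /\ c < p] #= `I_(absz (F c)).
Proof.
move=> pF; have [hF [C FC]] := pF; move: c; apply: (@int_down_ind _ C).
  move=> c Cc; rewrite FC //=.
  have -> : `I_0 = set0 :> set nat by apply/seteqP; split.
  rewrite card_eq0; apply/eqP/seteqP; split=> p //= -[Bp cp].
  by have := hF p; rewrite Bp !FC //; lia.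
move=> c IH; have Fc := profile_ge0 c pF; rewrite hF; case Bc: (B c).
  have -> : absz (F c + 1%N%:Z)%R = (absz (F c)).+1 by lia.
  apply/eq_cardSP; exists c; first by split=> //; lia.
  have -> // : [set p | B p /\ c - 1 < p] `\ c = [set p : int | B p /\ c < p].
  apply/seteqP; split=> p /=.
    by move=> [[Bp cp] /eqP pc]; split=> //; lia.
  by move=> [Bp cp]; split=> //; [split=> //; lia|apply/eqP; lia].
rewrite addr0; have -> // : [set p | B p /\ c - 1 < p] = [set p : int | B p /\ c < p].
apply/seteqP; split=> p /= [Bp cp]; split=> //; last by lia.
have : p != c by apply/eqP => pc; rewrite pc Bc in Bp.
by lia.
Qed.

End Profile.

Section Abacus.

Variable n : nat.
Hypothesis n_gt0 : (0 < n)%N.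
Local Notation N := ((period n)%:Z).
Local Notation L := ((2 * n)%N%:Z).

(* Numbers the entries in reading order; the centre of symmetry of the abacus
   lies between the positions 0 and 1. *)
Definition label (p : int) : int := p + N + ((p - 1) %/ L)%Z.

Lemma label_runner (q r : int) : 0 < r <= L -> label (q * L + r) = (q + 1) * N + r.
Proof.
move=> hr; have e := periodE n; rewrite /label.
have -> : q * L + r - 1 = q * L + (r - 1) by lia.
by rewrite divzMDl ?divz_small; lia.
Qed.

Lemma label_centered (q r : int) : - L < r <= L ->
  label (q * L + r) = (q + 1) * N + (if 0 < r then r else r - 1).
Proof.
move=> hr; have e := periodE n; case: ltrP => r0; first by rewrite label_runner //; lia.
have -> : q * L + r = (q - 1) * L + (L + r) by lia.
by rewrite label_runner //; lia.
Qed.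

Lemma position_runner (p : int) : exists q r : int, p = q * L + r /\ 0 < r <= L.
Proof.
have L0 : L != 0 by lia.
have := divz_eq (p - 1) L => pE.
have [r0 rL] : 0 <= ((p - 1) %% L)%Z /\ ((p - 1) %% L)%Z < L by split; lia.
by exists ((p - 1) %/ L)%Z, (((p - 1) %% L)%Z + 1); lia.
Qed.

Lemma label_mono (p p' : int) : p < p' -> label p < label p'.
Proof.
have e := periodE n; have L0 : 0 <= L by lia.
have [q [r [-> hr]]] := position_runner p; have [q' [r' [-> hr']]] := position_runner p'.
rewrite !label_runner //; have N0 : 0 <= N by lia.
have [Q|Q|->] := ltgtP q q'; last by lia.
  have : q + 1 <= q' by lia.
  by move=> /(ler_wpM2r N0); lia.
have : q' + 1 <= q by lia.
by move=> /(ler_wpM2r L0); lia.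
Qed.

Lemma label_le (p p' : int) : (label p <= label p') = (p <= p').
Proof. by apply: (le_mono label_mono). Qed.

Lemma label_inj : injective label.
Proof. by move=> p q pq; have := label_le p q; have := label_le q p; rewrite pq; lia. Qed.

Lemma label_nonmultiple (p : int) : ~ multiple n (label p).
Proof.
have e := periodE n; have N0 : 0 <= N by lia.
have [q [r [-> hr]]] := position_runner p; rewrite label_runner // => -[m h].
by have [Q|Q|Q|Q] := mulz_cases (q + 1) m N0; subst; lia.
Qed.

Lemma entryP (b : int) : entry n b <-> ~ multiple n b.
Proof.
have e := periodE n; rewrite /entry /=; split=> [/eqP h [m hm]|h].
  by apply: h; rewrite hm modzMl.
apply/eqP => h'; apply: h; exists (b %/ N)%Z.
by have := divz_eq b N; rewrite h' addr0.
Qed.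

Lemma entry_label (b : int) : entry n b -> exists p : int, b = label p.
Proof.
have e := periodE n; rewrite /entry /= => h; have := divz_eq b N => bE.
have [r0 rL] : 0 <= (b %% N)%Z /\ (b %% N)%Z < N by split; lia.
exists (((b %/ N)%Z - 1) * L + (b %% N)%Z); rewrite label_runner; last by lia.
by rewrite subrK.
Qed.

Lemma label_anti (p : int) : label (1 - p) = 2 * N - label p.
Proof.
have e := periodE n.
have [q [r [-> hr]]] := position_runner p.
have -> : 1 - (q * L + r) = (- q - 1) * L + (L + 1 - r) by lia.
by rewrite !label_runner; lia.
Qed.

Lemma label_shift (p k : int) : label (p + k * L) = label p + k * N.
Proof.
have [q [r [-> hr]]] := position_runner p.
have -> : q * L + r + k * L = (q + k) * L + r by lia.
by rewrite !label_runner //; lia.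
Qed.

(** An entry is w j + m N with 1 <= j <= 2n; it is a bead iff m <= 0, and the inverse sends it to j
    + m N. *)
Lemma abacusE w u (b : int) : mirrored_perm n w -> inverses w u ->
  abacus n w b <-> entry n b /\ u b < N.
Proof.
move=> wm wu; have um := mirrored_inv wm wu; have [wK uK] := wu.
have e := periodE n; have N0 : 0 <= N by lia.
rewrite /abacus /=; split=> [[eb [j [hj bj bw]]]|[eb ub]]; split=> //.
  have bE : b = w j%:Z + ((b %/ N)%Z - (w j%:Z %/ N)%Z) * N.
    by have := divz_eq b N; have := divz_eq (w j%:Z) N; rewrite -bj; lia.
  move: bE bw; move: (_ - _) => m -> bw.
  rewrite mirrored_shift // wK.
  by have [Q|Q|Q|Q] := mulz_cases 0 m N0; subst; lia.
have nub : ~ multiple n (u b) by move=> /(proj1 (mirrored_multiple _ um)); exact/entryP.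
have := divz_eq (u b) N => ubE; have rE : (u b %% N)%Z != 0.
  by apply/eqP => r0; apply: nub; exists (u b %/ N)%Z; lia.
have [r0 rL] : 0 <= (u b %% N)%Z /\ (u b %% N)%Z < N by split; lia.
exists (absz (u b %% N)%Z); have -> : (absz (u b %% N)%Z)%:Z = (u b %% N)%Z by lia.
have bE : b = (u b %/ N)%Z * N + w (u b %% N)%Z.
  by rewrite -[LHS]uK {1}ubE addrC mirrored_shift // addrC.
split; first by lia.
- by rewrite {1}bE modzMDl.
rewrite {1}bE; have [Q|Q|Q|Q] := mulz_cases 0 (u b %/ N)%Z N0; lia.
Qed.

Definition bead (u : int -> int) (p : int) : bool := u (label p) < N.

Variables (w u : int -> int).
Hypotheses (wm : mirrored_perm n w) (wu : inverses w u).
Let um : mirrored_perm n u := mirrored_inv wm wu.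

Lemma abacus_label (p : int) : abacus n w (label p) <-> bead u p.
Proof.
rewrite (abacusE _ wm wu) /bead; split=> [[]//|h]; split=> //.
by apply/entryP; exact: label_nonmultiple.
Qed.

(** The labels at p and 1 - p add up to 2 N, and so do their images under u. As N is not the image
    of an entry, exactly one of the two images is below N. *)
Lemma bead_anti (p : int) : bead u (1 - p) = ~~ bead u p.
Proof.
have uo : u (- label p) = - u (label p) by case: um.
rewrite /bead label_anti addrC mirrored_shift // uo.
have : u (label p) <> N.
  move=> h; apply: (@label_nonmultiple p); apply/(mirrored_multiple _ um).
  by exists 1; rewrite mul1r.
by lia.
Qed.

Lemma bead_flush (p k : int) : 0 <= k -> bead u (p + k * L) -> bead u p.
Proof.
have e := periodE n; have N0 : 0 <= N by lia.
move=> k0; rewrite /bead label_shift mirrored_shift //.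
by have := mulr_ge0 k0 N0; lia.
Qed.

Lemma bead_bounded : exists C : int, forall p : int, C <= p -> ~~ bead u p.
Proof.
have e := periodE n; have N0 : 0 <= N by lia.
(* [K] bounds |u r| over one period, so at a level q > K the value u r + (q + 1) N is at least N. *)
pose K : int := \sum_(r < period n) `|u r%:Z|.
have uK (r : int) : 0 < r <= L -> - K <= u r.
  move=> hr; have hr' : (absz r < period n)%N by lia.
  rewrite /K (bigD1 (Ordinal hr')) //=; have -> : (absz r)%:Z = r by lia.
  set S := \sum_(_ < _ | _) _; have S0 : 0 <= S by apply: sumr_ge0.
  by clearbody S; lia.
have K0 : 0 <= K by apply: sumr_ge0.
have L0 : 0 <= L by lia.
exists ((K + 1) * L + 1) => p; have [q [r [-> hr]]] := position_runner p => h.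
rewrite /bead label_runner // [_ + r]addrC mirrored_shift //.
have hK := uK r hr; have Kq : K + 1 <= q.
  have [//|Q] := lerP (K + 1) q; have : q + 1 <= K + 1 by lia.
  by move=> /(ler_wpM2r L0); lia.
have /(ler_wpM2r N0) : K + 2 <= q + 1 by lia.
have : 0 <= K * N by exact: mulr_ge0.
have /(ler_wpM2l K0) : 1 <= N by lia.
by lia.
Qed.

Lemma bead_profile : exists F, profile (bead u) F.
Proof. by have [C hC] := bead_bounded; exact: profile_exists hC. Qed.

Variable F : int -> int.
Hypothesis pF : profile (bead u) F.

Lemma bead_profile_sym (c : int) : F (- c) = F c + c.
Proof. exact: profile_sym pF bead_anti c. Qed.

Lemma card_beads_ge (p : int) :
  [set b' | abacus n w b' /\ label p <= b'] #= `I_(absz (F (p - 1))).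
Proof.
apply: card_eq_trans (profile_card _ pF).
have -> : [set b' | abacus n w b' /\ label p <= b'] =
    label @` [set q | bead u q /\ p - 1 < q].
  apply/seteqP; split=> b /=.
    move=> [ab pb]; have [eb _] : entry n b /\ u b < N by exact/(abacusE _ wm wu).
    have [q bq] := entry_label eb; rewrite bq in ab pb *; exists q => //.
    by split; [exact/abacus_label|move: pb; rewrite label_le; lia].
  move=> [q [Bq pq] <-]; split; first exact/abacus_label.
  by rewrite label_le; lia.
by apply: inj_card_eq => x y _ _; exact: label_inj.
Qed.

Lemma gaps_label (p : int) : gaps n w (label p) <-> ~~ bead u p.
Proof.
rewrite /gaps /=; split=> [[_ h]|h]; first by apply/negP => /abacus_label.
split; first by apply/entryP; exact: label_nonmultiple.
by move=> /abacus_label; apply/negP.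
Qed.

(** By antisymmetry the gaps up to p are the mirror images of the beads beyond - p, so a single
    profile counts both. *)
Lemma card_gaps_le (p : int) :
  [set g' | gaps n w g' /\ g' <= label p] #= `I_(absz (F (- p))).
Proof.
apply: card_eq_trans (profile_card _ pF).
have -> : [set g' | gaps n w g' /\ g' <= label p] =
    (fun q => label (1 - q)) @` [set q | bead u q /\ - p < q].
  apply/seteqP; split=> b /=.
    move=> [gb pb]; have [eb _] := gb.
    have [q bq] := entry_label eb; rewrite bq in gb pb *; exists (1 - q).
      split; last by move: pb; rewrite label_le; lia.
      by rewrite bead_anti; exact/gaps_label.
    by congr label; lia.
  move=> [q [Bq pq] <-]; split.
    by apply/gaps_label; rewrite bead_anti negbK.
  by rewrite label_le; lia.
apply: inj_card_eq => x y _ _ /label_inj; lia.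
Qed.

(** The bead of row i and the gap of column j sit at the positions p and q with F (p - 1) = i and F
    (- q) = j, and q < p says that the diagonal j - i still carries at least i boxes. *)
Lemma core_profile (i j : nat) :
  core n w (i, j) <-> [/\ (0 < i)%N, (0 < j)%N & i%:Z <= F (j%:Z - i%:Z)].
Proof.
have sym := bead_profile_sym; rewrite /core /=; split.
  move=> [b [g [ab gg gb cb cg]]].
  have [eb _] : entry n b /\ u b < N by exact/(abacusE _ wm wu).
  have [eg _] := gg.
  have [p bp] := entry_label eb; have [q gq] := entry_label eg; subst b g.
  have Bp : bead u p by exact/abacus_label.
  have Bq : ~~ bead u q by exact/gaps_label.
  have iE : F (p - 1) = i%:Z.
    have /card_eq_II := card_eq_trans (card_eq_trans (card_esym (card_beads_ge p)) cb) (card_eqxx _).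
    by have := profile_ge0 (p - 1) pF; lia.
  have jE : F (- q) = j%:Z.
    have /card_eq_II := card_eq_trans (card_eq_trans (card_esym (card_gaps_le q)) cg) (card_eqxx _).
    by have := profile_ge0 (- q) pF; lia.
  have qp : q < p by have := label_le p q; lia.
  have h1 := profile_step p pF; have h2 := profile_step q pF; rewrite Bp in h1.
  rewrite (negPf Bq) in h2; have h3 := profile_step (1 - q) pF.
  rewrite bead_anti (negPf Bq) in h3; have e : 1 - q - 1 = - q by lia.
  rewrite e in h3; have h4 := profile_ge0 p pF; have h5 := profile_ge0 (1 - q) pF.
  split; try by move: h1 h3 => /=; lia.
  have [//|h] := lerP i%:Z (F (j%:Z - i%:Z)).
  (* Before the bead, monotonicity of F suffices. From the bead on, hence beyond the gap, F drops by
     at most one per position from F q = j - q. *)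
  have [h6|h6] := ltrP (j%:Z - i%:Z) p.
    have h7 : j%:Z - i%:Z <= p - 1 by lia.
    by have := profile_le pF h7; lia.
  have h7 : q <= j%:Z - i%:Z by lia.
  by have := profile_le pF h7; have := sym q; lia.
move=> [i0 j0 hi].
have [p [p1 p2 p3]] := profile_bead pF i0 hi.
have [q [q2 q3]] : exists q : int, bead u q /\ F (q - 1) = j%:Z.
  have hj : j%:Z <= F (- j%:Z) by have := sym j%:Z; have := profile_ge0 j%:Z pF; lia.
  have [q [q1 q2 q3]] := profile_bead pF j0 hj; by exists q.
exists (label p), (label (1 - q)); split.
- exact/abacus_label.
- by apply/gaps_label; rewrite bead_anti negbK.
- apply: label_mono; have [//|h] := ltrP (1 - q) p.
  have h1 : j%:Z - i%:Z <= 1 - q - 1 by lia.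
  have := profile_le pF h1; have := sym (q - 1); have := sym (- q).
  have -> : - (q - 1) = 1 - q by lia.
  have := profile_step q pF; have := profile_step (1 - q) pF.
  rewrite bead_anti q2 /= opprK q3; have -> : 1 - q - 1 = - q by lia.
  by lia.
- by have := card_beads_ge p; rewrite p3.
- have := card_gaps_le (1 - q); have -> : - (1 - q) = q - 1 by lia.
  by rewrite q3.
Qed.

End Abacus.

(** * The action on cores as a permutation of positions *)

Section Action.

Variables (t : quotient_type) (n : nat).
Hypothesis hn : (min_rank t <= n)%N.
Local Notation N := ((period n)%:Z).
Local Notation L := ((2 * n)%N%:Z).

Let n_gt0 : (0 < n)%N := ltnW (rank_gt1 hn).

(** The diagonal j - i = c >= 0 carries exactly F c boxes, symmetry gives F at negative c, and the
    steps of F are the beads. *)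
Lemma bead_core_inj w u w' u' : mirrored_perm n w -> inverses w u ->
  mirrored_perm n w' -> inverses w' u' -> core n w = core n w' ->
  forall p, bead n u p = bead n u' p.
Proof.
move=> wm wu wm' wu' ww'.
have [F pF] := bead_profile n_gt0 wm wu; have [F' pF'] := bead_profile n_gt0 wm' wu'.
have FF (c : int) : 0 <= c -> F c = F' c.
  move=> c0; have H (i : nat) : (0 < i)%N -> i%:Z <= F c <-> i%:Z <= F' c.
    move=> i0; pose j := (i + absz c)%N; have j0 : (0 < j)%N by rewrite /j; lia.
    have jE : j%:Z - i%:Z = c by rewrite /j; lia.
    have := core_profile n_gt0 wm wu pF i j; have := core_profile n_gt0 wm' wu' pF' i j.
    rewrite ww' jE => h1 h2; split=> h.
      by have [] : [/\ (0 < i)%N, (0 < j)%N & i%:Z <= F' c] by apply/h1/h2.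
    by have [] : [/\ (0 < i)%N, (0 < j)%N & i%:Z <= F c] by apply/h2/h1.
  have g0 := profile_ge0 c pF; have g0' := profile_ge0 c pF'.
  have := H (absz (F c)); have := H (absz (F' c)); have := H (absz (F c)).+1.
  by have := H (absz (F' c)).+1; lia.
have {}FF (c : int) : F c = F' c.
  have [c0|c0] := lerP 0 c; first exact: FF.
  have := bead_profile_sym n_gt0 wm wu pF (- c); have := bead_profile_sym n_gt0 wm' wu' pF' (- c).
  by have := FF (- c); rewrite opprK; lia.
move=> p; have := profile_step p pF; have := profile_step p pF'; rewrite !FF.
by case: (bead n u p) => /=; case: (bead n u' p) => /=; lia.
Qed.

Lemma core_bead_eq w u w' u' : mirrored_perm n w -> inverses w u ->
  mirrored_perm n w' -> inverses w' u' ->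
  (forall p, bead n u p = bead n u' p) -> core n w = core n w'.
Proof.
move=> wm wu wm' wu' uu'; suff e : abacus n w = abacus n w' by rewrite /core /gaps e.
apply/seteqP; split=> b ab; have [eb _] := ab.
  have [p bp] := entry_label n_gt0 eb; move: ab; rewrite bp.
  by move=> /(abacus_label n_gt0 wm wu); rewrite uu' => /(abacus_label n_gt0 wm' wu').
have [p bp] := entry_label n_gt0 eb; move: ab; rewrite bp.
by move=> /(abacus_label n_gt0 wm' wu'); rewrite -uu' => /(abacus_label n_gt0 wm wu).
Qed.

Lemma core_coset w v : mirrored_perm n w -> left_coset t n w v -> core n v = core n w.
Proof.
move=> wm [p hp <-]; have [u wu] := mirrored_inverse wm.
have [q hq pq] := parabolic_inv hn hp.
have pm : mirrored_perm n p by have [s _ ->] := hp; exact: word_prod_mirrored.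
have e : inverses (w \o p) (q \o u).
  by have [a b] := pq; have [c d] := wu; split=> x /=; rewrite ?a ?b ?c ?d ?a ?b.
apply: (core_bead_eq (mirrored_comp wm pm) e wm wu) => x.
by rewrite /bead /= -[X in _ < X]mul1r (parabolic_lt hn) // mul1r.
Qed.

(** All preimages of the core share their beads, the generator permutes entries, and the core is
    constant on cosets, so neither choice made by [act] matters. *)
Lemma act_core (i : 'I_n.+1) w : min_reps t n w ->
  act t n (gen t i) (core n w) = core n (gen t i \o w).
Proof.
move=> wr; rewrite /act /core_inv; case: xgetP => [w' _ [[wg' _] ww']|]; last first.
  by move=> /(_ w) [].
have [wg _] := wr; have [wm _ _] := wg; have [wm' _ _] := wg'.
rewrite /min_rep; have gg := affine_gen_l hn i wg'; have [gm _ _] := gg.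
case: xgetP => [v _ [vr vw]|none]; last first.
  by have [v v1 v2] := min_reps_exists hn gg; case: (none v).
have -> : core n v = core n (gen t i \o w').
  by apply: core_coset => //; rewrite -vw; exact: left_coset_refl.
have [u wu] := mirrored_inverse wm; have [u' wu'] := mirrored_inverse wm'.
have uu := bead_core_inj wm' wu' wm wu ww'.
have [gwm _ _] := affine_gen_l hn i wg.
apply: (core_bead_eq gm (inverses_gen hn i wu') gwm (inverses_gen hn i wu)) => p.
rewrite /bead /=; have ge : entry n (gen t i (label n p)).
  apply/entryP => /(proj1 (mirrored_multiple _ (gen_mirrored hn i))).
  exact: label_nonmultiple.
by have [q ->] := entry_label n_gt0 ge; exact: uu.
Qed.

(** The labels are symmetric about N, so p -> u (label p - N) matches the beads beyond the centre
    with the set in the parity condition. *)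
Lemma profile0_even w u F : affine_group t n w -> inverses w u ->
  profile (bead n u) F -> s0_is_D t -> ~~ odd (absz (F 0)).
Proof.
move=> [wm w0 _] wu pF /w0[k ko wk].
have um := mirrored_inv wm wu; have [wK uK] := wu; have e := periodE n.
suff /card_eq_II <- : `I_k #= `I_(absz (F 0)) by [].
rewrite card_eq_sym in wk; apply: card_eq_trans wk _.
apply: card_eq_trans (profile_card 0 pF).
have uN (x : int) : u (x - N) = u x - N.
  by have := mirrored_shift x (- 1) um; rewrite mulN1r.
have -> : [set i : int | i <= 0 /\ 1 <= w i] =
    (fun p => u (label n p - N)) @` [set p | bead n u p /\ 0 < p].
  have l1 : label n 1 = N + 1.
    by have := @label_runner n n_gt0 0 1; rewrite mul0r !add0r mul1r; apply; lia.
  apply/seteqP; split=> x /=.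
    move=> [x0 wx].
    have ew : entry n (w x + N).
      apply/entryP => -[m mE].
      have xE : x = (m - 1) * N.
        apply: (can_inj wK); have := mirrored_shift 0 (m - 1) wm.
        by rewrite add0r (mirrored0 wm) add0r => ->; lia.
      have := mirrored_shift 0 (m - 1) wm.
      by rewrite add0r (mirrored0 wm) add0r -xE; lia.
    have [p pE] := entry_label n_gt0 ew.
    have xp : x = u (label n p - N) by rewrite -pE addrK wK.
    exists p => //; split; last first.
      by have := label_le n_gt0 1 p; rewrite l1 -pE; lia.
    have x0' : x != 0 by apply/eqP => h; rewrite h (mirrored0 wm) in wx.
    by rewrite /bead; have := uN (label n p); rewrite -xp; lia.
  move=> [p [Bp p0] <-]; rewrite uK uN; move: Bp; rewrite /bead => Bp.
  by have := label_le n_gt0 1 p; rewrite l1; lia.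
apply: inj_card_eq => x y _ _ /(can_inj uK) h.
by apply: (label_inj n_gt0); lia.
Qed.

Definition root_pair (i : nat) (x y : int) : Prop :=
  exists k : int, (x = root1 t n i + k * N /\ y = root2 i + k * N) \/
    (x = - root2 i + k * N /\ y = - root1 t n i + k * N).

Lemma root_pair_gen (i : 'I_n.+1) x y : root_pair i x y -> gen t i x = y /\ gen t i y = x.
Proof.
by have [h1 h2 h3 h4 _] := gen_reflects hn i; move=> [k [[-> ->]|[-> ->]]]; split.
Qed.

(** A translation only shifts the threshold. Negation reverses the inequality, and strictness is
    recovered because u sends no member of a root pair to a multiple of N. *)
Lemma root_pair_le (i : 'I_n.+1) u x y : mirrored_perm n u ->
  (forall m : int, u (root2 i) < m * N -> u (root1 t n i) < m * N) ->
  root_pair i x y -> u y < N -> u x < N.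
Proof.
move=> um le; have uo (z : int) : u (- z) = - u z by case: um.
have := affine_root_image um (root_affine hn i) => -[h1 h2 _ _].
move=> [k [[-> ->]|[-> ->]]]; rewrite !mirrored_shift // ?uo.
  by have := le (1 - k); lia.
move=> h; have [//|h'] := ltrP (- u (root2 i) + k * N) N.
have : u (root2 i) <> (k - 1) * N by move=> hk; apply: h2; exists (k - 1).
by have := le (k - 1); lia.
Qed.

Lemma root_pair_ge (i : 'I_n.+1) u x y : mirrored_perm n u ->
  (forall m : int, u (root1 t n i) < m * N -> u (root2 i) < m * N) ->
  root_pair i x y -> u x < N -> u y < N.
Proof.
move=> um le; have uo (z : int) : u (- z) = - u z by case: um.
have := affine_root_image um (root_affine hn i) => -[h1 h2 _ _].
move=> [k [[-> ->]|[-> ->]]]; rewrite !mirrored_shift // ?uo.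
  by have := le (1 - k); lia.
move=> h; have [//|h'] := ltrP (- u (root1 t n i) + k * N) N.
have : u (root1 t n i) <> (k - 1) * N by move=> hk; apply: h1; exists (k - 1).
by have := le (k - 1); lia.
Qed.

(* s_i is s_0^D or s_n^D, and moves beads by two positions. *)
Definition double (i : nat) : bool :=
  (i == 0%N) && s0_is_D t || (i == n) && sn_is_D t.

(** As a position, c is where the generator exchanges c with c + 1, or in the double case c - 1 with
    c + 1 and c with c + 2. As a diagonal, c is the centre of the resulting change of the
    profile. *)
Definition active (i : nat) (c : int) : Prop :=
  exists m : int, c = m * L + i%:Z \/ c = m * L - i%:Z.

Lemma active_single (i : 'I_n.+1) (c : int) : ~~ double i -> active i c ->
  root_pair i (label n c) (label n (c + 1)).
Proof.
have e := periodE n; have li := ltn_ord i; rewrite /double => nd [m cE].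
have lc (s k : int) : c = m * L + s -> - L < s + k -> s + k <= L ->
    label n (c + k) = (m + 1) * N + (if 0 < s + k then s + k else s + k - 1).
  by move=> -> h1 h2; rewrite -addrA label_centered //; lia.
rewrite -[X in label n X]addr0 /root_pair /root2.
case: cE => cE; rewrite !(lc _ _ cE); try lia; exists (m + 1);
 case: (genP hn i) => [i0 -> _|i0 sD -> _|i0 sD n2 -> _|i0 sD n2 -> _|i0 sD n2 -> _];
 do ?[case: ltrP => ?]; lia.
Qed.

Lemma active_double (i : 'I_n.+1) (c : int) : double i -> active i c ->
  root_pair i (label n (c - 1)) (label n (c + 1)) /\
  root_pair i (label n c) (label n (c + 2)).
Proof.
have e := periodE n; have li := ltn_ord i; have n1 := rank_gt1 hn.
have n0D := rank_s0D hn; have nnD := rank_snD hn; rewrite /double => nd [m cE].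
have lc (s k : int) : c = m * L + s -> - L < s + k -> s + k <= L ->
    label n (c + k) = (m + 1) * N + (if 0 < s + k then s + k else s + k - 1).
  by move=> -> h1 h2; rewrite -addrA label_centered //; lia.
rewrite -[X in root_pair _ (label n X) (label n (c + 2))]addr0 /root_pair /root2.
case: cE => cE; rewrite !(lc _ _ cE); try lia; split;
 case: (genP hn i) => [i0 -> _|i0 sD -> _|i0 sD n2 -> _|i0 sD n2 -> _|i0 sD n2 -> _]; try lia;
 do ?[case: ltrP => ?]; try lia;
 first [by exists (m + 1); lia|by exists (m + 2); lia|by exists m; lia].
Qed.

Lemma position_centered (p : int) :
  exists q r : int, p = q * L + r /\ - n%:Z < r <= n%:Z.
Proof.
have [q [r [-> hr]]] := position_runner n_gt0 p.
have [h|h] := lerP r n%:Z; first by exists q, r; lia.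
by exists (q + 1), (r - L); lia.
Qed.

Lemma inactive_single (i : 'I_n.+1) (p : int) : ~~ double i ->
  ~ active i p -> ~ active i (p - 1) -> gen t i (label n p) = label n p.
Proof.
have e := periodE n; have li := ltn_ord i; rewrite /double => nd h0 h1.
have [q [r [pE hr]]] := position_centered p.
have {}h0 : r <> i%:Z /\ r <> - i%:Z.
  by split=> rE; apply: h0; exists q; lia.
have {}h1 : r <> i%:Z + 1 /\ r <> - i%:Z + 1.
  by split=> rE; apply: h1; exists q; lia.
rewrite pE label_centered //; last by lia.
case: (ltrP 0 r) => r0;
 case: (genP hn i) => [i0 _ E|i0 sD _ E|i0 sD n2 _ E|i0 sD n2 _ E|i0 sD n2 _ E]; rewrite ?E; try lia;
 do ![case: eqP => //= ?]; lia.
Qed.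

Lemma inactive_double (i : 'I_n.+1) (p : int) : double i ->
  ~ active i (p + 1) -> ~ active i p -> ~ active i (p - 1) -> ~ active i (p - 2) ->
  gen t i (label n p) = label n p.
Proof.
have e := periodE n; have li := ltn_ord i; rewrite /double => nd h0 h1 h2 h3.
have [q [r [pE hr]]] := position_centered p.
have {}h0 : r <> i%:Z - 1 /\ r <> - i%:Z - 1.
  by split=> rE; apply: h0; exists q; lia.
have {}h1 : r <> i%:Z /\ r <> - i%:Z.
  by split=> rE; apply: h1; exists q; lia.
have {}h2 : r <> i%:Z + 1 /\ r <> - i%:Z + 1.
  by split=> rE; apply: h2; exists q; lia.
have {}h3 : r <> i%:Z + 2 /\ r <> - i%:Z + 2.
  by split=> rE; apply: h3; exists q; lia.
rewrite pE label_centered //; last by lia.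
case: (ltrP 0 r) => r0;
 case: (genP hn i) => [i0 _ E|i0 sD _ E|i0 sD n2 _ E|i0 sD n2 _ E|i0 sD n2 _ E]; rewrite ?E; try lia;
 do ![case: eqP => //= ?]; lia.
Qed.

End Action.
(** * Components *)

Lemma partition_of_neighbours (E : diagram) : finite_set E ->
  (forall i j, E (i, j) -> (0 < i)%N /\ (0 < j)%N) ->
  (forall i j, (0 < j)%N -> E (i, j.+1) -> E (i, j)) ->
  (forall i j, (0 < i)%N -> E (i.+1, j) -> E (i, j)) ->
  is_partition E.
Proof.
move=> fE pE hl hu; split=> // i j i' j' Eij hi hj.
have {hi}Eij : E (i', j).
  move: Eij; have -> : i = ((i - i') + i')%N by lia.
  by elim: (i - i')%N => // k IH h; apply: IH; apply: hu => //; lia.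
move: Eij; have -> : j = ((j - j') + j')%N by lia.
by elim: (j - j')%N => // k IH h; apply: IH; apply: hl => //; lia.
Qed.

Lemma partition_left (E : diagram) i j : is_partition E -> (0 < j)%N ->
  E (i, j.+1) -> E (i, j).
Proof. by move=> [_ pE hE] j0 Eij; have [i0 _] := pE _ _ Eij; apply: (hE _ _ _ _ Eij); lia. Qed.

Lemma partition_up (E : diagram) i j : is_partition E -> (0 < i)%N ->
  E (i.+1, j) -> E (i, j).
Proof. by move=> [_ pE hE] i0 Eij; have [_ j0] := pE _ _ Eij; apply: (hE _ _ _ _ Eij); lia. Qed.

Section Components.

Variables (t : quotient_type) (n : nat) (D D' : diagram) (r : nat).

Local Notation R := (has_residue t n D r).

Definition residue_class (p : nat * nat) : diagram :=
  [set q | clos_refl_trans _ (connected t n D r) p q].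

Local Notation K := residue_class.

Lemma residue_class_refl p : K p p.
Proof. exact: rt_refl. Qed.

Lemma residue_class_step p q q' : K p q -> R q -> R q' -> share_edge q q' -> K p q'.
Proof. by move=> pq Rq Rq' e; apply: rt_trans pq _; apply: rt_step. Qed.

Lemma residue_class_closed (S : diagram) p : S p ->
  (forall q q', S q -> R q -> R q' -> share_edge q q' -> S q') -> K p `<=` S.
Proof.
move=> Sp hS q; rewrite /residue_class /= => /(clos_rt_rtn1 _ _ _ _).
by elim=> // q1 q2 [e R1 R2] _ S1; apply: hS S1 R1 R2 e.
Qed.

Lemma share_edge_sym p q : share_edge p q -> share_edge q p.
Proof. by rewrite /share_edge; lia. Qed.

Definition changed : diagram := [set p | (D p /\ ~ D' p) \/ (~ D p /\ D' p)].

Hypothesis partD : is_partition D.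
Hypothesis partD' : is_partition D'.
Hypothesis changed_residue : forall p, changed p -> R p.
Hypothesis changed_closed : forall p, changed p -> K p `<=` changed.

(* A neighbour of a changed box on which D and D' differ too belongs to the
   same class: this is why adding or removing a class yields a partition. *)
Lemma partition_add_class p : D `<=` D' -> changed p -> is_partition (D `|` K p).
Proof.
move=> DD' cp; have KN := changed_closed cp.
have KD' q : (D `|` K p) q -> D' q.
  by move=> [/DD' //|/KN]; rewrite /changed /=; have := DD' q; tauto.
have finite' : finite_set (D `|` K p).
  by have [fD' _ _] := partD'; apply: sub_finite_set fD'.
have nb q q' : (D `|` K p) q -> D' q' -> share_edge q q' -> (D q -> D q') -> (D `|` K p) q'.
  move=> [Dq|Kq] D'q' e qq'; first by left; exact: qq'.
  have [Dq'|Dq'] := EM (D q'); first by left.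
  right; apply: (residue_class_step Kq) e; last by apply: changed_residue; right.
  by apply: changed_residue; exact: KN.
have [_ pos' _] := partD'; apply: partition_of_neighbours => // [i j /KD'|i j j0 h|i j i0 h].
- exact: pos'.
- apply: (nb _ _ h) => /=; last exact: partition_left.
    exact: partition_left partD' j0 (KD' _ h).
  by left; split=> //; left.
- apply: (nb _ _ h) => /=; last exact: partition_up.
    exact: partition_up partD' i0 (KD' _ h).
  by right; split=> //; left.
Qed.

Lemma partition_remove_class p : D' `<=` D -> changed p -> is_partition (D `\` K p).
Proof.
move=> D'D cp; have KN := changed_closed cp.
have finite' : finite_set (D `\` K p).
  by have [fD _ _] := partD; apply: sub_finite_set fD; exact: subDsetl.
have nb q q' : (D `\` K p) q -> D q' -> share_edge q' q -> (D' q -> D' q') -> (D `\` K p) q'.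
  move=> [Dq Kq] Dq' e qq'; split=> // Kq'; apply: Kq.
  have cq' := KN _ Kq'; have nD'q : ~ D' q.
    by move=> /qq'; have := cq'; rewrite /changed /=; tauto.
  apply: (residue_class_step Kq') e; first exact: changed_residue.
  by apply: changed_residue; left.
have [_ pos _] := partD; apply: partition_of_neighbours => // [i j [/pos]//|i j j0 h|i j i0 h].
- apply: (nb _ _ h) => /=; last exact: partition_left.
    by have [Dh _] := h; exact: partition_left partD j0 Dh.
  by left; split=> //; right.
- apply: (nb _ _ h) => /=; last exact: partition_up.
    by have [Dh _] := h; exact: partition_up partD i0 Dh.
  by right; split=> //; right.
Qed.

(** The classes of changed boxes are addable and cover what D lacks from D', so what remains for
    each generator is that no other class is addable. *)
Lemma add_changed : D `<=` D' ->
  (forall p, R p -> ~ changed p -> ~ addable D (K p)) ->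
  add_components t n r D = D'.
Proof.
move=> DD' nadd; apply/seteqP; split=> p.
  move=> [/DD' //|[_ [[q Rq ->] aq] Kp]].
  have [cq|cq] := EM (changed q); last by case: (nadd q Rq cq).
  by have := changed_closed cq Kp; rewrite /changed /=; have := DD' p; tauto.
move=> D'p; have [Dp|Dp] := EM (D p); first by left.
have cp : changed p by right.
right; exists (K p); last exact: residue_class_refl.
split; first by exists p => //; exact: changed_residue.
split; last exact: partition_add_class.
apply/seteqP; split=> q //= -[/(changed_closed cp) cq Dq].
by move: cq; rewrite /changed /=; have := DD' q; tauto.
Qed.

Lemma remove_changed : D' `<=` D ->
  (forall p, R p -> ~ changed p -> ~ removable D (K p)) ->
  remove_components t n r D = D'.
Proof.
move=> D'D nrem; apply/seteqP; split=> p; last first.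
  move=> D'p; split; first exact: D'D.
  move=> [_ [[q Rq ->] rq] Kp].
  have [cq|cq] := EM (changed q); last by case: (nrem q Rq cq).
  by have := changed_closed cq Kp; rewrite /changed /=; have := D'D p; tauto.
move=> [Dp hp]; have [//|D'p] := EM (D' p); case: hp.
have cp : changed p by left.
exists (K p); last exact: residue_class_refl.
split; first by exists p => //; exact: changed_residue.
split; last exact: partition_remove_class.
move=> q /(changed_closed cp); rewrite /changed /=; have := D'D q; tauto.
Qed.

End Components.

(** * Symmetric diagrams cut out by a profile *)

Definition profile_diagram (F : int -> int) (D : diagram) : Prop :=
  forall i j, D (i, j) <-> [/\ (0 < i)%N, (0 < j)%N & i%:Z <= F (j%:Z - i%:Z)].

Section ProfileDiagram.

Variables (B : int -> bool) (F : int -> int) (D : diagram).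
Hypothesis pF : profile B F.
Hypothesis symF : forall c : int, F (- c) = F c + c.
Hypothesis DF : profile_diagram F D.

Lemma profile_diagram_sym i j : D (i, j) <-> D (j, i).
Proof.
split=> /DF[i0 j0 h]; apply/DF; split=> //.
  have -> : i%:Z - j%:Z = - (j%:Z - i%:Z) by lia.
  by rewrite symF; lia.
have -> : j%:Z - i%:Z = - (i%:Z - j%:Z) by lia.
by rewrite symF; lia.
Qed.

Lemma profile_diagram_partition : is_partition D.
Proof.
have [_ [C FC]] := pF; apply: partition_of_neighbours => [|i j /DF[]//|i j j0|i j i0].
- have sub : D `<=` `I_(2 * absz C).+1 `*` `I_(2 * absz C).+1.
    have h1 i j : D (i, j) -> (i <= j)%N -> (j <= 2 * absz C)%N.
      move=> /DF[i0 j0 h] ij; have [h'|h'] := lerP C (j%:Z - i%:Z).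
        by rewrite (FC _ h') in h; lia.
      have := profile_le pF (_ : 0 <= j%:Z - i%:Z); have := profile_le pF (_ : 0 <= Num.max 0 C).
      by rewrite (FC (Num.max 0 C)); lia.
    move=> [i j] Dij; have [ij|ji] := leqP i j.
      by have := h1 _ _ Dij ij; split=> /=; lia.
    have Dji : D (j, i) by exact/profile_diagram_sym.
    by have := h1 _ _ Dji (ltnW ji); split=> /=; lia.
  by apply: sub_finite_set sub _; apply: finite_setX.
- move=> /DF[i0 _ h]; apply/DF; split=> //.
  have := profile_step (j.+1%:Z - i%:Z) pF.
  have -> : j.+1%:Z - i%:Z - 1 = j%:Z - i%:Z by lia.
  by case: (B _) => /=; lia.
- move=> /DF[_ j0 h]; apply/DF; split=> //.
  have := profile_step (j%:Z - i%:Z) pF.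
  have -> : j%:Z - i%:Z - 1 = j%:Z - i.+1%:Z by lia.
  by case: (B _) => /=; lia.
Qed.

Lemma diag_ge (c : int) : - c <= F c.
Proof. by have := symF c; have := profile_ge0 (- c) pF; lia. Qed.

(** The right end of row i is the north-step of the i-th bead from the end, and a north-step after
    column c in row i has position c + 1 - i. *)
Lemma row_ends_profile (i c : nat) : (0 < i)%N -> (0 < c)%N ->
  row_ends D i c <-> B (c.+1%:Z - i%:Z) /\ F (c.+1%:Z - i%:Z) = i%:Z - 1.
Proof.
move=> i0 c0; have := profile_step (c.+1%:Z - i%:Z) pF.
have -> : c.+1%:Z - i%:Z - 1 = c%:Z - i%:Z by lia.
move=> st; split=> [h|[Bc Fc] j j0].
  have /DF[_ _ h1] : D (i, c) by apply/h.
  have h2 : ~ D (i, c.+1) by move=> /(proj1 (h c.+1 isT)); rewrite ltnn.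
  have [h3|h3] := lerP i%:Z (F (c.+1%:Z - i%:Z)); first by case: h2; apply/DF.
  by move: st; case: (B _) => /= st; split=> //; lia.
rewrite Bc Fc /= in st; split.
  move=> /DF[_ _ h]; have [//|jc] := leqP j c.
  by have := profile_le pF (_ : c.+1%:Z - i%:Z <= j%:Z - i%:Z); lia.
move=> jc; apply/DF; split=> //.
by have := profile_le pF (_ : j%:Z - i%:Z <= c%:Z - i%:Z); lia.
Qed.

End ProfileDiagram.

Section Changed.

Variables (F F' : int -> int) (D D' : diagram).
Hypotheses (DF : profile_diagram F D) (DF' : profile_diagram F' D').
Local Notation changed := (changed D D').

Lemma changedE i j : (0 < i)%N -> (0 < j)%N ->
  changed (i, j) <-> (F' (j%:Z - i%:Z) < i%:Z <= F (j%:Z - i%:Z)) \/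
    (F (j%:Z - i%:Z) < i%:Z <= F' (j%:Z - i%:Z)).
Proof.
move=> i0 j0.
have DE : D (i, j) <-> i%:Z <= F (j%:Z - i%:Z).
  by split=> [/DF[]//|h]; apply/DF.
have DE' : D' (i, j) <-> i%:Z <= F' (j%:Z - i%:Z).
  by split=> [/DF'[]//|h]; apply/DF'.
have E (x y : int) : (x < i%:Z <= y) <-> (i%:Z <= y) /\ ~ (i%:Z <= x) by split; lia.
have := E (F' (j%:Z - i%:Z)) (F (j%:Z - i%:Z)).
have := E (F (j%:Z - i%:Z)) (F' (j%:Z - i%:Z)).
by rewrite /changed /=; tauto.
Qed.

Lemma changed_sym i j : (forall c : int, F (- c) = F c + c) ->
  (forall c : int, F' (- c) = F' c + c) -> changed (i, j) -> changed (j, i).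
Proof.
move=> symF symF'; rewrite /changed /=; have := profile_diagram_sym symF DF i j.
by have := profile_diagram_sym symF' DF' i j; tauto.
Qed.

End Changed.

(** * Generators exchanging adjacent positions *)

Section Single.

Variables (t : quotient_type) (n r : nat) (A : int -> Prop).
Variables (B B' : int -> bool) (F F' : int -> int) (D D' : diagram).
Hypotheses (pF : profile B F) (pF' : profile B' F').
Hypotheses (symF : forall c : int, F (- c) = F c + c).
Hypotheses (symF' : forall c : int, F' (- c) = F' c + c).
Hypotheses (DF : profile_diagram F D) (DF' : profile_diagram F' D').
Hypothesis sparse : forall c : int, A c -> ~ A (c + 1).
Hypothesis swapped : forall c : int, A c -> B' c = B (c + 1) /\ B' (c + 1) = B c.
Hypothesis unmoved : forall c : int, ~ A c -> ~ A (c - 1) -> B' c = B c.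

Lemma profile_single (c : int) :
  F' c = if `[< A c >] then F c + (B c : nat)%:Z - (B (c + 1) : nat)%:Z else F c.
Proof.
move: c; apply: (profile_unique pF'); split.
  move=> c; have st := profile_step c pF.
  have eq1 : c - 1 + 1 = c by lia.
  case: (asboolP (A c)) => Ac; case: (asboolP (A (c - 1))) => Ac1; rewrite ?eq1.
  - by have := sparse Ac1; rewrite eq1.
  - by have [-> _] := swapped Ac; lia.
  - by have [_] := swapped Ac1; rewrite eq1 => ->; lia.
  - by rewrite unmoved.
have [hF [C FC]] := pF; exists (C + 1) => c hc.
have := hF c; have := hF (c + 1); rewrite !FC ?if_same; try lia.
by case: (B c) => /=; case: (B (c + 1)) => /=; case: ifP => _; lia.
Qed.

Local Notation R := (has_residue t n D r).
Local Notation K := (residue_class t n D r).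
Local Notation changed := (changed D D').

Hypothesis residueA : forall i j, R (i, j) -> [/\ (0 < i)%N, (0 < j)%N & A (j%:Z - i%:Z)].
Hypothesis residueN : forall p, changed p -> R p.

(** Boxes sharing an edge lie on neighbouring diagonals, which are never both active, so every
    component is a single box. *)
Lemma single_class p q : K p q -> q = p.
Proof.
move: q; suff : K p `<=` [set p] by [].
apply: residue_class_closed => // q q' -> Rp Rq'.
case: p q' Rp Rq' => i j [i' j'] /residueA[i0 j0 A1] /residueA[i0' j0' A2].
have := sparse A1; have := sparse A2; rewrite /share_edge /= => h2 h1 e; exfalso.
have [c|c] : j%:Z - i%:Z + 1 = j'%:Z - i'%:Z \/ j'%:Z - i'%:Z + 1 = j%:Z - i%:Z by lia.
  by apply: h1; rewrite c.
by apply: h2; rewrite c.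
Qed.

Let partD := profile_diagram_partition pF symF DF.
Let partD' := profile_diagram_partition pF' symF' DF'.

Lemma single_closed p : changed p -> K p `<=` changed.
Proof. by move=> cp q /single_class ->. Qed.

(** If the box fits, its neighbours above and to the left are in D. This forces a bead at c and a
    gap at c + 1, and the exchange then gains this very box. *)
Lemma single_not_addable p : R p -> ~ changed p -> ~ addable D (K p).
Proof.
case: p => i j Rp np [KD pK].
have [i0 j0 Ac] := residueA Rp.
have Kp : K (i, j) (i, j) by exact: residue_class_refl.
have Dp : ~ D (i, j) by move=> Dp; have : (K (i, j) `&` D) (i, j) by []; rewrite KD.
have Fi : F (j%:Z - i%:Z) < i%:Z.
  by rewrite ltNge; apply/negP => h; apply: Dp; apply/DF.
have D1 q : q <> (i, j) -> (D `|` K (i, j)) q -> D q.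
  by move=> qp [//|/single_class].
have inU : (D `|` K (i, j)) (i, j) by right.
pose c := j%:Z - i%:Z.
have up : i%:Z - 1 <= F (c + 1).
  have [i1|i1] := eqVneq i 1%N; first by have := profile_ge0 (c + 1) pF; lia.
  have : D (i.-1, j).
    apply: D1; first by case; lia.
    by apply: (partition_up pK); [lia|have -> : i.-1.+1 = i by lia].
  move=> /DF[_ _]; have -> : j%:Z - i.-1%:Z = c + 1 by rewrite /c; lia.
  by lia.
have left : i%:Z <= F (c - 1).
  have [j1|j1] := eqVneq j 1%N.
    (* In column 1 there is no left neighbour; symmetry gives F (c - 1) >= 1 - c = i instead. *)
    by have := diag_ge pF symF (c - 1); rewrite /c j1; lia.
  have : D (i, j.-1).
    apply: D1; first by case; lia.
    by apply: (partition_left pK); [lia|have -> : j.-1.+1 = j by lia].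
  move=> /DF[_ _]; have -> : j.-1%:Z - i%:Z = c - 1 by rewrite /c; lia.
  by [].
have := profile_step c pF; have := profile_step (c + 1) pF; rewrite addrK.
have := profile_single c; have -> : `[< A c >] by apply/asboolP.
rewrite -/c in Fi => F'E s1 s2.
apply: np; right; split=> //; apply/DF'; split=> //; rewrite -/c F'E.
by move: s1 s2; case: (B c) => /=; case: (B (c + 1)) => /=; lia.
Qed.

(** Dually, removability forces a gap at c and a bead at c + 1. *)
Lemma single_not_removable p : R p -> ~ changed p -> ~ removable D (K p).
Proof.
case: p => i j Rp np [KD pK].
have [i0 j0 Ac] := residueA Rp.
have Kp : K (i, j) (i, j) by exact: residue_class_refl.
have /DF[_ _ Fi] := KD _ Kp.
have nU : ~ (D `\` K (i, j)) (i, j) by move=> [].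
pose c := j%:Z - i%:Z.
have right' : F (c + 1) < i%:Z.
  rewrite ltNge; apply/negP => h; apply: nU; apply: (partition_left pK j0); split.
    by apply/DF; split=> //; have -> : j.+1%:Z - i%:Z = c + 1 by rewrite /c; lia.
  by move=> /single_class[]; lia.
have down : F (c - 1) < i%:Z + 1.
  rewrite ltNge; apply/negP => h; apply: nU; apply: (partition_up pK i0); split.
    apply/DF; split=> //; have -> : j%:Z - i.+1%:Z = c - 1 by rewrite /c; lia.
    by lia.
  by move=> /single_class[]; lia.
have := profile_step c pF; have := profile_step (c + 1) pF; rewrite addrK.
have := profile_single c; have -> : `[< A c >] by apply/asboolP.
rewrite -/c in Fi => F'E s1 s2.
apply: np; left; split; first exact: KD.
move=> /DF'[_ _]; rewrite -/c F'E.
by move: s1 s2; case: (B c) => /=; case: (B (c + 1)) => /=; lia.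
Qed.

Lemma single_add : (forall c : int, A c -> B (c + 1) -> B c) ->
  add_components t n r D = D'.
Proof.
move=> asc; apply: (add_changed partD partD' residueN single_closed); last exact: single_not_addable.
move=> [i j] /DF[i0 j0 h]; apply/DF'; split=> //; rewrite profile_single.
case: asboolP => // Ac; have := asc _ Ac.
by case: (B _) => /=; case: (B _) => /=; lia.
Qed.

Lemma single_remove : (forall c : int, A c -> B c -> B (c + 1)) ->
  remove_components t n r D = D'.
Proof.
move=> des; apply: (remove_changed partD partD' residueN single_closed); last exact: single_not_removable.
move=> [i j] /DF'[i0 j0]; rewrite profile_single => h; apply/DF; split=> //; move: h.
case: asboolP => // Ac; have := des _ Ac.
by case: (B _) => /=; case: (B _) => /=; lia.
Qed.

End Single.

(** * Generators exchanging positions at distance two *)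

Section Double.

Variables (t : quotient_type) (n r : nat) (A : int -> Prop).
Variables (B B' : int -> bool) (F F' : int -> int) (D D' : diagram).
Hypotheses (pF : profile B F) (pF' : profile B' F').
Hypotheses (symF : forall c : int, F (- c) = F c + c).
Hypotheses (symF' : forall c : int, F' (- c) = F' c + c).
Hypotheses (DF : profile_diagram F D) (DF' : profile_diagram F' D').
Hypothesis sparse : forall c c' : int, A c -> A c' -> `|c - c'| <= 5 -> c = c'.
Hypothesis symA : forall c : int, A c -> A (- c).
Hypothesis swapped : forall c : int, A c ->
  [/\ B' (c - 1) = B (c + 1), B' (c + 1) = B (c - 1), B' c = B (c + 2) & B' (c + 2) = B c].
Hypothesis unmoved : forall c : int,
  ~ A (c + 1) -> ~ A c -> ~ A (c - 1) -> ~ A (c - 2) -> B' c = B c.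

(** Around a centre c0, both exchanges affect F at c0, only that of c0 - 1 and c0 + 1 affects it at
    c0 - 1, and only that of c0 and c0 + 2 at c0 + 1. *)
Lemma profile_double (c : int) : F' c =
  if `[< A (c + 1) >] then F c + (B c : nat)%:Z - (B (c + 2) : nat)%:Z
  else if `[< A c >] then F c + (B (c - 1) : nat)%:Z - (B (c + 1) : nat)%:Z
      + (B c : nat)%:Z - (B (c + 2) : nat)%:Z
  else if `[< A (c - 1) >] then F c + (B (c - 1) : nat)%:Z - (B (c + 1) : nat)%:Z
  else F c.
Proof.
move: c; apply: (profile_unique pF'); split.
  move=> c; have st := profile_step c pF.
  have e1 : c - 1 + 1 = c by lia.
  have e2 : c - 1 + 2 = c + 1 by lia.
  have e3 : c - 1 - 1 = c - 2 by lia.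
  have e4 : c - 2 + 1 = c - 1 by lia.
  have e5 : c - 2 + 2 = c by lia.
  have e6 : c + 1 - 1 = c by lia.
  have e7 : c + 1 + 1 = c + 2 by lia.
  rewrite e1 e2 e3; have sp := sparse.
  case: (asboolP (A (c + 1))) => A1; case: (asboolP (A c)) => A0;
   case: (asboolP (A (c - 1))) => A3; case: (asboolP (A (c - 2))) => A4;
   try (by have := sp _ _ A1 A0; lia); try (by have := sp _ _ A1 A3; lia);
   try (by have := sp _ _ A1 A4; lia); try (by have := sp _ _ A0 A3; lia);
   try (by have := sp _ _ A0 A4; lia); try (by have := sp _ _ A3 A4; lia).
  - by have [] := swapped A1; rewrite e6 e7 => -> _ _ _; lia.
  - by have [_ _ -> _] := swapped A0; lia.
  - by have [_ + _ _] := swapped A3; rewrite e1 e3 => ->; lia.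
  - by have [_ _ _ +] := swapped A4; rewrite e5 => ->; lia.
  - by rewrite unmoved.
have [hF [C FC]] := pF; exists (C + 2) => c hc.
have Bz (d : int) : C < d -> B d = false.
  by move=> Cd; have := hF d; rewrite !FC; try lia; case: (B d).
by rewrite !Bz ?FC /= ?addr0 ?subr0 ?if_same; lia.
Qed.

Lemma profile_double_at (c : int) : A c ->
  [/\ F' (c - 1) = F (c - 1) + (B (c - 1) : nat)%:Z - (B (c + 1) : nat)%:Z,
      F' c = F c + (B (c - 1) : nat)%:Z - (B (c + 1) : nat)%:Z
         + (B c : nat)%:Z - (B (c + 2) : nat)%:Z &
      F' (c + 1) = F (c + 1) + (B c : nat)%:Z - (B (c + 2) : nat)%:Z].
Proof.
move=> Ac; rewrite !profile_double.
have e1 : c - 1 + 1 = c by lia.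
have e2 : c - 1 + 2 = c + 1 by lia.
have e3 : c + 1 - 1 = c by lia.
have e4 : c + 1 + 1 = c + 2 by lia.
have nA (d : int) : d <> 0 -> `|d| <= 5 -> `[< A (c + d) >] = false.
  move=> d0 d5; apply/asboolP => Ad; have := sparse Ac Ad; lia.
have -> : `[< A (c + 1) >] = false by exact: nA.
have -> : `[< A (c + 1 + 1) >] = false by rewrite -addrA nA.
have -> : `[< A (c + 1 - 1) >] = true by rewrite e3; apply/asboolP.
have -> : `[< A (c - 1 + 1) >] = true by rewrite e1; apply/asboolP.
have -> : `[< A c >] = true by apply/asboolP.
by rewrite e2 e3 e4.
Qed.

Lemma profile_double_off (c : int) :
  (forall c0, A c0 -> 1 < `|c - c0|) -> F' c = F c.
Proof.
move=> h; rewrite profile_double.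
by case: asboolP => [/h|_]; [lia|case: asboolP => [/h|_]; [lia|case: asboolP => [/h|_]; lia]].
Qed.

(* The rows meeting a strip centred on the diagonal c0 whose ends assign
   residues are those of the beads at c0 - 1, c0, c0 + 1 and c0 + 2. *)
Definition strip_box (c0 : int) (i : nat) (c : int) : Prop :=
  let ends d := B (c0 + d) /\ F (c0 + d) = i%:Z - 1 in
  (c = c0 - 1 /\ (ends (- 1) \/ ends 1)) \/
  (c = c0 /\ (ends (- 1) \/ ends 0 \/ ends 1 \/ ends 2)) \/
  (c = c0 + 1 /\ (ends 0 \/ ends 2)).

Local Notation R := (has_residue t n D r).
Local Notation K := (residue_class t n D r).
Local Notation changed := (changed D D').

Hypothesis upper_free : forall c : int, A c -> 0 < c ->
  ~~ (B (c - 1) && B (c + 2)) /\ ~~ (B c && B (c + 1)).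
Hypothesis main_anti : A 0 -> B 2 = ~~ B (- 1) /\ B 1 = ~~ B 0.
Hypothesis main_even : A 0 -> ~~ odd (absz (F 0)).
Hypothesis residue_sym : forall i j, R (i, j) -> R (j, i).
Hypothesis residue_near : forall i j, R (i, j) -> [/\ (0 < i)%N, (0 < j)%N &
  exists c0 : int, A c0 /\ `|j%:Z - i%:Z - c0| <= 1].
Hypothesis residue_upper : forall (c0 : int) i j, A c0 -> 0 < c0 ->
  (0 < i)%N -> (0 < j)%N -> `|j%:Z - i%:Z - c0| <= 1 ->
  R (i, j) <-> strip_box c0 i (j%:Z - i%:Z).
Hypothesis residue_main : forall i j, A 0 -> (0 < i)%N -> (0 < j)%N ->
  `|j%:Z - i%:Z| <= 1 -> R (i, j) <-> (i = j \/ odd (minn i j)).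

Lemma changed_near i j : changed (i, j) -> [/\ (0 < i)%N, (0 < j)%N &
  exists c0 : int, A c0 /\ `|j%:Z - i%:Z - c0| <= 1].
Proof.
move=> ch; have [i0 j0] : (0 < i)%N /\ (0 < j)%N.
  by case: ch => [[/DF[]]|[_ /DF'[]]].
split=> //; have [//|h] := EM (exists c0 : int, A c0 /\ `|j%:Z - i%:Z - c0| <= 1).
have F'F : F' (j%:Z - i%:Z) = F (j%:Z - i%:Z).
  apply: profile_double_off => c0 Ac0; rewrite ltNge; apply/negP => h'.
  by apply: h; exists c0.
by have := ch; move=> /(changedE DF DF' i0 j0); rewrite F'F; lia.
Qed.

(** The uniform form [c0 + d], even for d = 0, lets [strip_abstract] replace the four beads and four
    counts by variables, leaving a finite case analysis. *)
Lemma strip_steps (c0 : int) :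
  [/\ F (c0 + - 1) = F (c0 + 0) + (B (c0 + 0) : nat)%:Z,
      F (c0 + 0) = F (c0 + 1) + (B (c0 + 1) : nat)%:Z &
      F (c0 + 1) = F (c0 + 2) + (B (c0 + 2) : nat)%:Z].
Proof.
have st (d d' : int) : d' = d - 1 -> F (c0 + d') = F (c0 + d) + (B (c0 + d) : nat)%:Z.
  by move=> ->; rewrite addrA; exact: profile_step.
by split; apply: st.
Qed.

Definition strip_changed (c0 : int) (i : nat) (c : int) : Prop :=
  let f d := F (c0 + d) in let b d := (B (c0 + d) : nat)%:Z in
  let between (x y : int) := x < i%:Z <= y \/ y < i%:Z <= x in
  (c = c0 - 1 /\ between (f (- 1)) (f (- 1) + b (- 1) - b 1)) \/
  (c = c0 /\ between (f 0) (f 0 + b (- 1) - b 1 + b 0 - b 2)) \/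
  (c = c0 + 1 /\ between (f 1) (f 1 + b 0 - b 2)).

Lemma changed_strip (c0 : int) i j : A c0 -> (0 < i)%N -> (0 < j)%N ->
  `|j%:Z - i%:Z - c0| <= 1 ->
  changed (i, j) <-> strip_changed c0 i (j%:Z - i%:Z).
Proof.
move=> Ac0 i0 j0 near; have [f0 f1 f2] := profile_double_at Ac0.
apply: iff_trans (changedE DF DF' i0 j0) _; rewrite /strip_changed /= addr0.
have [c|[c|c]] : j%:Z - i%:Z = c0 - 1 \/ j%:Z - i%:Z = c0 \/ j%:Z - i%:Z = c0 + 1.
  by move: near; clear; lia.
- by rewrite c f0; clear; split; lia.
- by rewrite c f1; clear; split; lia.
- by rewrite c f2; clear; split; lia.
Qed.

Ltac strip_abstract c0 :=
  have [] := strip_steps c0;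
  move: (B (c0 + - 1)) (B (c0 + 0)) (B (c0 + 1)) (B (c0 + 2))
    (F (c0 + - 1)) (F (c0 + 0)) (F (c0 + 1)) (F (c0 + 2));
  move=> b0 b1 b2 b3 f0 f1 f2 f3 s0 s1 s2.

Lemma strip_free (c0 : int) : A c0 -> 0 < c0 ->
  ~~ (B (c0 + - 1) && B (c0 + 2)) /\ ~~ (B (c0 + 0) && B (c0 + 1)).
Proof. by move=> Ac0 p0; have := upper_free Ac0 p0; rewrite addr0. Qed.

(** The two excluded pairs of beads leave nine of the sixteen patterns on the four positions, and
    each is checked. *)
Lemma strip_changed_box (c0 : int) i c : A c0 -> 0 < c0 ->
  strip_changed c0 i c -> strip_box c0 i c.
Proof.
move=> Ac0 p0; have [] := strip_free Ac0 p0; rewrite /strip_changed /strip_box /=.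
strip_abstract c0; case: b0 s0; case: b1 s1; case: b2 s2; case: b3 => //= s0 s1 s2 _ _;
  move=> [[->]|[[->]|[->]]] h; clear -s0 s1 s2 h; first [left; lia|right; left; lia|right; right; lia].
Qed.

(** This keeps a whole component inside the changed boxes; the four alternatives are the edges of a
    box in terms of row and diagonal. *)
Lemma strip_changed_step (c0 : int) (i i' : nat) (c c' : int) : A c0 -> 0 < c0 ->
  strip_changed c0 i c -> strip_box c0 i' c' ->
  [\/ i' = i /\ c' = c + 1, i' = i /\ c' = c - 1,
      i' = i.+1 /\ c' = c - 1 | i = i'.+1 /\ c' = c + 1] ->
  strip_changed c0 i' c'.
Proof.
move=> Ac0 p0; have [] := strip_free Ac0 p0; rewrite /strip_changed /strip_box /=.
strip_abstract c0; case: b0 s0; case: b1 s1; case: b2 s2; case: b3 => //= s0 s1 s2 _ _;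
  move=> [[->]|[[->]|[->]]] h [[->]|[[->]|[->]]] h' e;
  clear -s0 s1 s2 h h' e; first [left; lia|right; left; lia|right; right; lia].
Qed.

Lemma upper_changed_residue (c0 : int) i j : A c0 -> 0 < c0 ->
  (0 < i)%N -> (0 < j)%N -> `|j%:Z - i%:Z - c0| <= 1 -> changed (i, j) -> R (i, j).
Proof.
move=> Ac0 p0 i0 j0 near /(changed_strip Ac0 i0 j0 near) h.
by apply/(residue_upper Ac0 p0 i0 j0 near); apply: strip_changed_box.
Qed.

Lemma share_edge_diagonal i j i' j' : share_edge (i, j) (i', j') ->
  [\/ i' = i /\ j'%:Z - i'%:Z = j%:Z - i%:Z + 1, i' = i /\ j'%:Z - i'%:Z = j%:Z - i%:Z - 1,
      i' = i.+1 /\ j'%:Z - i'%:Z = j%:Z - i%:Z - 1 |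
      i = i'.+1 /\ j'%:Z - i'%:Z = j%:Z - i%:Z + 1].
Proof.
rewrite /share_edge /= => -[[-> [->|->]]|[-> [->|->]]].
- by constructor 2; lia.
- by constructor 1; lia.
- by constructor 4; lia.
- by constructor 3; lia.
Qed.

Lemma near_class (c0 : int) i j i' j' : A c0 -> `|j%:Z - i%:Z - c0| <= 1 ->
  R (i', j') -> share_edge (i, j) (i', j') -> `|j'%:Z - i'%:Z - c0| <= 1.
Proof.
move=> Ac0 near /residue_near[_ _ [c1 [Ac1 near1]]] /share_edge_diagonal e.
have d : `|j'%:Z - i'%:Z - (j%:Z - i%:Z)| <= 1.
  by case: e => -[_ ->]; lia.
by have -> // : c0 = c1 by apply: sparse => //; lia.
Qed.

Lemma upper_closed (c0 : int) i j : A c0 -> 0 < c0 ->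
  `|j%:Z - i%:Z - c0| <= 1 -> changed (i, j) -> K (i, j) `<=` changed.
Proof.
move=> Ac0 p0 near ch.
suff : K (i, j) `<=` [set q | changed q /\ `|q.2%:Z - q.1%:Z - c0| <= 1].
  by move=> h q /h[].
apply: residue_class_closed => //= -[x y] [x' y'] /= [cq nq] Rq Rq' e.
have nq' := near_class Ac0 nq Rq' e; split=> //.
have [x0 y0 _] := residue_near Rq; have [x0' y0' _] := residue_near Rq'.
apply/(changed_strip Ac0 x0' y0' nq').
move: cq Rq' => /(changed_strip Ac0 x0 y0 nq) cq /(residue_upper Ac0 p0 x0' y0' nq') Rq'.
by apply: (strip_changed_step Ac0 p0 cq Rq'); apply: share_edge_diagonal.
Qed.

Lemma mixed_class p q q' : D q -> ~ D q' -> K p q -> K p q' ->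
  ~ addable D (K p) /\ ~ removable D (K p).
Proof.
move=> Dq Dq' Kq Kq'; split=> -[KD _].
  by have : (K p `&` D) q by []; rewrite KD.
by apply: Dq'; exact: KD.
Qed.

(** The two middle boxes lie on either side of the boundary and are linked to all four, so the class
    meets both D and its complement. *)
Lemma snake_class p x y : R (x, y) -> R (x, y.+1) -> R (x.+1, y.+1) -> R (x.+1, y.+2) ->
  D (x, y.+1) -> ~ D (x.+1, y.+1) ->
  [\/ p = (x, y), p = (x, y.+1), p = (x.+1, y.+1) | p = (x.+1, y.+2)] ->
  ~ addable D (K p) /\ ~ removable D (K p).
Proof.
move=> R1 R2 R3 R4 D2 D3 hp.
have e12 : share_edge (x, y) (x, y.+1) by left; split=> //; right.
have e23 : share_edge (x, y.+1) (x.+1, y.+1) by right; split=> //; right.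
have e34 : share_edge (x.+1, y.+1) (x.+1, y.+2) by left; split=> //; right.
have e32 := share_edge_sym e23; have e43 := share_edge_sym e34.
suff [K2 K3] : K p (x, y.+1) /\ K p (x.+1, y.+1) by exact: mixed_class D2 D3 K2 K3.
case: hp => pE; have := residue_class_refl t n D r p; rewrite {2}pE => K0.
- have K2 := residue_class_step K0 R1 R2 e12.
  by split=> //; exact: residue_class_step K2 R2 R3 e23.
- by split=> //; exact: residue_class_step K0 R2 R3 e23.
- by split=> //; exact: residue_class_step K0 R3 R2 e32.
- have K3 := residue_class_step K0 R4 R3 e43.
  by split=> //; exact: residue_class_step K3 R3 R2 e32.
Qed.

(** A residue box is unchanged only when two exchanged positions both carry beads: c0 - 1 and c0 +
    1, or c0 and c0 + 2. Beyond c0 + 2 there are x - 1 beads, so theirs are the rows x and x + 1,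
    which form a snake across the boundary. *)
Lemma strip_mixed (c0 : int) (i x : nat) c : A c0 -> 0 < c0 ->
  x%:Z = F (c0 + 2) + 1 -> strip_box c0 i c -> ~ strip_changed c0 i c ->
  (i = x \/ i = x.+1) /\
  ([/\ c = c0 - 1 \/ c = c0, strip_box c0 x (c0 - 1) /\ strip_box c0 x c0,
     strip_box c0 x.+1 (c0 - 1) /\ strip_box c0 x.+1 c0, x%:Z <= F (c0 + 0) &
     F (c0 + - 1) < x%:Z + 1] \/
   [/\ c = c0 \/ c = c0 + 1, strip_box c0 x c0 /\ strip_box c0 x (c0 + 1),
     strip_box c0 x.+1 c0 /\ strip_box c0 x.+1 (c0 + 1), x%:Z <= F (c0 + 1) &
     F (c0 + 0) < x%:Z + 1]).
Proof.
move=> Ac0 p0; have [] := strip_free Ac0 p0; rewrite /strip_changed /strip_box /=.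
strip_abstract c0; case: b0 s0; case: b1 s1; case: b2 s2; case: b3 => //= s0 s1 s2 _ _ xE;
  move=> [[->]|[[->]|[->]]] h h'; clear -s0 s1 s2 xE h h';
  try (by case: h'; first [left; lia|right; left; lia|right; right; lia]);
  (split; [lia|first [left; split; lia|right; split; lia]]).
Qed.

Lemma upper_mixed (c0 : int) i j : A c0 -> 0 < c0 ->
  `|j%:Z - i%:Z - c0| <= 1 -> R (i, j) -> ~ changed (i, j) ->
  ~ addable D (K (i, j)) /\ ~ removable D (K (i, j)).
Proof.
move=> Ac0 p0 near Rp nch; have [i0 j0 _] := residue_near Rp.
have /(residue_upper Ac0 p0 i0 j0 near) bx := Rp.
have F2 := profile_ge0 (c0 + 2) pF.
have xE : (absz (F (c0 + 2))).+1%:Z = F (c0 + 2) + 1 by lia.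
move: (absz (F (c0 + 2))).+1 xE => x xE; have x0 : (0 < x)%N by lia.
have nsc : ~ strip_changed c0 i (j%:Z - i%:Z).
  by move=> /(changed_strip Ac0 i0 j0 near).
have toR (a b : nat) (c : int) : (0 < a)%N -> (0 < b)%N -> b%:Z - a%:Z = c ->
    `|c - c0| <= 1 -> strip_box c0 a c -> R (a, b).
  by move=> a0 b0 cE; rewrite -cE => nr /(residue_upper Ac0 p0 a0 b0 nr).
have [hi [[hc [s1 s2] [s3 s4] f1 f2]|[hc [s1 s2] [s3 s4] f1 f2]]] := strip_mixed Ac0 p0 xE bx nsc.
- have [y yE] : exists y : nat, y%:Z = x%:Z + (c0 - 1).
    by exists (absz (x%:Z + (c0 - 1))%R); lia.
  apply: (@snake_class _ x y).
  + by apply: (toR x y (c0 - 1)) => //; lia.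
  + by apply: (toR x y.+1 c0) => //; lia.
  + by apply: (toR x.+1 y.+1 (c0 - 1)) => //; lia.
  + by apply: (toR x.+1 y.+2 c0) => //; lia.
  + apply/DF; split=> //; move: f1; rewrite addr0.
    by have -> : y.+1%:Z - x%:Z = c0 by lia.
  + move=> /DF[_ _]; have -> : y.+1%:Z - x.+1%:Z = c0 - 1 by lia.
    by lia.
  + by case: hi => hi; case: hc => hc; [constructor 1|constructor 2|constructor 3|constructor 4];
      congr pair; lia.
- have [y yE] : exists y : nat, y%:Z = x%:Z + c0.
    by exists (absz (x%:Z + c0)%R); lia.
  apply: (@snake_class _ x y).
  + by apply: (toR x y c0) => //; lia.
  + by apply: (toR x y.+1 (c0 + 1)) => //; lia.
  + by apply: (toR x.+1 y.+1 c0) => //; lia.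
  + by apply: (toR x.+1 y.+2 (c0 + 1)) => //; lia.
  + apply/DF; split=> //.
    by have -> : y.+1%:Z - x%:Z = c0 + 1 by lia.
  + move=> /DF[_ _]; have -> : y.+1%:Z - x.+1%:Z = c0 by lia.
    by move: f2; rewrite addr0; lia.
  + by case: hi => hi; case: hc => hc; [constructor 1|constructor 2|constructor 3|constructor 4];
      congr pair; lia.
Qed.

(** By the rule modulo 4, these squares along the diagonal are the components of residue 0 in the
    main descalator. *)
Definition main_block (k : nat) : diagram :=
  [set q | (2 * k < q.1 <= 2 * k + 2)%N && (2 * k < q.2 <= 2 * k + 2)%N].

Lemma main_block_residue k i j : A 0 -> main_block k (i, j) -> R (i, j).
Proof.
by rewrite /main_block /= => A0 h; apply/residue_main; rewrite //; lia.
Qed.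

Lemma residue_main_block i j : A 0 -> `|j%:Z - i%:Z| <= 1 -> R (i, j) ->
  main_block (i.-1)./2 (i, j).
Proof.
move=> A0 near Rp; have [i0 j0 _] := residue_near Rp.
by move: Rp => /(residue_main A0 i0 j0 near); rewrite /main_block /= => -[h|h]; lia.
Qed.

Lemma main_block_class k p : A 0 -> main_block k p -> K p = main_block k.
Proof.
move=> A0 Sp; apply/seteqP; split.
  apply: residue_class_closed => // -[i j] [i' j'] Sq Rq Rq' e.
  have near : `|j'%:Z - i'%:Z - 0| <= 1.
    by apply: (near_class A0 _ Rq' e); move: Sq; rewrite /main_block /=; lia.
  rewrite subr0 in near; have := residue_main_block A0 near Rq'.
  by move: Sq e; rewrite /main_block /share_edge /=; lia.
case: p Sp => i j Sp [i' j'] Sq.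
have Sm : main_block k (i, j') by move: Sp Sq; rewrite /main_block /=; lia.
have Rp := main_block_residue A0 Sp; have Rq := main_block_residue A0 Sq.
have Rm := main_block_residue A0 Sm.
have Km : K (i, j) (i, j').
  have [<-|jj] := eqVneq j j'; first exact: residue_class_refl.
  apply: (residue_class_step (residue_class_refl _ _ _ _ _)) => //.
  by move: Sp Sq; rewrite /main_block /share_edge /=; lia.
have [<- //|ii] := eqVneq i i'.
apply: (residue_class_step Km) => //.
by move: Sp Sq; rewrite /main_block /share_edge /=; lia.
Qed.

Lemma main_facts : A 0 -> exists m : nat,
  [/\ F (0 + 0) = 2 * m%:Z, B (0 + 2) = ~~ B (0 + - 1) & B (0 + 1) = ~~ B (0 + 0)].
Proof.
move=> A0; have [a1 a2] := main_anti A0; exists (absz (F 0))./2.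
have := main_even A0; have := profile_ge0 0 pF; rewrite !add0r => h1 h2.
by split=> //; lia.
Qed.

Lemma main_changed_residue i j : A 0 -> `|j%:Z - i%:Z| <= 1 ->
  changed (i, j) -> R (i, j).
Proof.
move=> A0 near ch; have [i0 j0 _] := changed_near ch.
have near' : `|j%:Z - i%:Z - 0| <= 1 by rewrite subr0.
apply/(residue_main A0 i0 j0 near).
move: ch => /(changed_strip A0 i0 j0 near'); have [m []] := main_facts A0.
rewrite /strip_changed /=; strip_abstract (0 : int) => fm e1 e2.
rewrite e1 e2 in s0 s1 s2 *; move: s0 s1 s2.
by case: (b0); case: (b1) => /= s0 s1 s2 h; clear -s0 s1 s2 h fm near; lia.
Qed.

(** Positions 1 and 2 carry the opposite of 0 and -1, so a block moves as a whole: it is gained if 1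
    and 2 are gaps, lost if both are beads. The evenness of F 0 aligns the change with the
    blocks. *)
Lemma main_block_changed k i j : A 0 -> main_block k (i, j) ->
  changed (i, j) <-> (F (0 + 0) = 2 * k%:Z /\ F (0 + 2) = F (0 + 0)) \/
    (F (0 + 0) = 2 * k%:Z + 2 /\ F (0 + 2) = F (0 + 0) - 2).
Proof.
move=> A0; rewrite /main_block /= => S.
have near' : `|j%:Z - i%:Z - 0| <= 1 by lia.
apply: iff_trans (changed_strip A0 _ _ near') _; [lia|lia|].
have [m []] := main_facts A0.
rewrite /strip_changed /=; strip_abstract (0 : int) => fm e1 e2.
have cE : (j = i \/ j = i.+1 \/ i = j.+1) by clear -S; lia.
rewrite e1 e2 in s0 s1 s2 *.
by move: s0 s1 s2; case: (b0); case: (b1) => /= s0 s1 s2; clear -s0 s1 s2 fm S cE;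
  case: cE => [cE|[cE|cE]]; subst; split; lia.
Qed.

Lemma main_closed i j : A 0 -> `|j%:Z - i%:Z| <= 1 -> changed (i, j) ->
  K (i, j) `<=` changed.
Proof.
move=> A0 near ch; have Rp := main_changed_residue A0 near ch.
have Sp := residue_main_block A0 near Rp; rewrite (main_block_class A0 Sp).
by move: ch => /(main_block_changed A0 Sp) h [x y] Sq; apply/(main_block_changed A0 Sq).
Qed.

(** An addable block forces (2k, 2k) and (2k, 2k + 2) into D, hence F 0 = 2k without beads at 1 and
    2, so the block is changed. For k = 0 these boxes do not exist and F >= 0 replaces them. *)
Lemma main_not_addable i j : A 0 -> `|j%:Z - i%:Z| <= 1 -> R (i, j) ->
  ~ changed (i, j) -> ~ addable D (K (i, j)).
Proof.
move=> A0 near Rp nch; have Sp := residue_main_block A0 near Rp.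
move: (i.-1)./2 Sp => k Sp; rewrite (main_block_class A0 Sp) => -[KD pK].
have [m [Fm _ _]] := main_facts A0.
have z (x : nat) : x%:Z - x%:Z = 0 + 0 by rewrite subrr addr0.
have [_ _ cl] := pK.
have inE (x y : nat) : main_block k (x, y) -> (D `|` main_block k) (x, y) by right.
have outD (x y : nat) : main_block k (x, y) -> ~ D (x, y).
  by move=> Sxy Dxy; have : (main_block k `&` D) (x, y) by []; rewrite KD.
have Dlt (x y : nat) : (0 < x)%N -> (0 < y)%N -> ~ D (x, y) -> F (y%:Z - x%:Z) < x%:Z.
  by move=> x0 y0 nD; rewrite ltNge; apply/negP => h; apply: nD; apply/DF.
have S11 : main_block k ((2 * k).+1, (2 * k).+1) by rewrite /main_block /=; clear; lia.
have S12 : main_block k ((2 * k).+1, (2 * k).+2) by rewrite /main_block /=; clear; lia.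
have F0 : F (0 + 0) < 2 * k%:Z + 1.
  have := Dlt (2 * k).+1 (2 * k).+1 isT isT (outD _ _ S11).
  by rewrite z; move: (F (0 + 0)); clear; lia.
have F0k : F (0 + 0) = 2 * k%:Z.
  have [k0|k0] := eqVneq k 0%N; first by have := profile_ge0 (0 + 0) pF; move: F0 Fm k0; clear; lia.
  have : (D `|` main_block k) ((2 * k)%N, (2 * k)%N).
    by apply: (cl _ _ _ _ (inE _ _ S11)); move: k0; clear; lia.
  case; last by rewrite /main_block /=; clear; lia.
  move=> /DF[_ _]; move: F0 Fm; rewrite z.
  by move: (F (0 + 0)); clear; lia.
have F2 : 2 * k%:Z <= F (0 + 2).
  have [k0|k0] := eqVneq k 0%N; first by have := profile_ge0 (0 + 2) pF; move: k0; clear; lia.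
  have : (D `|` main_block k) ((2 * k)%N, (2 * k).+2).
    by apply: (cl _ _ _ _ (inE _ _ S12)); move: k0; clear; lia.
  case; last by rewrite /main_block /=; clear; lia.
  move=> /DF[_ _]; have -> : (2 * k).+2%:Z - (2 * k)%N%:Z = 0 + 2 by clear; lia.
  by move: (F _); clear; lia.
apply: nch; apply/(main_block_changed A0 Sp); left; split=> //.
have [_ s1 s2] := strip_steps 0; move: s1 s2 F2 F0k.
move: (F (0 + 0)) (F (0 + 1)) (F (0 + 2)); clear.
by case: (B (0 + 1)); case: (B (0 + 2)) => /=; lia.
Qed.

(** Removal leaves (2k + 3, 2k + 3) and (2k + 1, 2k + 3) unsupported, so both are outside D. With
    evenness this gives F 0 = 2k + 2 and beads at 1 and 2. *)
Lemma main_not_removable i j : A 0 -> `|j%:Z - i%:Z| <= 1 -> R (i, j) ->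
  ~ changed (i, j) -> ~ removable D (K (i, j)).
Proof.
move=> A0 near Rp nch; have Sp := residue_main_block A0 near Rp.
move: (i.-1)./2 Sp => k Sp; rewrite (main_block_class A0 Sp) => -[KD pK].
have [m [Fm _ _]] := main_facts A0.
have z (x : nat) : x%:Z - x%:Z = 0 + 0 by rewrite subrr addr0.
have [_ _ cl] := pK.
have out (x y : nat) : main_block k (x, y) -> ~ (D `\` main_block k) (x, y).
  by move=> Sxy [].
have S12 : main_block k ((2 * k).+1, (2 * k).+2) by rewrite /main_block /=; clear; lia.
have S22 : main_block k ((2 * k).+2, (2 * k).+2) by rewrite /main_block /=; clear; lia.
have F0 : 2 * k%:Z + 2 <= F (0 + 0).
  have /DF[_ _] := KD _ S22; rewrite z.
  by move: (F (0 + 0)); clear; lia.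
have F0k : F (0 + 0) = 2 * k%:Z + 2.
  have [//|h] : F (0 + 0) = 2 * k%:Z + 2 \/ 2 * k%:Z + 4 <= F (0 + 0).
    by move: F0 Fm; clear; lia.
  case: (out _ _ S22); apply: (cl (2 * k).+3 (2 * k).+3); [split|clear; lia|clear; lia]; last by rewrite /main_block /=; clear; lia.
  apply/DF; split=> //; move: h; rewrite z.
  by move: (F (0 + 0)); clear; lia.
have F2 : F (0 + 2) < 2 * k%:Z + 1.
  rewrite ltNge; apply/negP => h.
  case: (out _ _ S12); apply: (cl (2 * k).+1 (2 * k).+3); [split|clear; lia|clear; lia]; last by rewrite /main_block /=; clear; lia.
  apply/DF; split=> //; have -> : (2 * k).+3%:Z - (2 * k).+1%:Z = 0 + 2 by clear; lia.
  by move: h; clear; lia.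
apply: nch; apply/(main_block_changed A0 Sp); right; split=> //.
have [_ s1 s2] := strip_steps 0; move: s1 s2 F2 F0k.
move: (F (0 + 0)) (F (0 + 1)) (F (0 + 2)); clear.
by case: (B (0 + 1)); case: (B (0 + 2)) => /=; lia.
Qed.

Lemma residue_class_sym i j x y : K (i, j) (x, y) -> K (j, i) (y, x).
Proof.
suff : K (i, j) `<=` [set q | K (j, i) (q.2, q.1)] by move=> h /h.
apply: residue_class_closed; first exact: residue_class_refl.
move=> [a b] [a' b'] /= Kq Rq Rq' e; apply: (residue_class_step Kq).
- exact: residue_sym.
- exact: residue_sym.
- by move: e; rewrite /share_edge /=; lia.
Qed.

Lemma partition_transpose (E : diagram) : is_partition E -> is_partition (transpose E).
Proof.
move=> [fE pE cE]; split=> [|i j /pE[]//|i j i' j' Eij hi hj]; last exact: cE Eij hj hi.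
have -> : transpose E = (fun q => (q.2, q.1)) @` E.
  apply/seteqP; split=> [[i j] h|q [[i j] h <-] //].
  by exists (j, i).
exact: finite_image.
Qed.

Lemma class_transpose i j : transpose (K (i, j)) = K (j, i).
Proof. by apply/seteqP; split=> [[x y] /residue_class_sym|[x y] /residue_class_sym]. Qed.

Lemma diagram_transpose : transpose D = D.
Proof.
by apply/seteqP; split=> [[x y] /(profile_diagram_sym symF DF)|[x y] /(profile_diagram_sym symF DF)].
Qed.

Lemma addable_sym i j : addable D (K (i, j)) -> addable D (K (j, i)).
Proof.
move=> [KD pK]; rewrite -class_transpose; split.
  apply/seteqP; split=> -[x y] //= [Kxy /(profile_diagram_sym symF DF) Dxy].
  by have : (K (i, j) `&` D) (y, x) by []; rewrite KD.
by rewrite -[X in X `|` _]diagram_transpose; exact: partition_transpose pK.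
Qed.

Lemma removable_sym i j : removable D (K (i, j)) -> removable D (K (j, i)).
Proof.
move=> [KD pK]; rewrite -class_transpose; split.
  by move=> [x y] /KD; exact: (proj1 (profile_diagram_sym symF DF _ _)).
by rewrite -[X in X `\` _]diagram_transpose; exact: partition_transpose pK.
Qed.

Lemma near_cases i j : (exists c0 : int, A c0 /\ `|j%:Z - i%:Z - c0| <= 1) ->
  [\/ exists2 c0 : int, A c0 /\ 0 < c0 & `|j%:Z - i%:Z - c0| <= 1,
      A 0 /\ `|j%:Z - i%:Z| <= 1 |
      exists2 c0 : int, A c0 /\ 0 < c0 & `|i%:Z - j%:Z - c0| <= 1].
Proof.
move=> [c0 [Ac0 near]]; have [c00|c00|c00] := ltgtP c0 0.
- by constructor 3; exists (- c0); [split; [exact: symA|lia]|lia].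
- by constructor 1; exists c0.
- by constructor 2; rewrite c00 subr0 in Ac0 near.
Qed.

Lemma double_residue p : changed p -> R p.
Proof.
case: p => i j ch; have [i0 j0 /near_cases[[c0 [A0 p0] near]|[A0 near]|[c0 [A0 p0] near]]] := changed_near ch.
- exact: upper_changed_residue A0 p0 i0 j0 near ch.
- exact: main_changed_residue.
- apply: residue_sym; apply: (upper_changed_residue A0 p0 j0 i0 near).
  exact: (changed_sym DF DF' symF symF').
Qed.

Lemma double_closed p : changed p -> K p `<=` changed.
Proof.
case: p => i j ch; have [i0 j0 /near_cases[[c0 [A0 p0] near]|[A0 near]|[c0 [A0 p0] near]]] := changed_near ch.
- exact: upper_closed A0 p0 near ch.
- exact: main_closed.
- move=> [x y] /residue_class_sym h; apply: (changed_sym DF DF' symF symF').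
  exact: (upper_closed A0 p0 near (changed_sym DF DF' symF symF' ch)) h.
Qed.

Lemma double_not_addable p : R p -> ~ changed p -> ~ addable D (K p).
Proof.
case: p => i j Rp ch; have [i0 j0 /near_cases[[c0 [A0 p0] near]|[A0 near]|[c0 [A0 p0] near]]] := residue_near Rp.
- by have [] := upper_mixed A0 p0 near Rp ch.
- exact: main_not_addable.
- move=> /addable_sym; have [|//] := upper_mixed A0 p0 near (residue_sym Rp) _.
  by move=> /(changed_sym DF DF' symF symF').
Qed.

Lemma double_not_removable p : R p -> ~ changed p -> ~ removable D (K p).
Proof.
case: p => i j Rp ch; have [i0 j0 /near_cases[[c0 [A0 p0] near]|[A0 near]|[c0 [A0 p0] near]]] := residue_near Rp.
- by have [] := upper_mixed A0 p0 near Rp ch.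
- exact: main_not_removable.
- move=> /removable_sym; have [|//] := upper_mixed A0 p0 near (residue_sym Rp) _.
  by move=> /(changed_sym DF DF' symF symF').
Qed.

Let partD := profile_diagram_partition pF symF DF.
Let partD' := profile_diagram_partition pF' symF' DF'.

Lemma double_add :
  (forall c : int, A c -> (B (c + 1) -> B (c - 1)) /\ (B (c + 2) -> B c)) ->
  add_components t n r D = D'.
Proof.
move=> asc; apply: (add_changed partD partD' double_residue double_closed) double_not_addable.
move=> [i j] /DF[i0 j0 h]; apply/DF'; split=> //; apply: (le_trans h).
have [[c0 [A0 near]]|far] := EM (exists c0 : int, A c0 /\ `|j%:Z - i%:Z - c0| <= 1); last first.
  rewrite profile_double_off // => c0 A0; rewrite ltNge; apply/negP => near.
  by apply: far; exists c0.
have [f0 f1 f2] := profile_double_at A0; have [] := asc _ A0.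
have [->|[->|->]] : j%:Z - i%:Z = c0 - 1 \/ j%:Z - i%:Z = c0 \/ j%:Z - i%:Z = c0 + 1.
  by clear -near; lia.
- rewrite f0 => + _; move: (F _) (B (c0 - 1)) (B (c0 + 1)); clear => x [] [] /= h; lia.
- rewrite f1; move: (F _) (B (c0 - 1)) (B (c0 + 1)) (B c0) (B (c0 + 2)).
  by clear => x [] [] [] [] /= h h'; lia.
- rewrite f2 => _; move: (F _) (B c0) (B (c0 + 2)); clear => x [] [] /= h; lia.
Qed.

Lemma double_remove :
  (forall c : int, A c -> (B (c - 1) -> B (c + 1)) /\ (B c -> B (c + 2))) ->
  remove_components t n r D = D'.
Proof.
move=> des; apply: (remove_changed partD partD' double_residue double_closed) double_not_removable.
move=> [i j] /DF'[i0 j0 h]; apply/DF; split=> //; apply: (le_trans h).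
have [[c0 [A0 near]]|far] := EM (exists c0 : int, A c0 /\ `|j%:Z - i%:Z - c0| <= 1); last first.
  rewrite profile_double_off // => c0 A0; rewrite ltNge; apply/negP => near.
  by apply: far; exists c0.
have [f0 f1 f2] := profile_double_at A0; have [] := des _ A0.
have [->|[->|->]] : j%:Z - i%:Z = c0 - 1 \/ j%:Z - i%:Z = c0 \/ j%:Z - i%:Z = c0 + 1.
  by clear -near; lia.
- rewrite f0 => + _; move: (F _) (B (c0 - 1)) (B (c0 + 1)); clear => x [] [] /= h; lia.
- rewrite f1; move: (F _) (B (c0 - 1)) (B (c0 + 1)) (B c0) (B (c0 + 2)).
  by clear => x [] [] [] [] /= h h'; lia.
- rewrite f2 => _; move: (F _) (B c0) (B (c0 + 2)); clear => x [] [] /= h; lia.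
Qed.

End Double.

(** * Residues *)

Section Residues.

Variables (t : quotient_type) (n : nat).
Hypothesis hn : (min_rank t <= n)%N.
Local Notation L := ((2 * n)%N%:Z).

Let n1 : (1 < n)%N := rank_gt1 hn.

Lemma diag_classE (x y : nat) (m s : int) : y%:Z - x%:Z = m * L + s ->
  - L <= s < L -> diag_class n x y = absz (if 0 <= s then s else L + s).
Proof.
move=> c hs; rewrite /diag_class c; congr absz; case: ifP => s0.
  by rewrite modzMDl modz_small; lia.
have -> : m * L + s = (m - 1) * L + (L + s) by lia.
by rewrite modzMDl modz_small; lia.
Qed.

Lemma diag_decomp (c : int) : exists m s : int, c = m * L + s /\ - n%:Z < s <= n%:Z.
Proof. exact: (position_centered hn). Qed.

Lemma escalatorP (x y : nat) :
  reflect (exists m : int, `|y%:Z - x%:Z - (m * L + n%:Z)| <= 1)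
    (diag_class n x y \in escalator n).
Proof.
rewrite /escalator !inE; apply: (iffP idP) => [h|[m hm]].
  have [m [s [c hs]]] := diag_decomp (y%:Z - x%:Z).
  rewrite (diag_classE c) in h; last by lia.
  by move: h; case: lerP => s0 h; [exists m|exists (m - 1)]; lia.
have c : y%:Z - x%:Z = m * L + (y%:Z - x%:Z - m * L) by lia.
rewrite (diag_classE c); last by lia.
by case: lerP; lia.
Qed.

Lemma descalatorP (x y : nat) :
  reflect (exists m : int, `|y%:Z - x%:Z - m * L| <= 1)
    (diag_class n x y \in descalator n).
Proof.
rewrite /descalator !inE; apply: (iffP idP) => [h|[m hm]].
  have [m [s [c hs]]] := diag_decomp (y%:Z - x%:Z).
  rewrite (diag_classE c) in h; last by lia.
  by move: h; case: lerP => s0 h; exists m; lia.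
have c : y%:Z - x%:Z = m * L + (y%:Z - x%:Z - m * L) by lia.
rewrite (diag_classE c); last by lia.
by case: lerP; lia.
Qed.

Lemma escalator_index (x y : nat) (m : int) : `|y%:Z - x%:Z - (m * L + n%:Z)| <= 1 ->
  (index (diag_class n x y) (escalator n))%:Z = y%:Z - x%:Z - (m * L + n%:Z) + 1.
Proof.
move=> hm; have c : y%:Z - x%:Z = m * L + (y%:Z - x%:Z - m * L) by lia.
rewrite (diag_classE c); last by lia.
by case: lerP => s0 /=; do ![case: eqP => //= ?]; lia.
Qed.

Lemma descalator_index (x y : nat) (m : int) : `|y%:Z - x%:Z - m * L| <= 1 ->
  (index (diag_class n x y) (descalator n))%:Z = y%:Z - x%:Z - m * L + 1.
Proof.
move=> hm; have c : y%:Z - x%:Z = m * L + (y%:Z - x%:Z - m * L) by lia.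
rewrite (diag_classE c); last by lia.
by case: lerP => s0 /=; do ![case: eqP => //= ?]; lia.
Qed.

Lemma fixed_residue_active (x y r : nat) : (r <= n)%N ->
  r = fixed_residue n x y <-> active n r (y%:Z - x%:Z).
Proof.
move=> rn; have [m [s [c hs]]] := diag_decomp (y%:Z - x%:Z).
rewrite /fixed_residue (diag_classE c); last by lia.
have L0 : 0 <= L by lia.
split.
  by case: (lerP 0 s) => s0; case: leqP => h rE; exists m; lia.
move=> [k kE]; have [Q|Q|Q|Q] := mulz_cases m k L0; subst;
 case: (lerP 0 s) => s0; case: leqP => h; lia.
Qed.

Lemma active_sym (r : nat) (c : int) : active n r c -> active n r (- c).
Proof. by move=> [m [->|->]]; exists (- m); [right|left]; lia. Qed.

Variables (B : int -> bool) (F : int -> int) (D : diagram).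
Hypothesis pF : profile B F.
Hypothesis symF : forall c : int, F (- c) = F c + c.
Hypothesis DF : profile_diagram F D.

Local Notation ends c0 i d := (B (c0 + d) /\ F (c0 + d) = i%:Z - 1).

(** Case d of the rule is a row whose bead sits at c0 + d - 1, with c0 the middle diagonal of the
    strip. The bound 1 < c0 prevents truncated subtraction and keeps the row end positive. *)
Lemma upper_residueE (s : seq nat) (a b r x y k : nat) (c0 : int) :
  (0 < x)%N -> 1 < c0 -> (k <= 2)%N ->
  index (diag_class n x y) s = k -> k%:Z = y%:Z - x%:Z - c0 + 1 ->
  upper_residue s a b n D x y r <->
    exists2 d : nat, ends c0 x (d%:Z - 1) & r \in strip_residues a b d k.
Proof.
move=> x0 far k2 idx kE; rewrite /upper_residue idx.
have rowE (d : nat) : row_ends D x ((y - k).-1 + d)%N <-> ends c0 x (d%:Z - 1).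
  apply: iff_trans (row_ends_profile pF DF x0 _) _; first by lia.
  have -> // : ((y - k).-1 + d).+1%:Z - x%:Z = c0 + (d%:Z - 1) by lia.
by split=> -[d h1 h2]; exists d => //; exact/rowE.
Qed.

Lemma upper_residue_b (s : seq nat) (a b x y k : nat) (c0 : int) :
  (0 < x)%N -> 1 < c0 -> (k <= 2)%N -> a != b ->
  index (diag_class n x y) s = k -> k%:Z = y%:Z - x%:Z - c0 + 1 ->
  upper_residue s a b n D x y b <-> strip_box B F c0 x (y%:Z - x%:Z).
Proof.
move=> x0 far k2 ab idx kE.
apply: iff_trans (upper_residueE _ _ _ x0 far k2 idx kE) _.
have cE : y%:Z - x%:Z = c0 - 1 + k%:Z by lia.
rewrite cE /strip_box /=; split.
  move=> [d]; have [->|[->|->]] : k = 0%N \/ k = 1%N \/ k = 2%N by lia.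
  - move: d => [|[|[|[|d]]]] //= h; rewrite ?inE ?(eq_sym b a) ?(negPf ab) ?eqxx //= => _;
      left; split; [lia|move: h; tauto|lia|move: h; tauto].
  - move: d => [|[|[|[|d]]]] //= h; rewrite ?inE ?(eq_sym b a) ?(negPf ab) ?eqxx //= => _;
      right; left; (split; [lia|move: h; tauto]).
  - move: d => [|[|[|[|d]]]] //= h; rewrite ?inE ?(eq_sym b a) ?(negPf ab) ?eqxx //= => _;
      right; right; (split; [lia|move: h; tauto]).
move=> [[kk h]|[[kk h]|[kk h]]].
- have -> : k = 0%N by lia.
  by case: h => h; [exists 0%N|exists 2%N]; rewrite ?inE ?eqxx ?orbT.
- have -> : k = 1%N by lia.
  by case: h => [h|[h|[h|h]]]; [exists 0%N|exists 1%N|exists 2%N|exists 3%N]; rewrite ?inE ?eqxx ?orbT.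
- have -> : k = 2%N by lia.
  by case: h => h; [exists 1%N|exists 3%N]; rewrite ?inE ?eqxx ?orbT.
Qed.

Lemma upper_residue_a (s : seq nat) (a b x y k : nat) (c0 : int) :
  (0 < x)%N -> 1 < c0 -> (k <= 2)%N -> a != b ->
  index (diag_class n x y) s = k -> k%:Z = y%:Z - x%:Z - c0 + 1 ->
  upper_residue s a b n D x y a <->
    (k = 0%N /\ (ends c0 x (- 1) \/ ends c0 x 0)) \/
    (k = 2%N /\ (ends c0 x 1 \/ ends c0 x 2)).
Proof.
move=> x0 far k2 ab idx kE.
apply: iff_trans (upper_residueE _ _ _ x0 far k2 idx kE) _; split.
  move=> [d]; have [->|[->|->]] : k = 0%N \/ k = 1%N \/ k = 2%N by lia.
  - by move: d => [|[|[|[|d]]]] //= h; rewrite ?inE ?(negPf ab) ?eqxx //= => _; left; tauto.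
  - by move: d => [|[|[|[|d]]]] //= h; rewrite ?inE ?(negPf ab) ?eqxx.
  - by move: d => [|[|[|[|d]]]] //= h; rewrite ?inE ?(negPf ab) ?eqxx //= => _; right; tauto.
move=> [[-> [h|h]]|[-> [h|h]]]; [exists 0%N|exists 1%N|exists 2%N|exists 3%N] => //;
  by rewrite ?inE ?eqxx ?orbT.
Qed.

Lemma upper_residue_ab (s : seq nat) (a b r x y : nat) :
  upper_residue s a b n D x y r -> r = a \/ r = b.
Proof.
rewrite /upper_residue; move: (index _ s) => k [d _].
by move: d k => [|[|[|[|d]]]] [|[|[|k]]] //=; rewrite ?inE //;
  repeat case/orP; move=> /eqP ->; tauto.
Qed.

Local Notation R := (has_residue t n D).

Lemma escalator_sym x y : (diag_class n x y \in escalator n) = (diag_class n y x \in escalator n).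
Proof.
by apply/idP/idP => /escalatorP[m hm]; apply/escalatorP; exists (- m - 1); lia.
Qed.

Lemma descalator_sym x y : (diag_class n x y \in descalator n) = (diag_class n y x \in descalator n).
Proof.
by apply/idP/idP => /descalatorP[m hm]; apply/descalatorP; exists (- m); lia.
Qed.

Lemma strip_residue_sym s a b x y r :
  strip_residue s a b n D x y r -> strip_residue s a b n D y x r.
Proof.
rewrite /strip_residue (diagram_transpose symF DF).
by case: (ltngtP x y) => // ->.
Qed.

Lemma has_residue_sym r x y : (r <= n)%N -> R r (x, y) -> R r (y, x).
Proof.
move=> rn [x0 y0 h]; split=> //; move: h.
rewrite (escalator_sym x y) (descalator_sym x y); case: ifP => _.
  exact: strip_residue_sym.
case: ifP => _.
  rewrite [X in (if X then main_residue y x r else _)]andbC; case: ifP => _.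
    by rewrite /main_residue eq_sym addnC.
  exact: strip_residue_sym.
move=> /(fixed_residue_active _ _ rn) h; apply/(fixed_residue_active _ _ rn).
by move: (active_sym h); rewrite opprB.
Qed.

Lemma escalator_upper (x y : nat) (m : int) : sn_is_D t -> (x <= y)%N ->
  `|y%:Z - x%:Z - (m * L + n%:Z)| <= 1 -> 1 < m * L + n%:Z /\ (x < y)%N.
Proof.
move=> sD xy hm; have n2 := rank_snD hn sD; have L0 : 0 <= L by lia.
have [m0|m0] := lerP 0 m; first by have := mulr_ge0 m0 L0; lia.
have : m + 1 <= 0 by lia.
by move=> /(ler_wpM2r L0); lia.
Qed.

Lemma descalator_upper (x y : nat) (m : int) : s0_is_D t -> (x <= y)%N ->
  `|y%:Z - x%:Z - m * L| <= 1 -> (m = 0 /\ (y <= x.+1)%N) \/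
  [/\ 1 < m * L, (x < y)%N & (y <= x.+1)%N = false].
Proof.
move=> sD xy hm; have n2 := rank_s0D hn sD; have L0 : 0 <= L by lia.
have [m0|m0|m0] := ltgtP m 0.
- have : m + 1 <= 0 by lia.
  by move=> /(ler_wpM2r L0); lia.
- have : 1 <= m by lia.
  by move=> /(ler_wpM2r L0); right; split; lia.
- by left; rewrite m0 in hm *; lia.
Qed.

Lemma strip_disjoint (x y : nat) (m m' : int) : sn_is_D t -> s0_is_D t ->
  `|y%:Z - x%:Z - (m * L + n%:Z)| <= 1 -> `|y%:Z - x%:Z - m' * L| <= 1 -> False.
Proof.
move=> sD s0D; have n3 : (3 < n)%N by move: hn sD s0D; case: t.
have L0 : 0 <= L by lia.
by have [Q|Q|Q|Q] := mulz_cases m m' L0; subst; lia.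
Qed.

(** In a strip the residue a occurs only on the two outer diagonals, which are congruent to a or -
    a; so the strip rules never place it off its own diagonals. *)
Lemma single_residue_active (i x y : nat) : (i <= n)%N -> ~~ double t n i ->
  R i (x, y) -> [/\ (0 < x)%N, (0 < y)%N & active n i (y%:Z - x%:Z)].
Proof.
move=> iN nd Rxy; have [x0 y0 _] := Rxy; split=> //.
wlog xy : x y x0 y0 Rxy / (x <= y)%N => [H|].
  have [xy|xy] := leqP x y; first exact: H.
  by have := active_sym (H _ _ y0 x0 (has_residue_sym iN Rxy) (ltnW xy)); rewrite opprB.
have [_ _] := Rxy; case: ifP => [/andP[sD /escalatorP[m hm]]|nE].
  have [c1 xy'] := escalator_upper sD xy hm; rewrite /strip_residue xy' => h.
  case: (upper_residue_ab h) => iE; last by move: nd; rewrite /double; lia.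
  have idx := escalator_index hm; have nn : n.-1 != n by lia.
  have k2 : (index (diag_class n x y) (escalator n) <= 2)%N by lia.
  rewrite iE in h; have [[k _]|[k _]] := proj1 (upper_residue_a x0 c1 k2 nn erefl idx) h.
  - by exists m; left; rewrite k in idx; lia.
  - by exists (m + 1); right; rewrite k in idx; lia.
case: ifP => [/andP[sD /descalatorP[m hm]]|nD]; last first.
  by move=> /(fixed_residue_active _ _ iN).
have xy1 : (x <= y.+1)%N by lia.
have i0 : i <> 0%N by move=> i0; move: nd; rewrite /double i0 sD.
have [[m0 yx]|[c1 xy' yx]] := descalator_upper sD xy hm; rewrite xy1 yx /=.
  rewrite /main_residue; case: eqP => [//|xy2]; case: ifP => // _ -> //.
  by exists 0; left; lia.
rewrite /strip_residue xy' => h.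
case: (upper_residue_ab h) => iE //.
have idx := descalator_index hm.
have k2 : (index (diag_class n x y) (descalator n) <= 2)%N by lia.
have n10 : 1%N != 0%N by [].
rewrite iE in h; have [[k _]|[k _]] := proj1 (upper_residue_a x0 c1 k2 n10 erefl idx) h.
- by exists m; right; rewrite k in idx; lia.
- by exists m; left; rewrite k in idx; lia.
Qed.

(** The disjunction says that row x ends just before the box or at the box, and there the strip
    rules do assign the residue a. *)
Lemma single_changed_residue (i x y : nat) :
  (s0_is_D t -> ~~ odd (absz (F 0))) -> (i <= n)%N -> ~~ double t n i ->
  active n i (y%:Z - x%:Z) -> (0 < x)%N -> (0 < y)%N -> (x <= y)%N ->
  (B (y%:Z - x%:Z) /\ F (y%:Z - x%:Z) = x%:Z - 1) \/
  (~~ B (y%:Z - x%:Z) /\ B (y%:Z - x%:Z + 1) /\ F (y%:Z - x%:Z + 1) = x%:Z - 1) ->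
  R i (x, y).
Proof.
move=> evenF iN nd act x0 y0 xy H; split=> //.
have fixed := fixed_residue_active x y iN.
have L0 : 0 <= L by lia.
case: ifP => [/andP[sD /escalatorP[m hm]]|nE].
  have [c1 xy'] := escalator_upper sD xy hm; rewrite /strip_residue xy'.
  have idx := escalator_index hm; have nn : n.-1 != n by lia.
  have k2 : (index (diag_class n x y) (escalator n) <= 2)%N by lia.
  have iN' : i <> n by move=> iN'; move: nd; rewrite /double iN' eqxx sD orbT.
  have [iE kE] : i = n.-1 /\ (y%:Z - x%:Z = m * L + n%:Z - 1 \/ y%:Z - x%:Z = m * L + n%:Z + 1).
    have [k [kE|kE]] := act; have [Q|Q|Q|Q] := mulz_cases m k L0; subst; lia.
  rewrite iE; apply/(upper_residue_a x0 c1 k2 nn erefl idx).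
  case: kE => kE; rewrite kE in H idx; [left|right]; (split; [lia|]).
    move: H; rewrite subrK addr0; tauto.
  have e2 : m * L + n%:Z + 1 + 1 = m * L + n%:Z + 2 by lia.
  by move: H; rewrite e2; tauto.
case: ifP => [/andP[sD /descalatorP[m hm]]|nD]; last exact/fixed.
have n2 := rank_s0D hn sD.
have i0 : i <> 0%N by move=> i0; move: nd; rewrite /double i0 eqxx sD.
have xy1 : (x <= y.+1)%N by lia.
have [iE kE] : i = 1%N /\ (y%:Z - x%:Z = m * L - 1 \/ y%:Z - x%:Z = m * L + 1).
  have nE' : sn_is_D t -> i <> n.
    by move=> sD' iN'; move: nd; rewrite /double iN' eqxx sD' orbT.
  have [k [kE|kE]] := act; have [Q|Q|Q|Q] := mulz_cases m k L0; subst; lia.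
have [[m0 yx]|[c1 xy' yx]] := descalator_upper sD xy hm; rewrite xy1 yx /=.
  have yE : y = x.+1 by subst; lia.
  rewrite /main_residue iE yE.
  have -> : (x == x.+1) = false by lia.
  (* Both alternatives give F 0 = x, so x is even and 2x + 1 is 1 modulo 4. *)
  suff -> : ((x + x.+1) %% 4 == 1)%N by [].
  have c1 : y%:Z - x%:Z = 1 by lia.
  rewrite c1 in H; have := evenF sD; have := profile_step 1 pF.
  have f0 := profile_ge0 0 pF; rewrite subrr.
  have := profile_step (1 + 1) pF; rewrite addrK.
  move: f0 H; move: (F 0) (F 1) (F (1 + 1)) (B 1) (B (1 + 1)) => f0 f1 f2 b1 b2 h0.
  have [s xE] : exists s : nat, x = (s + s)%N \/ x = (s + s).+1 by exists x./2; lia.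
  by move: h0 xE; clear; case: b1; case: b2 => /= h0 xE H s2 s1 ev; lia.
rewrite /strip_residue xy' iE.
have idx := descalator_index hm.
have k2 : (index (diag_class n x y) (descalator n) <= 2)%N by lia.
have n10 : 1%N != 0%N by [].
apply/(upper_residue_a x0 c1 k2 n10 erefl idx).
case: kE => kE; rewrite kE in H idx; [left|right]; (split; [lia|]).
  by move: H; rewrite subrK addr0; tauto.
have e2 : m * L + 1 + 1 = m * L + 2 by lia.
by move: H; rewrite e2; tauto.
Qed.

Lemma double_residue_near (i x y : nat) : (i <= n)%N -> double t n i -> R i (x, y) ->
  [/\ (0 < x)%N, (0 < y)%N &
    exists c0 : int, active n i c0 /\ `|y%:Z - x%:Z - c0| <= 1].
Proof.
move=> iN di Rxy; have [x0 y0 _] := Rxy; split=> //.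
wlog xy : x y x0 y0 Rxy / (x <= y)%N => [H|].
  have [xy|xy] := leqP x y; first exact: H.
  have [c0 [A0 h]] := H _ _ y0 x0 (has_residue_sym iN Rxy) (ltnW xy).
  by exists (- c0); split; [exact: active_sym|lia].
have [_ _] := Rxy; case: ifP => [/andP[sD /escalatorP[m hm]]|nE].
  have [c1 xy'] := escalator_upper sD xy hm; rewrite /strip_residue xy' => h.
  have iE : i = n by case: (upper_residue_ab h) => // iE; move: di; rewrite /double; lia.
  by exists (m * L + n%:Z); split=> //; exists m; left; rewrite iE.
case: ifP => [/andP[sD /descalatorP[m hm]]|nD]; last first.
  move=> /(fixed_residue_active _ _ iN) ac; exists (y%:Z - x%:Z).
  by split=> //; rewrite subrr.
have n2 := rank_s0D hn sD.
suff i0 : i = 0%N -> exists c0 : int, active n i c0 /\ `|y%:Z - x%:Z - c0| <= 1.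
  have xy1 : (x <= y.+1)%N by lia.
  have [[m0 yx]|[c1 xy' yx]] := descalator_upper sD xy hm; rewrite xy1 yx /=.
    rewrite /main_residue; case: ifP => _; first exact: i0.
    by case: ifP => _ => iE; apply: i0 => //; move: di; rewrite /double iE; lia.
  rewrite /strip_residue xy' => h; apply: i0.
  by case: (upper_residue_ab h) => // iE; move: di; rewrite /double iE; lia.
by move=> i0; exists (m * L); split=> //; exists m; left; rewrite i0; lia.
Qed.

Lemma double_residue_upper (i x y : nat) (c0 : int) : double t n i ->
  active n i c0 -> 0 < c0 -> (0 < x)%N -> (0 < y)%N ->
  `|y%:Z - x%:Z - c0| <= 1 -> R i (x, y) <-> strip_box B F c0 x (y%:Z - x%:Z).
Proof.
move=> di ac c00 x0 y0 near; have xy : (x <= y)%N by lia.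
have [i0|iN] : i = 0%N \/ (0 < i)%N by lia.
  have sD : s0_is_D t by move: di; rewrite /double; have := n1; lia.
  have [m mE] : exists m, c0 = m * L by have [m [mE|mE]] := ac; exists m; lia.
  have hm : `|y%:Z - x%:Z - m * L| <= 1 by lia.
  have nE : sn_is_D t && (diag_class n x y \in escalator n) = false.
    apply/negbTE/negP => /andP[sD' /escalatorP[m' hm']].
    exact: strip_disjoint sD' sD hm' hm.
  have Dd : s0_is_D t && (diag_class n x y \in descalator n).
    by rewrite sD; apply/descalatorP; exists m.
  have xy1 : (x <= y.+1)%N by lia.
  have [[m0 yx]|[c1 xy' yx]] := descalator_upper sD xy hm; first by subst; lia.
  have idx := descalator_index hm.
  have k2 : (index (diag_class n x y) (descalator n) <= 2)%N by lia.
  have n10 : 1%N != 0%N by [].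
  have E := upper_residue_b x0 c1 k2 n10 erefl idx; rewrite -mE in E.
  rewrite /has_residue nE Dd xy1 yx /= /strip_residue xy' i0.
  by split=> [[_ _ /E]|/E].
have [sD iE] : sn_is_D t /\ i = n by move: di; rewrite /double; lia.
have [m mE] : exists m, c0 = m * L + n%:Z.
  by have [m [mE|mE]] := ac; [exists m|exists (m - 1)]; lia.
have hm : `|y%:Z - x%:Z - (m * L + n%:Z)| <= 1 by lia.
have Ee : sn_is_D t && (diag_class n x y \in escalator n).
  by rewrite sD; apply/escalatorP; exists m.
have [c1 xy'] := escalator_upper sD xy hm.
have idx := escalator_index hm; have nn : n.-1 != n by have := n1; lia.
have k2 : (index (diag_class n x y) (escalator n) <= 2)%N by lia.
have E := upper_residue_b x0 c1 k2 nn erefl idx; rewrite -mE in E.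
rewrite /has_residue Ee /strip_residue xy' iE.
by split=> [[_ _ /E]|/E].
Qed.

Lemma active0 (i : nat) : (i <= n)%N -> double t n i -> active n i 0 -> i = 0%N /\ s0_is_D t.
Proof.
move=> iN di [m mE]; have L0 : 0 <= L by lia.
suff i0 : i = 0%N by split=> //; move: di; rewrite /double i0; have := n1; lia.
by have [Q|Q|Q|Q] := mulz_cases 0 m L0; subst; move: di; rewrite /double; have := n1; lia.
Qed.

Lemma double_residue_main (i x y : nat) : (i <= n)%N -> double t n i -> active n i 0 ->
  (0 < x)%N -> (0 < y)%N -> `|y%:Z - x%:Z| <= 1 ->
  R i (x, y) <-> (x = y \/ odd (minn x y)).
Proof.
move=> iN di ac x0 y0 near; have [i0 sD] := active0 iN di ac.
have hm : `|y%:Z - x%:Z - 0 * L| <= 1 by lia.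
have nE : sn_is_D t && (diag_class n x y \in escalator n) = false.
  apply/negbTE/negP => /andP[sD' /escalatorP[m' hm']].
  exact: strip_disjoint sD' sD hm' hm.
have Dd : s0_is_D t && (diag_class n x y \in descalator n).
  by rewrite sD; apply/descalatorP; exists 0.
have xy1 : (x <= y.+1)%N by lia.
have yx1 : (y <= x.+1)%N by lia.
rewrite /has_residue nE Dd xy1 yx1 /= /main_residue i0.
have cE : y = x \/ y = x.+1 \/ x = y.+1 by lia.
have [s xE] : exists s : nat, x = (s + s)%N \/ x = (s + s).+1 by exists x./2; lia.
case: eqP => xy; first by split=> [_|_]; [left|split].
by case: ifP => h; split=> [[_ _ H]|H]; try split=> //; lia.
Qed.

End Residues.

(** * Abacus data of a generator, and the theorem *)

Section Generator.

Variables (t : quotient_type) (n : nat).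
Hypothesis hn : (min_rank t <= n)%N.
Local Notation N := ((period n)%:Z).
Local Notation L := ((2 * n)%N%:Z).

Variables (i : 'I_n.+1) (w u : int -> int).
Hypotheses (wg : affine_group t n w) (wu : inverses w u).

Local Notation B := (bead n u).
Local Notation B' := (bead n (u \o gen t i)).
Local Notation A := (active n i).

Let n_gt0 : (0 < n)%N := ltnW (rank_gt1 hn).
Let iN : (i <= n)%N. Proof. by have := ltn_ord i; lia. Qed.
Let wm : mirrored_perm n w. Proof. by case: wg. Qed.
Let um : mirrored_perm n u := mirrored_inv wm wu.
Let gm : mirrored_perm n (gen t i \o w) := mirrored_comp (gen_mirrored hn i) wm.
Let gwu : inverses (gen t i \o w) (u \o gen t i) := inverses_gen hn i wu.

Lemma active_sparse_single (c : int) : A c -> ~ A (c + 1).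
Proof. by move=> [m mE] [k kE]; lia. Qed.

(** The centres are 2n apart, and n >= 3 whenever a generator is of type D; hence the bound 5. *)
Lemma active_sparse_double (c c' : int) : double t n i -> A c -> A c' -> `|c - c'| <= 5 -> c = c'.
Proof.
move=> di; have n2 : (2 < n)%N.
  by move: di; rewrite /double; have := rank_s0D hn; have := rank_snD hn; lia.
have L0 : 0 <= L by lia.
have [a aE] : exists a : int, forall d : int, A d -> exists m : int, d = m * L + a.
  have [i0|i0] : i = 0%N :> nat \/ i = n :> nat by move: di; rewrite /double; lia.
    by exists 0 => d [m mE]; exists m; lia.
  by exists n%:Z => d [m [mE|mE]]; [exists m|exists (m - 1)]; lia.
move=> /aE[m ->] /aE[k ->] h.
by have [Q|Q|Q|Q] := mulz_cases m k L0; subst; lia.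
Qed.

Lemma bead_gen (p q : int) : gen t i (label n p) = label n q -> B' p = B q.
Proof. by rewrite /bead /= => ->. Qed.

Lemma single_swapped (c : int) : ~~ double t n i -> A c ->
  B' c = B (c + 1) /\ B' (c + 1) = B c.
Proof.
by move=> nd /(active_single hn nd)/(root_pair_gen hn)[h1 h2]; split; apply: bead_gen.
Qed.

Lemma double_swapped (c : int) : double t n i -> A c ->
  [/\ B' (c - 1) = B (c + 1), B' (c + 1) = B (c - 1), B' c = B (c + 2) & B' (c + 2) = B c].
Proof.
move=> di /(active_double hn di)[/(root_pair_gen hn)[h1 h2] /(root_pair_gen hn)[h3 h4]].
by split; apply: bead_gen.
Qed.

(** Twice an active diagonal is k L with k >= 0. Flushness carries a bead from 1 - p + k L to 1 - p,
    so p is a gap by antisymmetry; p = c + 2 and p = c + 1 give the two pairs. *)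
Lemma bead_upper_free (c : int) : double t n i -> A c -> 0 < c ->
  ~~ (B (c - 1) && B (c + 2)) /\ ~~ (B c && B (c + 1)).
Proof.
move=> di ac c0; have L0 : 0 <= L by lia.
have [k kE] : exists k : int, 2 * c = k * L.
  have [i0|i0] : i = 0%N :> nat \/ i = n :> nat by move: di; rewrite /double; lia.
    by have [m mE] := ac; exists (2 * m); lia.
  by have [m [mE|mE]] := ac; [exists (2 * m + 1)|exists (2 * m - 1)]; lia.
have k0 : 0 <= k.
  rewrite leNgt; apply/negP => k0; have : k <= 0 by lia.
  by move=> /(ler_wpM2r L0); lia.
have free (p q : int) : 1 - p + 2 * c = q -> ~~ (B q && B p).
  rewrite kE => qE; apply/negP => /andP[Bq Bp]; rewrite -qE in Bq.
  by have := bead_flush n_gt0 wm wu k0 Bq; rewrite (bead_anti n_gt0 wm wu) Bp.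
by split; apply: free; lia.
Qed.

(** [root_pair_le] and [root_pair_ge] spread the comparison of the basic pair to every exchanged
    pair, so all beads move in one direction. *)
Lemma core_gen :
  ((forall m : int, u (root2 i) < m * N -> u (root1 t n i) < m * N) ->
   add_components t n i (core n w) = core n (gen t i \o w)) /\
  ((forall m : int, u (root1 t n i) < m * N -> u (root2 i) < m * N) ->
   remove_components t n i (core n w) = core n (gen t i \o w)).
Proof.
have [F pF] := bead_profile n_gt0 wm wu; have [F' pF'] := bead_profile n_gt0 gm gwu.
have symF := bead_profile_sym n_gt0 wm wu pF; have symF' := bead_profile_sym n_gt0 gm gwu pF'.
have DF := core_profile n_gt0 wm wu pF; have DF' := core_profile n_gt0 gm gwu pF'.
have evenF := profile0_even hn wg wu pF.
have anti := bead_anti n_gt0 wm wu.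
have [di|nd] := boolP (double t n i).
- have sparse := fun c c' : int => @active_sparse_double c c' di.
  have swapped := fun c : int => @double_swapped c di.
  have unmoved (c : int) : ~ A (c + 1) -> ~ A c -> ~ A (c - 1) -> ~ A (c - 2) -> B' c = B c.
    by move=> h0 h1 h2 h3; apply: bead_gen; exact: inactive_double.
  have free := fun c : int => @bead_upper_free c di.
  have symA (c : int) : A c -> A (- c) by exact: (active_sym hn).
  have main_anti : A 0 -> B 2 = ~~ B (- 1) /\ B 1 = ~~ B 0.
    by move=> _; rewrite -!anti; split; congr (bead _ _ _); lia.
  have main_even : A 0 -> ~~ odd (absz (F 0)).
    by move=> /(active0 hn iN di)[_ /evenF].
  have rsym := fun x y : nat => has_residue_sym hn symF DF (x := x) (y := y) iN.
  have rnear := fun x y : nat => double_residue_near hn symF DF (x := x) (y := y) iN di.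
  have rup := fun (c0 : int) (x y : nat) =>
    double_residue_upper hn pF DF (x := x) (y := y) (c0 := c0) di.
  have rmain := fun x y : nat => double_residue_main hn (core n w) (x := x) (y := y) iN di.
  split=> h.
    apply: (double_add pF pF' symF symF' DF DF' sparse symA swapped unmoved
      free main_anti main_even rsym rnear rup rmain).
    move=> c /(active_double hn di)[r1 r2].
    by split; [exact: (root_pair_le hn um h r1)|exact: (root_pair_le hn um h r2)].
  apply: (double_remove pF pF' symF symF' DF DF' sparse symA swapped unmoved
    free main_anti main_even rsym rnear rup rmain).
  move=> c /(active_double hn di)[r1 r2].
  by split; [exact: (root_pair_ge hn um h r1)|exact: (root_pair_ge hn um h r2)].
have swapped := fun c : int => @single_swapped c nd.
have unmoved (c : int) : ~ A c -> ~ A (c - 1) -> B' c = B c.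
  by move=> h0 h1; apply: bead_gen; exact: inactive_single.
have residueA := fun x y : nat =>
  single_residue_active hn pF symF DF (x := x) (y := y) iN nd.
have residueN p : changed (core n w) (core n (gen t i \o w)) p ->
    has_residue t n (core n w) i p.
  case: p => x y ch.
  have [x0 y0] : (0 < x)%N /\ (0 < y)%N by case: ch => [[/DF[]]|[_ /DF'[]]].
  wlog xy : x y ch x0 y0 / (x <= y)%N => [H|].
    have [xy|xy] := leqP x y; first exact: H.
    apply: (has_residue_sym hn symF DF iN); apply: H => //; last exact: ltnW.
    exact: (changed_sym DF DF' symF symF').
  have := ch; move=> /(changedE DF DF' x0 y0).
  rewrite (profile_single pF pF' active_sparse_single swapped unmoved).
  case: asboolP => [ac H|_]; last by lia.
  apply: (single_changed_residue hn pF DF evenF iN nd ac x0 y0 xy).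
  have := profile_step (y%:Z - x%:Z + 1) pF; rewrite addrK.
  move: H; move: (F _) (F _) (B (y%:Z - x%:Z)) (B (y%:Z - x%:Z + 1)).
  by clear => f f1 [] [] /=; lia.
split=> h.
  apply: (single_add pF pF' symF symF' DF DF' active_sparse_single swapped unmoved
    residueA residueN).
  by move=> c /(active_single hn nd); exact: (root_pair_le hn um h).
apply: (single_remove pF pF' symF symF' DF DF' active_sparse_single swapped unmoved
  residueA residueN).
by move=> c /(active_single hn nd); exact: (root_pair_ge hn um h).
Qed.

End Generator.

Theorem theorem5p8 (t : quotient_type) (n : nat) (hn : (min_rank t <= n)%N)
    (w : int -> int) (hw : min_reps t n w)
    (lam : diagram) (hlam : lam = core n w) (i : 'I_n.+1) :
  (ascent t i w -> act t n (gen t i) lam = add_components t n i lam) /\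
  (descent t i w -> act t n (gen t i) lam = remove_components t n i lam) /\
  (~ ascent t i w -> ~ descent t i w -> act t n (gen t i) lam = lam).
Proof.
have [wg _] := hw; have [wm _ _] := wg; have [u wu] := mirrored_inverse wm.
have [wK uK] := wu; rewrite hlam act_core //.
set a := u (root1 t n i); set b := u (root2 i).
have wa : w a = root1 t n i by exact: uK.
have wb : w b = root2 i by exact: uK.
pose le := forall m : int, b < m * (period n)%:Z -> a < m * (period n)%:Z.
pose ge := forall m : int, a < m * (period n)%:Z -> b < m * (period n)%:Z.
have [addE removeE] : (le -> _) /\ (ge -> _) := core_gen hn i wg wu.
have sep (c d : int) : ~ (forall m : int, d < m * (period n)%:Z -> c < m * (period n)%:Z) ->
    exists2 m : int, d < m * (period n)%:Z & m * (period n)%:Z <= c.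
  move=> h; have [//|none] := EM (exists2 m : int, d < m * (period n)%:Z & m * (period n)%:Z <= c).
  by case: h => m dm; rewrite ltNge; apply/negP => mc; apply: none; exists m.
(* Failure of [le] gives b < m N <= a and so a descent; failure of [ge] gives a < m N <= b and so an
   ascent. *)
have not_le : ~ le -> descent t i w.
  by move=> /sep[m bm ma]; apply: (len_gen_lt hn wg wa wb); exact: lt_le_trans bm ma.
have not_ge : ~ ge -> ascent t i w.
  by move=> /sep[m am mb]; apply: (min_reps_gen hn hw wa wb am mb).
split=> [[lt _]|].
  have [/addE //|/not_le] := EM le; rewrite /descent => gt; exfalso; lia.
split=> [lt|nasc ndes].
  have [/removeE //|/not_ge[gt _]] := EM ge; move: lt; rewrite /descent => lt; exfalso; lia.
have le_w : le by apply: contrapT => nle; exact: ndes (not_le nle).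
have ge_w : ge by apply: contrapT => nge; exact: nasc (not_ge nge).
(* Both directions hold, so the result is [core n w] with boxes removed and also with boxes added;
   the two inclusions follow. *)
apply/seteqP; split=> p; first by rewrite -(removeE ge_w) => -[].
by rewrite -(addE le_w) => ?; left.
Qed.
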